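(* For integers $0\le k\le w$, \[ \sum_{\substack{\lambda:\lambda_1 \le 2w+1\\ c(\lambda)=k}} s_{\lambda}(\mathbf{x}) + \sum_{\substack{\lambda:\lambda_1 \le 2w+1\\ c(\lambda)=2w+1-k}} s_{\lambda}(\mathbf{x}) = e(\mathbf{x}) \det_{1 \le i, j \le w} \left( (p_1^{\perp})^{j-1} \big(f_{i+\chi(i>w-k)-1}(\mathbf{x})-f_{i+\chi(i>w-k)}(\mathbf{x})\big) \right), \] \[ \sum_{\substack{\lambda:\lambda_1 \le 2w+1\\ c(\lambda)=k}} s_{\lambda}(\mathbf{x}) - \sum_{\substack{\lambda:\lambda_1 \le 2w+1\\ c(\lambda)=2w+1-k}} s_{\lambda}(\mathbf{x}) = \overline{e}(\mathbf{x}) \det_{1 \le i, j \le w} \left( (p_1^{\perp})^{j-1} \big(f_{i+\chi(i>w-k)-1}(\mathbf{x})+f_{i+\chi(i>w-k)}(\mathbf{x})\big) \right), \] \[ \sum_{\substack{\lambda:\lambda_1 \le 2w\\ c(\lambda)=k}} s_{\lambda}(\mathbf{x}) + \sum_{\substack{\lambda:\lambda_1 \le 2w\\ c(\lambda)=2w-k}} s_{\lambda}(\mathbf{x}) = 2^{\chi(k=w)} \det_{1 \le i, j \le w} \left( (p_1^{\perp})^{j-1}f_{i+\chi(i>w-k)-1}(\mathbf{x}) \right), \] and, for $0\le k\le w-1$, \[ \sum_{\substack{\lambda:\lambda_1 \le 2w\\ c(\lambda)=k}} s_{\lambda}(\mathbf{x}) - \sum_{\substack{\lambda:\lambda_1 \le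 2w\\ c(\lambda)=2w-k}} s_{\lambda}(\mathbf{x}) = e(\mathbf{x}) \overline{e}(\mathbf{x}) \det_{2 \le i, j \le w} \left( (p_1^{\perp})^{j-2} \big(f_{i+\chi(i>w-k)-2}(\mathbf{x})-f_{i+\chi(i>w-k)}(\mathbf{x})\big) \right). \]
   Context: Symmetric functions are in infinitely many variables $\mathbf{x}=(x_1,x_2,\dots)$. Sums range over partitions $\lambda$ with the indicated bound on $\lambda_1$ and the indicated value of $c(\lambda)$, the number of columns of odd length of $\lambda$ (the number of $j$ with $\lambda'_j$ odd, $\lambda'$ the conjugate). $s_\lambda$ is the Schur function, $e_n$ the elementary symmetric function ($e_0=1$, $e_n=0$ for $n<0$), $f_r(\mathbf{x})=\sum_{n\in\mathbb{Z}} e_n(\mathbf{x})e_{n+r}(\mathbf{x})$, $e(\mathbf{x})=\sum_{n\ge0}e_n(\mathbf{x})$, $\overline{e}(\mathbf{x})=\sum_{n\ge0}(-1)^ne_n(\mathbf{x})$. $\chi(P)=1$ if statement $P$ is true and $0$ otherwise. With the Hall inner product $\langle s_\lambda,s_\mu\rangle=\delta_{\lambda,\mu}$, $p_1^\perp$ is the adjoint of multiplication by $p_1(\mathbf{x})=x_1+x_2+\cdots$. The determinant of an empty matrix is $1$. *)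

(* Defs.v *)
From HB Require Import structures.
From mathcomp Require Import all_boot all_order all_algebra finmap multiset.
From mathcomp Require Import boolp classical_sets functions cardinality fsbigop.

Set Implicit Arguments.
Unset Strict Implicit.
Unset Printing Implicit Defensive.

Import Order.TTheory GRing.Theory Num.Theory.
Local Open Scope classical_set_scope.
Local Open Scope mset_scope.
Local Open Scope ring_scope.

(* Formal power series over rat in the variables x_0, x_1, x_2, ... (the       *)
(* variables are indexed from 0).  A monomial is the multiset of its variable  *)
(* indices, so that the product of monomials is the sum `+` of multisets and   *)
(* the degree of a monomial is the size of the multiset.                       *)
(* Sums over infinite index sets are taken coefficient by coefficient, each    *)
(* coefficient being the finitely supported sum \sum_(i \in A) of fsbigop      *)
(* (whose value is 0 when the support is infinite; for all the families below  *)
(* it is finite).                                                              *)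

Notation monomial := {mset nat}.

Record series := Series { coef : monomial -> rat }.

Lemma seriesP (f g : series) : coef f =1 coef g -> f = g.
Proof. by case: f g => [f] [g] /= /funext ->. Qed.

HB.instance Definition _ := gen_eqMixin series.
HB.instance Definition _ := gen_choiceMixin series.

Definition series0 := Series (fun=> 0).
Definition series1 := Series (fun m => (m == mset0)%:R).
Definition series_opp (f : series) := Series (fun m => - coef f m).
Definition series_add (f g : series) := Series (fun m => coef f m + coef g m).
Definition series_mul (f g : series) :=
  Series (fun m => \sum_(p \in [set p | (p.1 `+` p.2)%mset = m])
                     (coef f p.1 * coef g p.2)).
Definition series_scale (a : rat) (f : series) := Series (fun m => a * coef f m).

Lemma series_addA : associative series_add.
Proof. by move=> f g h; apply: seriesP => m /=; rewrite addrA. Qed.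
Lemma series_addC : commutative series_add.
Proof. by move=> f g; apply: seriesP => m /=; rewrite addrC. Qed.
Lemma series_add0 : left_id series0 series_add.
Proof. by move=> f; apply: seriesP => m /=; rewrite add0r. Qed.
Lemma series_addN : left_inverse series0 series_opp series_add.
Proof. by move=> f; apply: seriesP => m /=; rewrite addNr. Qed.

HB.instance Definition _ := GRing.isZmodule.Build series
  series_addA series_addC series_add0 series_addN.

Fixpoint splits (s : seq nat) : seq (monomial * monomial) :=
  if s is x :: s' then
    [seq ((x +` p.1)%mset, p.2) | p <- splits s'] ++
    [seq (p.1, (x +` p.2)%mset) | p <- splits s']
  else [:: (mset0, mset0)].

Lemma seq_mset_nil : seq_mset [::] = mset0 :> monomial.
Proof. by apply/msetP => a; rewrite mset_seqE mset0E. Qed.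

Lemma seq_mset_cons x (s : seq nat) :
  seq_mset (x :: s) = (x +` seq_mset s)%mset.
Proof. by apply/msetP => a; rewrite mset1DE !mset_seqE /= eq_sym. Qed.

Lemma msetDI (a b c : monomial) : (a `+` b = a `+` c)%mset -> b = c.
Proof.
move=> /msetP h; apply/msetP => x; move: (h x); rewrite !msetE2.
exact: addnI.
Qed.

Lemma mem_splits (s : seq nat) (a b : monomial) :
  ((a, b) \in splits s) = ((a `+` b)%mset == seq_mset s).
Proof.
elim: s a b => [|x s IH] a b /=.
  rewrite inE seq_mset_nil; apply/eqP/eqP => [[-> ->]|/msetP h].
    by rewrite msetD0.
  by congr pair; apply/msetP => c; have := h c;
    rewrite msetE2 !mset0E => /eqP; rewrite addn_eq0 => /andP[/eqP ha /eqP hb].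
rewrite mem_cat seq_mset_cons; apply/orP/eqP => [[]|h].
- case/mapP => -[c d]; rewrite IH /= => /eqP h [-> ->].
  by rewrite -msetDA h.
- case/mapP => -[c d]; rewrite IH /= => /eqP h [-> ->].
  by rewrite msetDCA h.
have /orP [xa|xb] : (x \in a) || (x \in b).
- by rewrite -in_msetD h mset1D1.
- left; apply/mapP; exists ((a `\ x)%mset, b); last by rewrite /= msetB1K.
  rewrite IH /=; apply/eqP; apply: (@msetDI [mset x]%mset).
  by rewrite msetDA msetB1K.
- right; apply/mapP; exists (a, (b `\ x)%mset); last by rewrite /= msetB1K.
  rewrite IH /=; apply/eqP; apply: (@msetDI [mset x]%mset).
  by rewrite msetDCA msetB1K.
Qed.

Definition divs (m : monomial) := undup (splits m).

Lemma divs_uniq m : uniq (divs m). Proof. exact: undup_uniq. Qed.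

Lemma mem_divs m p : (p \in divs m) = ((p.1 `+` p.2)%mset == m).
Proof. by case: p => a b; rewrite mem_undup mem_splits seq_mset_id. Qed.

Lemma coef_mul f g m :
  coef (series_mul f g) m = \sum_(p <- divs m) coef f p.1 * coef g p.2.
Proof.
rewrite /= (fsbig_seq _ (fun p => coef f p.1 * coef g p.2) (divs_uniq m)).
by apply: eq_fsbigl; apply/seteqP; split => p /=; rewrite mem_divs => /eqP.
Qed.

Lemma series_mulA : associative series_mul.
Proof.
move=> f g h; apply: seriesP => m; rewrite !coef_mul.
under eq_bigr => p _ do rewrite coef_mul mulr_sumr.
under [RHS]eq_bigr => p _ do rewrite coef_mul mulr_suml.
pose F (t : monomial * monomial * monomial) :=
  coef f t.1.1 * coef g t.1.2 * coef h t.2.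
pose L := [seq (p.1, q.1, q.2) | p <- divs m, q <- divs p.2].
pose R := [seq (q.1, q.2, p.2) | p <- divs m, q <- divs p.1].
have -> : \sum_(p <- divs m) \sum_(q <- divs p.2)
    coef f p.1 * (coef g q.1 * coef h q.2) = \sum_(t <- L) F t.
  rewrite big_allpairs_dep; apply: eq_bigr => p _; apply: eq_bigr => q _.
  by rewrite /F mulrA.
have -> : \sum_(p <- divs m) \sum_(q <- divs p.1)
    coef f q.1 * coef g q.2 * coef h p.2 = \sum_(t <- R) F t.
  by rewrite big_allpairs_dep.
apply: perm_big; apply: uniq_perm.
- apply: allpairs_uniq_dep; rewrite ?divs_uniq //; first by move=> *; exact: divs_uniq.
  move=> z z' /allpairsPdep[[a b]] [[c d]] [_ + ->].
  move=> + /allpairsPdep[[a' b']] [[c' d']] [_ + ->] /=.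
  by rewrite !mem_divs /= => /eqP <- /eqP <- [-> -> ->].
- apply: allpairs_uniq_dep; rewrite ?divs_uniq //; first by move=> *; exact: divs_uniq.
  move=> z z' /allpairsPdep[[a b]] [[c d]] [_ + ->].
  move=> + /allpairsPdep[[a' b']] [[c' d']] [_ + ->] /=.
  by rewrite !mem_divs /= => /eqP <- /eqP <- [-> -> ->].
- move=> [[a b] c]; apply/allpairsPdep/allpairsPdep.
  + move=> [[a' b']] [[c' d']] []; rewrite !mem_divs /= => /eqP h1 /eqP h2.
    case=> -> -> ->; exists ((a' `+` c')%mset, d'), (a', c').
    by rewrite !mem_divs /= -msetDA h2 h1 !eqxx.
  + move=> [[a' b']] [[c' d']] []; rewrite !mem_divs /= => /eqP h1 /eqP h2.
    case=> -> -> ->; exists (c', (d' `+` b')%mset), (d', b').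
    by rewrite !mem_divs /= msetDA h2 h1 !eqxx.
Qed.

Lemma series_mulC : commutative series_mul.
Proof.
move=> f g; apply: seriesP => m; rewrite !coef_mul.
rewrite (perm_big [seq (p.2, p.1) | p <- divs m]) /=; last first.
  apply: uniq_perm; rewrite ?divs_uniq ?map_inj_uniq ?divs_uniq //.
    by move=> [a b] [c d] [-> ->].
  move=> [a b]; apply/idP/mapP => [h|[[c d]]].
    by exists (b, a) => //; move: h; rewrite !mem_divs /= msetDC.
  by rewrite !mem_divs /= => h [-> ->]; rewrite msetDC.
by rewrite big_map; apply: eq_bigr => p _; rewrite mulrC.
Qed.

Lemma series_mul1 : left_id series1 series_mul.
Proof.
move=> f; apply: seriesP => m; rewrite coef_mul.
rewrite (bigD1_seq (mset0, m)) ?divs_uniq ?mem_divs /= ?mset0D ?eqxx //.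
rewrite mul1r big_seq_cond big1 ?addr0 // => -[a b] /=.
rewrite mem_divs /= xpair_eqE => /andP[/eqP <-].
by case: eqP => [->|_]; rewrite ?mset0D ?eqxx // mul0r.
Qed.

Lemma series_mulDl : left_distributive series_mul series_add.
Proof.
move=> f g h; apply: seriesP => m.
transitivity (coef (series_mul f h) m + coef (series_mul g h) m) => //.
by rewrite !coef_mul -big_split; apply: eq_bigr => p _; rewrite mulrDl.
Qed.

Lemma series_oner_neq0 : series1 != series0.
Proof.
by apply/eqP => /(congr1 (coef^~ mset0)) /= /eqP; rewrite eqxx oner_eq0.
Qed.

HB.instance Definition _ := GRing.Zmodule_isComNzRing.Build series
  series_mulA series_mulC series_mul1 series_mulDl series_oner_neq0.

Lemma series_scaleA a b f :
  series_scale a (series_scale b f) = series_scale (a * b) f.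
Proof. by apply: seriesP => m /=; rewrite mulrA. Qed.
Lemma series_scale1 : left_id 1 series_scale.
Proof. by move=> f; apply: seriesP => m /=; rewrite mul1r. Qed.
Lemma series_scaleDr : right_distributive series_scale +%R.
Proof. by move=> a f g; apply: seriesP => m /=; rewrite mulrDr. Qed.
Lemma series_scaleDl f : {morph series_scale^~ f : a b / a + b}.
Proof. by move=> a b; apply: seriesP => m /=; rewrite mulrDl. Qed.

HB.instance Definition _ := GRing.Zmodule_isLmodule.Build rat series
  series_scaleA series_scale1 series_scaleDr series_scaleDl.

Definition monom (m : monomial) : series := Series (fun m' => (m' == m)%:R).

Definition ssum (I : choiceType) (A : set I) (F : I -> series) : series :=
  Series (fun m => \sum_(i \in A) coef (F i) m).

Definition symmetric_series (f : series) :=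
  forall s : nat -> nat, bijective s ->
  forall m : monomial, coef f (seq_mset (map s m)) = coef f m.

Definition bounded_degree (f : series) :=
  exists d : nat, forall m : monomial, coef f m != 0 -> (size m <= d)%N.

Definition elementary (n : nat) : series :=
  ssum [set s : seq nat | sorted ltn s /\ size s = n]
       (fun s => monom (seq_mset s)).

Definition elementaryz (n : int) : series :=
  if n is Posz n' then elementary n' else 0.

Definition f_series (r : int) : series :=
  ssum [set: int] (fun n => elementaryz n * elementaryz (n + r)).

Definition e_series : series := ssum [set: nat] elementary.

Definition ebar_series : series :=
  ssum [set: nat] (fun n => (-1) ^+ n * elementary n).

Definition p1 : series := ssum [set: nat] (fun i => monom [mset i]%mset).

Record int_partition := IntPartition {
  parts :> seq nat;
  _ : sorted geq parts && (0%N \notin parts) }.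

HB.instance Definition _ := [isSub for parts].
HB.instance Definition _ := [Choice of int_partition by <:].

Definition first_part (la : int_partition) : nat := head 0%N la.

Definition conj_part (la : int_partition) : seq nat :=
  [seq count (leq j) la | j <- iota 1 (first_part la)].

Definition odd_columns (la : int_partition) : nat := count odd (conj_part la).

(* T is the list of the rows of the tableau, from top to bottom. *)
Definition semistandard (la : int_partition) (T : seq (seq nat)) :=
  [/\ shape T = la,
      forall r, r \in T -> sorted leq r
    & forall i j, (j < nth 0%N la i.+1)%N ->
        (nth 0%N (nth [::] T i) j < nth 0%N (nth [::] T i.+1) j)%N].

Definition schur (la : int_partition) : series :=
  ssum [set T | semistandard la T] (fun T => monom (seq_mset (flatten T))).

Definition schur_expansion (f : series) (a : int_partition -> rat) :=
  f = ssum [set: int_partition] (fun la => a la *: schur la).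

(* The Schur coefficients are unique, and exist whenever f is symmetric. *)
Definition schur_coef (f : series) : int_partition -> rat :=
  xget (fun=> 0) [set a | schur_expansion f a].

(* Meaningful when f and g are symmetric and one of them has bounded degree:   *)
(* the Hall inner product extended to a pairing between symmetric series and   *)
(* symmetric functions of bounded degree.                                      *)
Definition hall (f g : series) : rat :=
  \sum_(la \in [set: int_partition]) (schur_coef f la * schur_coef g la).

Definition p1_adjoint (f g : series) :=
  symmetric_series g /\
  forall h, symmetric_series h -> bounded_degree h ->
    hall g h = hall f (p1 * h).

(* For symmetric f there is exactly one g with p1_adjoint f g. *)
Definition p1perp (f : series) : series := xget 0 [set g | p1_adjoint f g].

Definition schur_sum (b c : nat) : series :=
  ssum [set la | (first_part la <= b)%N /\ odd_columns la = c] schur.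

(* Main.v *)
(* Let E(y) = sum_i e_i y^i in N variables.  By the dual Jacobi-Trudi formula
   the left-hand sides are sums, over decreasing sequences a of length n (n being
   the bound on the first part), of the minors of (y^(n-1-p) E)_(0 <= p < n) on the
   columns a, and c(lambda) is the number of odd a_q + (n-1-q), written odd_gaps a.
   Let eps be the product of signs eta_c (none, one or two of them).  After E is
   multiplied by 1 + t y, the weight t^odd_gaps + eps t^(n - odd_gaps) becomes a
   Pfaffian of the form sgn(a-b) [a-b odd] bordered by the columns eta_c^a, so
   Cauchy-Binet turns the generating function in t into the bordered Pfaffian of
   the Gram matrix of the y^(n-1-p) E (1 + t y).  With kappa = prod_c (y - eta_c),
   the basis (1 + y) kappa (1 + y^2)^i y^(w-1-i), (y - 1) kappa (1 + y^2)^i y^(w-1-i),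
   kappa / (y - eta_c) makes that matrix block antidiagonal, and the Pfaffian
   becomes prod_c E(eta_c) times a w x w determinant of moments
   <kappa E (1 + t y), (y + 1/y)^(i+j) kappa E (1 + t y)>.  The moments of E alone
   are the f_r, on which y + 1/y acts by f_r |-> f_(r-1) + f_(r+1), that is as
   p_1^perp; a tridiagonal expansion extracts the coefficient of t^k.  The
   constants do not depend on E, and E = 1 determines them. *)

Require Import Defs.
From HB Require Import structures.
From mathcomp Require Import all_boot all_order all_algebra all_fingroup.
From mathcomp Require Import finmap multiset.
From mathcomp Require Import boolp classical_sets fsbigop.
From mathcomp Require Import zify ring.

Set Implicit Arguments.
Unset Strict Implicit.
Unset Printing Implicit Defensive.

Import Order.TTheory GRing.Theory Num.Theory.
Local Open Scope ring_scope.

(** * Bordered Pfaffians *)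

(** The identities are one formula for three border sizes, [n = w + w + r]: for [2w + 1] columns
    [r = 1], with sign 1 for the sum and -1 for the difference; for [2w] columns [r = 0] for the sum
    and [r = 2] with both signs for the difference, with [w - 1] in place of [w]. The sign between
    the two Schur sums is [sgprod]. The entries are power series, so only nonzero integers are ever
    cancelled. Hence [pf] sums over all permutations instead of dividing by the symmetries of a
    matching, the factors [1 + eta_c t] are absorbed into the entry [v 0] of a kernel vector, and a
    power of [t] disappears by reading a shifted coefficient. The determinant of the basis change
    and [pfw0] are never computed: the other constant is seen to be nonzero, and [E = 1], [k = 0],
    where both sides reduce to 1, makes the two equal. [E] is a polynomial only in finitely many
    variables, so each identity is proved after [restr N] for every [N]. The operator [p_1^perp] is
    given only through the Hall pairing, hence Schur expansions must be shown to exist and be unique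
    before it can be computed. *)

Section SignSum.
Variables w r : nat.
Local Notation n := (w + w + r)%N.

(* The indices are w pairs [pl i], [pr i] followed by the r indices [px c]. *)
Definition pl (i : 'I_w) : 'I_n := lshift r (lshift w i).
Definition pr (i : 'I_w) : 'I_n := lshift r (rshift w i).
Definition px (c : 'I_r) : 'I_n := rshift (w + w) c.

Lemma big_n (R : Type) (idx : R) (op : Monoid.com_law idx) (F : 'I_n -> R) :
  \big[op/idx]_p F p =
  op (\big[op/idx]_i op (F (pl i)) (F (pr i))) (\big[op/idx]_c F (px c)).
Proof. by rewrite big_split_ord big_split_ord big_split. Qed.

Lemma ord_n_ind (P : 'I_n -> Prop) :
  (forall i, P (pl i)) -> (forall i, P (pr i)) -> (forall c, P (px c)) ->
  forall p, P p.
Proof.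
move=> Pl Pr Px p; rewrite -(fintype.splitK p).
case: (fintype.split p) => [q|c]; last exact: Px.
rewrite -(fintype.splitK q); case: (fintype.split q) => i; [exact: Pl | exact: Pr].
Qed.

Section BorderedPfaffian.
Variables (K : comNzRingType) (I : Type).
Variables (A : I -> I -> K) (X : I -> 'I_r -> K).

Definition pfterm (phi : 'I_n -> I) : K :=
  (\prod_i A (phi (pl i)) (phi (pr i))) * \prod_c X (phi (px c)) c.

(* A multiple of the Pfaffian of [A] bordered by the columns of [X]. *)
Definition pf (phi : 'I_n -> I) : K :=
  \sum_(s : 'S_n) (-1) ^+ s * pfterm (phi \o s).

Lemma eq_pfterm phi psi : phi =1 psi -> pfterm phi = pfterm psi.
Proof. by move=> e; congr (_ * _); apply: eq_bigr => i _; rewrite !e. Qed.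

Lemma eq_pf phi psi : phi =1 psi -> pf phi = pf psi.
Proof.
by move=> e; apply: eq_bigr => s _; congr (_ * _); apply: eq_pfterm => p /=.
Qed.

Lemma pf_perm (phi : 'I_n -> I) (s : 'S_n) : pf (phi \o s) = (-1) ^+ s * pf phi.
Proof.
rewrite /pf mulr_sumr [RHS](reindex_inj (mulIg s)) /=; apply: eq_bigr => u _.
rewrite odd_permM signr_addb mulrA [X in _ = X * _]mulrCA -expr2 sqrr_sign mulr1.
by congr (_ * _); apply: eq_pfterm => p /=; rewrite permM.
Qed.

End BorderedPfaffian.

(** A permutation never puts one index in both slots of a pair, so the diagonal entries of the form
    are never read. *)
Lemma eq_pf_entries (K : comNzRingType) (I J : Type) (A : I -> I -> K) X
    (A' : J -> J -> K) X' (phi : 'I_n -> I) (phi' : 'I_n -> J) :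
  (forall p q, p != q -> A (phi p) (phi q) = A' (phi' p) (phi' q)) ->
  (forall p c, X (phi p) c = X' (phi' p) c) ->
  pf A X phi = pf A' X' phi'.
Proof.
move=> eA eX; apply: eq_bigr => s _; congr (_ * (_ * _)); apply: eq_bigr => i _ /=.
  by apply: eA; rewrite (inj_eq perm_inj) (inj_eq (@lshift_inj _ _)) eq_lrshift.
exact: eX.
Qed.

Lemma pf_morph (K L : comNzRingType) (f : {rmorphism K -> L}) I
    (A : I -> I -> K) X phi :
  f (pf A X phi) = pf (fun i j => f (A i j)) (fun i c => f (X i c)) phi.
Proof.
rewrite rmorph_sum; apply: eq_bigr => s _.
by rewrite rmorphM rmorph_sign rmorphM !rmorph_prod.
Qed.

Section Multilinear.
Variables (K : comNzRingType) (I : Type) (J : finType).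
Variables (A : I -> I -> K) (X : I -> 'I_r -> K).
Variables (W : J -> J -> K) (Y : J -> 'I_r -> K) (U : I -> J -> K).
Hypothesis AE : forall i i', A i i' = \sum_j \sum_j' U i j * U i' j' * W j j'.
Hypothesis XE : forall i c, X i c = \sum_j U i j * Y j c.

Lemma pfterm_expand phi :
  pfterm A X phi =
  \sum_(psi : {ffun 'I_n -> J}) (\prod_p U (phi p) (psi p)) * pfterm W Y psi.
Proof.
rewrite /pfterm.
under eq_bigr => i _ do rewrite AE pair_big /=.
under [X in _ * X = _]eq_bigr => c _ do rewrite XE.
rewrite !bigA_distr_bigA /= big_distrlr /= pair_big /=.
(* [h] glues the choices made on the pairs and on the border indices into a single choice on all [n]
   indices. *)
pose h (fg : {ffun 'I_w -> J * J} * {ffun 'I_r -> J}) : {ffun 'I_n -> J} :=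
  [ffun p => match fintype.split p with
     | inl q => match fintype.split q with inl i => (fg.1 i).1 | inr i => (fg.1 i).2 end
     | inr c => fg.2 c end].
have hl fg i : h fg (pl i) = (fg.1 i).1.
  by rewrite ffunE (unsplitK (inl _ _)) (unsplitK (inl _ _)).
have hr fg i : h fg (pr i) = (fg.1 i).2.
  by rewrite ffunE (unsplitK (inl _ _)) (unsplitK (inr _ _)).
have hx fg c : h fg (px c) = fg.2 c by rewrite ffunE (unsplitK (inr _ _)).
rewrite [RHS](reindex h) /=; last first.
  apply: onW_bij.
  exists (fun psi : {ffun 'I_n -> J} =>
    ([ffun i => (psi (pl i), psi (pr i))], [ffun c => psi (px c)])).
    case=> f g; congr pair; apply/ffunP => i; rewrite ffunE ?hl ?hr ?hx //=.
    by case: (f i).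
  move=> psi; apply/ffunP; apply: ord_n_ind => i.
  - by rewrite hl ffunE. - by rewrite hr ffunE. - by rewrite hx ffunE.
apply: eq_bigr => fg _.
rewrite big_n /= mulrACA -!big_split /=; congr (_ * _); apply: eq_bigr => i _.
  by rewrite hl hr.
by rewrite hx.
Qed.

(** Each index fills exactly one slot of a term, so expanding its vector over [J] contributes one
    coefficient, and the permutation can be moved onto the choice [psi]. This is Cauchy-Binet before
    sorting. *)
Lemma pf_expand phi :
  pf A X phi =
  \sum_(psi : {ffun 'I_n -> J}) (\prod_p U (phi p) (psi p)) * pf W Y psi.
Proof.
rewrite /pf; under [RHS]eq_bigr => psi _ do rewrite mulr_sumr.
rewrite exchange_big /=; apply: eq_bigr => s _; rewrite pfterm_expand mulr_sumr.
rewrite (reindex (fun psi : {ffun 'I_n -> J} => [ffun p => psi (s p)])) /=; last first.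
  apply: onW_bij; exists (fun psi : {ffun 'I_n -> J} => [ffun p => psi ((s^-1)%g p)]).
    by move=> psi; apply/ffunP => p; rewrite !ffunE permKV.
  by move=> psi; apply/ffunP => p; rewrite !ffunE permK.
apply: eq_bigr => psi _; rewrite mulrCA; congr (_ * (_ * _)).
  by rewrite [RHS](reindex_inj (@perm_inj _ s)); apply: eq_bigr => p _; rewrite ffunE.
by apply: eq_pfterm => p; rewrite ffunE.
Qed.

End Multilinear.
End SignSum.

Definition decr n M (a : {ffun 'I_n -> 'I_M}) :=
  [forall p : 'I_n, forall q : 'I_n, (p < q)%N ==> (a q < a p)%N].

Lemma decrP n M (a : {ffun 'I_n -> 'I_M}) :
  reflect (forall p q : 'I_n, (p < q)%N -> (a q < a p)%N) (decr a).
Proof.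
apply: (iffP forallP) => h p; last by apply/forallP => q; apply/implyP; exact: h.
by move=> q pq; exact: (implyP (forallP (h p) q)).
Qed.

Lemma decr_inj n M (a : {ffun 'I_n -> 'I_M}) : decr a -> injective a.
Proof.
move/decrP => h p q e; apply: val_inj; case: (ltngtP p q) => // /h.
  by rewrite e ltnn.
by rewrite e ltnn.
Qed.

(** * Cauchy-Binet for alternating weights *)

Section Sorting.
Variables (n M : nat).
Implicit Types (a psi : {ffun 'I_n -> 'I_M}).

Let geo := (fun x y : 'I_M => y <= x)%N.
Definition dsort psi : {ffun 'I_n -> 'I_M} :=
  [ffun p => tnth (sort_tuple geo [tuple psi i | i < n]) p].

Let geo_trans : transitive geo.
Proof. by move=> y x z xy yz; apply: leq_trans yz xy. Qed.
Let geo_total : total geo.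
Proof. by move=> x y; apply: leq_total. Qed.

Lemma decr_sorted a : decr a -> sorted geo [tuple a i | i < n].
Proof.
move=> /decrP h; case: n a h => [|m] a h; first by rewrite tuple0.
apply/(sortedP (a ord0)) => i; rewrite size_tuple => i1.
have i0 := ltnW i1.
rewrite -[i.+1]/(nat_of_ord (Ordinal i1)) -[X in nth _ _ X]/(nat_of_ord (Ordinal i0)).
rewrite -!tnth_nth !tnth_mktuple /geo ltnW //; exact: h.
Qed.

Lemma dsort_perm psi (s : 'S_n) : decr psi -> dsort [ffun p => psi (s p)] = psi.
Proof.
move=> dp; pose phi : {ffun 'I_n -> 'I_M} := [ffun p => psi (s p)].
apply/ffunP => p; rewrite -/phi ffunE.
suff -> : sort_tuple geo [tuple phi i | i < n] = [tuple psi i | i < n].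
  by rewrite tnth_mktuple.
apply: val_inj => /=.
apply: (sorted_eq geo_trans).
- by move=> x y /andP[xy yx]; apply/val_inj/eqP; rewrite eqn_leq; apply/andP.
- exact: sort_sorted.
- exact: decr_sorted.
rewrite perm_sort; apply/(@tuple_permP _ n _ [tuple psi i | i < n]); exists s.
rewrite -[LHS]/(tval [tuple phi i | i < n]); congr tval.
by apply: eq_from_tnth => i; rewrite !tnth_mktuple ffunE.
Qed.

Lemma dsortP psi : injective psi ->
  decr (dsort psi) /\ exists s : 'S_n, psi = [ffun p => dsort psi (s p)].
Proof.
move=> ip; split.
  apply/decrP => p q pq; rewrite !ffunE.
  set t := sort_tuple _ _.
  have ut : uniq t by rewrite sort_uniq map_inj_uniq ?enum_uniq.
  have st : sorted geo t by exact: sort_sorted.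
  rewrite ltn_neqAle; apply/andP; split; last first.
    have x0 := tnth t p; rewrite !(tnth_nth x0).
    by apply: (sorted_ltn_nth geo_trans) => //; rewrite inE size_tuple.
  rewrite (inj_eq val_inj); have x0 := tnth t p; rewrite !(tnth_nth x0).
  by rewrite nth_uniq ?size_tuple // gtn_eqF.
have : perm_eq [tuple psi i | i < n] (sort_tuple geo [tuple psi i | i < n]).
  by rewrite /= perm_sym perm_sort.
case/(@tuple_permP _ n _ (sort_tuple _ _)) => s e; exists s; apply/ffunP => p; rewrite !ffunE.
move/val_inj: e => /(congr1 (fun t => tnth t p)).
by rewrite !tnth_mktuple.
Qed.

(** An injective sequence is a decreasing one composed with exactly one permutation; [dsort]
    recovers the decreasing one. *)
Lemma sum_injective (K : nmodType) (F : {ffun 'I_n -> 'I_M} -> K) :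
  (forall psi, ~~ injectiveb psi -> F psi = 0) ->
  \sum_psi F psi = \sum_(a | decr a) \sum_(s : 'S_n) F [ffun p => a (s p)].
Proof.
move=> F0; rewrite (bigID (fun psi : {ffun _} => injectiveb psi)) /=.
rewrite [X in _ + X]big1 ?addr0 //.
rewrite (partition_big dsort (fun a => decr a)) /=; last first.
  by move=> psi /injectiveP /dsortP [].
apply: eq_bigr => a da.
rewrite -[RHS](big_map (fun s : 'S_n => [ffun p => a (s p)]) xpredT F) -big_filter.
apply: perm_big; apply: uniq_perm.
- by rewrite filter_uniq // index_enum_uniq.
- rewrite map_inj_uniq ?index_enum_uniq // => s u /ffunP e; apply/permP => p.
  by move: (e p); rewrite !ffunE => /(decr_inj da).
move=> psi; rewrite mem_filter mem_index_enum andbT; apply/andP/mapP.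
  move=> [/injectiveP ip /eqP e]; have [_ [s ps]] := dsortP ip.
  by exists s; rewrite ?mem_index_enum // ps e.
move=> [s _ ->]; rewrite dsort_perm // eqxx; split=> //.
by apply/injectiveP => p q; rewrite !ffunE => /(decr_inj da) /perm_inj.
Qed.

(** The alternating weight [c] takes the place of the second minor; it will be a bordered
    Pfaffian. *)
Lemma cauchy_binet (K : comNzRingType) (U : 'I_n -> 'I_M -> K)
    (c : {ffun 'I_n -> 'I_M} -> K) :
  (forall psi, ~~ injectiveb psi -> c psi = 0) ->
  (forall psi (s : 'S_n), c [ffun p => psi (s p)] = (-1) ^+ s * c psi) ->
  \sum_(psi : {ffun 'I_n -> 'I_M}) (\prod_p U p (psi p)) * c psi =
  \sum_(a : {ffun 'I_n -> 'I_M} | decr a) \det (\matrix_(p, q) U p (a q)) * c a.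
Proof.
move=> c0 ca; rewrite sum_injective; last by move=> psi /c0 ->; rewrite mulr0.
apply: eq_bigr => a _; rewrite /determinant mulr_suml; apply: eq_bigr => s _.
rewrite ca mulrCA mulrA; congr (_ * _ * _).
by apply: eq_bigr => p _; rewrite ffunE mxE.
Qed.

End Sorting.

(** * The parity form *)

Definition parity_form (a b : nat) : int :=
  if odd (a + b) then (if (b < a)%N then 1 else -1) else 0.

Lemma parity_form_skew a b : parity_form b a = - parity_form a b.
Proof.
rewrite /parity_form addnC; case o: (odd _); last by rewrite oppr0.
case: (ltngtP a b) => // e; by move: o; rewrite e addnn odd_double.
Qed.

Lemma parity_formDl a b d : parity_form (d + a) (d + b) = parity_form a b.
Proof.
rewrite /parity_form ltn_add2l addnACA addnn oddD odd_double.
by case: ifP.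
Qed.

(** A shift by two keeps the parity and changes the order only across [b = a + 1]. This jump is what
    later turns the parity pairing into the pairing of coefficients. *)
Lemma parity_formSS a b :
  parity_form a.+2 b - parity_form a b = ((a.+1 == b)%:R : int) *+ 2.
Proof.
rewrite /parity_form !addSn /= negbK; case o: (odd (a + b)) => /=.
  case: (ltngtP b a) => h.
  - by rewrite ifT ?(leq_trans h) ?leqW // subrr (gtn_eqF (leqW h)).
  - case: (eqVneq a.+1 b) => [<-|nb]; first by rewrite leqnn.
    by rewrite ifF ?subrr //; apply/negbTE; lia.
  - by move: o; rewrite h addnn odd_double.
case: eqP => [e|//]; by move: o; rewrite -e addnS addnn /= odd_double.
Qed.

Section ParityWeights.
Variables (w r : nat).
Local Notation n := (w + w + r)%N.
Variable eta : 'I_r -> int.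

Definition sign_form (a : nat) (c : 'I_r) : int := eta c ^+ a.
Definition pfw (phi : 'I_n -> nat) : int := pf parity_form sign_form phi.

Hypothesis eta_sq : forall c, eta c ^+ 2 = 1.

Lemma eta_expD2 c a b : odd a = odd b -> eta c ^+ a = eta c ^+ b.
Proof.
move=> o; rewrite -(odd_double_half a) -(odd_double_half b) o !exprD -!muln2.
by rewrite !(mulnC _ 2%N) !exprM eta_sq !expr1n.
Qed.

(** Exchanging two values of equal parity with no other value between them changes neither the form
    nor the border, yet it reverses the sign of the Pfaffian. *)
Lemma pfw_eq0 (phi : 'I_n -> nat) p q : p != q -> odd (phi p) = odd (phi q) ->
  (forall k, k != p -> k != q -> (phi k < phi p)%N = (phi k < phi q)%N) ->
  pfw phi = 0.
Proof.
move=> pq o h.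
suff : pfw (phi \o tperm p q) = pfw phi
  by rewrite /pfw pf_perm odd_tperm pq expr1 mulN1r; set x := pf _ _ _; lia.
have W1 k : k != p -> k != q ->
    parity_form (phi p) (phi k) = parity_form (phi q) (phi k).
  by move=> kp kq; rewrite /parity_form !oddD o h.
have W2 k : k != p -> k != q ->
    parity_form (phi k) (phi p) = parity_form (phi k) (phi q).
  by move=> kp kq; rewrite (parity_form_skew (phi p)) (parity_form_skew (phi q)) W1.
have W0 : parity_form (phi p) (phi q) = 0 by rewrite /parity_form oddD o addbb.
have W0' : parity_form (phi q) (phi p) = 0 by rewrite parity_form_skew W0.
apply: eq_pf_entries => [k l kl|k c] /=.
  case: tpermP => [kE|kE|kp kq]; case: tpermP => [lE|lE|lp lq]; subst;
    rewrite ?eqxx // in kl *; rewrite ?W0 ?W0' //.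
  - by rewrite W1 //; apply/eqP.
  - by rewrite W1 //; apply/eqP.
  - by rewrite W2 //; apply/eqP.
  - by rewrite W2 //; apply/eqP.
by case: tpermP => [->|->|//]; apply: eta_expD2.
Qed.

Definition pfw0 : int := pfw (fun p => n.-1 - p)%N.
Definition sgprod : int := \prod_c eta c.

(** The parity form sees only order and parity, so [phi] cannot be told from the staircase
    [n.-1 - p]; a common parity shift [b] only multiplies the border column [c] by [eta c ^+ b]. *)
Lemma pfw_alternating (phi : 'I_n -> nat) b :
  (forall p q : 'I_n, (p < q)%N -> (phi q < phi p)%N) ->
  (forall p, odd (phi p + (n.-1 - p)) = b) ->
  pfw phi = sgprod ^+ b * pfw0.
Proof.
move=> dec par.
transitivity (pf parity_form (fun a c => eta c ^+ b * sign_form a c)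
               (fun p : 'I_n => n.-1 - p)%N).
  apply: eq_pf_entries => [p q pq|p c].
    rewrite /parity_form; have := par p; have := par q; rewrite !oddD.
    case: (ltngtP p q) => [l|l|/val_inj e]; last by rewrite e eqxx in pq.
    - have := dec _ _ l; have := ltn_ord q; move: (phi p) (phi q) => u v.
      case: (odd u); case: (odd v); case: (odd (_ - p)); case: (odd (_ - q));
        rewrite /= => ? ? <- //; rewrite ?ifT //; lia.
    - have := dec _ _ l; have := ltn_ord p; move: (phi p) (phi q) => u v.
      case: (odd u); case: (odd v); case: (odd (_ - p)); case: (odd (_ - q));
        rewrite /= => ? ? <- //; rewrite ?ifF //; lia.
  rewrite /sign_form -exprD; apply: eta_expD2; rewrite oddD oddb -(par p) oddD.
  by rewrite -addbA addbb addbF.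
rewrite /pfw0 /pfw /pf mulr_sumr; apply: eq_bigr => s _.
rewrite [RHS]mulrCA; congr (_ * _); rewrite /pfterm [RHS]mulrCA; congr (_ * _).
by rewrite /= big_split /= /sgprod -prodrXl.
Qed.

Section Pattern.
Variables (R : comNzRingType) (t : R) (M : nat) (a : {ffun 'I_n -> 'I_M}).
Hypothesis da : decr a.
Hypothesis n_gt0 : (0 < n)%N.

Definition odd_gaps : nat := \sum_(p < n) odd (a p + (n.-1 - p)).

Let step (p : 'I_n) (k : nat) : R := (k == a p)%:R + t *+ (k == (a p).+1).
(** The two patterns that survive in [sum_pattern]: an entry is raised exactly when its gap parity
    differs from [b], so that afterwards all of them equal [b]. *)
Let bump_par b : {ffun 'I_n -> 'I_M.+1} :=
  [ffun p => inord (a p + (odd (a p + (n.-1 - p)) (+) b))%N].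

Let bumpE b p : bump_par b p = (a p + (odd (a p + (n.-1 - p)) (+) b))%N :> nat.
Proof. by rewrite ffunE inordK //; have := ltn_ord (a p); case: (_ (+) _); lia. Qed.

Let bump_odd b p : odd (bump_par b p + (n.-1 - p)) = b.
Proof.
by rewrite bumpE addnAC oddD oddb addKb.
Qed.

(** Raising entries by at most one keeps a weak decrease, and equal neighbours would have opposite
    gap parities. *)
Let bump_decr b : forall p q : 'I_n, (p < q)%N -> (bump_par b q < bump_par b p)%N.
Proof.
suff h (p q : 'I_n) : (q = p.+1 :> nat) -> (bump_par b q < bump_par b p)%N.
  move=> p q; case: q => q; elim: q => // q IH /= q1; rewrite ltnS leq_eqVlt.
  case/orP => [/eqP e|l]; first by apply: h => /=; rewrite e.
  apply: ltn_trans (IH (ltnW q1) l); exact: h.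
move=> e; have := bump_odd b p; have := bump_odd b q.
have : (bump_par b q <= bump_par b p)%N.
  rewrite !bumpE; have /decrP/(_ p q) := da; rewrite e ltnSn => /(_ isT).
  by case: (_ (+) _); case: (_ (+) _); lia.
rewrite leq_eqVlt => /orP[/eqP -> |//].
have -> : (n.-1 - p = (n.-1 - q).+1)%N by have := ltn_ord q; lia.
by rewrite addnS /= => ->; case: b.
Qed.

(** Each entry may stay or rise by one. Unless all gap parities agree, there is a repetition or a
    pair of neighbours with different gap parities; such neighbours have values of equal parity with
    nothing between them, and [pfw_eq0] applies. The two survivors raise the odd gaps or the even
    gaps, whence the two exponents. *)
Lemma sum_pattern :
  \sum_(chi : {ffun 'I_n -> 'I_M.+1})
     (\prod_p step p (chi p)) * (pfw (fun p => chi p))%:~R =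
  pfw0%:~R * (t ^+ odd_gaps + sgprod%:~R * t ^+ (n - odd_gaps)).
Proof.
pose p0 : 'I_n := Ordinal n_gt0.
have bneq : bump_par true != bump_par false.
  by apply/eqP => e; have := bump_odd true p0; rewrite e bump_odd.
have val b : pfw (fun p => bump_par b p) = sgprod ^+ b * pfw0.
  by apply: pfw_alternating => [p q|p]; [exact: bump_decr | exact: bump_odd].
have prodE b : \prod_p step p (bump_par b p) =
    t ^+ (if b then n - odd_gaps else odd_gaps)%N.
  have -> : (if b then n - odd_gaps else odd_gaps)%N
            = (\sum_(p < n) (odd (a p + (n.-1 - p)) (+) b))%N.
    case: b; last by apply: eq_bigr => p _; rewrite addbF.
    apply/eqP; rewrite -(eqn_add2l odd_gaps) subnKC; last first.
      rewrite /odd_gaps -[X in (_ <= X)%N]card_ord -sum1_card.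
      by apply: leq_sum => p _; case: odd.
    rewrite /odd_gaps -big_split /= -[X in X == _]card_ord -sum1_card.
    by apply/eqP; apply: eq_bigr => p _; case: odd.
  rewrite -prodrXr; apply: eq_bigr => p _; rewrite /step bumpE.
  case: (_ (+) _); rewrite ?addn1 ?addn0 ?eqxx.
    by rewrite eq_sym ltn_eqF // add0r expr1.
  by rewrite ltn_eqF // addr0.
rewrite (bigD1 (bump_par true)) //= (bigD1 (bump_par false)) /=; last by rewrite eq_sym.
rewrite [X in _ + (_ + X)]big1; last first.
  move=> chi /andP[nt nf].
  case: (eqVneq (\prod_p step p (chi p)) 0) => [->|nz]; first by rewrite mul0r.
  suff -> : pfw (fun p => chi p) = 0 by rewrite mulr0.
  have chiP p : (chi p == a p :> nat) || (chi p == (a p).+1 :> nat).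
    apply: contraNT nz; rewrite negb_or => /andP[/negbTE h1 /negbTE h2].
    by rewrite (bigD1 p) //= /step h1 h2 addr0 mul0r.
  case: (boolP (injectiveb chi)) => [/injectiveP ci|/injectivePn[p [q pq e]]]; last first.
    by apply: (pfw_eq0 pq); rewrite e.
  have wd (p q : 'I_n) : (p < q)%N -> (chi q < chi p)%N.
    move=> l; have /decrP/(_ _ _ l) l' := da.
    have : (chi q <= chi p)%N by have := chiP p; have := chiP q; lia.
    rewrite leq_eqVlt => /orP[/eqP/val_inj/ci e|//]; by rewrite e ltnn in l.
  pose f p := odd (chi p + (n.-1 - p)).
  case: (boolP [exists p : 'I_n, exists q : 'I_n, (q == p.+1 :> nat) && (f p != f q)]).
    case/existsP => p /existsP[q /andP[/eqP e nf']].
    apply: (@pfw_eq0 _ p q); first by apply/eqP => pq; move: e; rewrite pq; lia.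
      move: nf'; rewrite /f !oddD.
      have -> : (n.-1 - p = (n.-1 - q).+1)%N by have := ltn_ord q; lia.
      by rewrite /=; case: (odd (chi p)); case: (odd (chi q)); case: (odd (_ - _)).
    move=> k kp kq; case: (ltngtP k p) => [l|l|/val_inj kE]; last by rewrite kE eqxx in kp.
      by have := wd _ _ l; have := @wd k q; rewrite e; lia.
    have l' : (q < k)%N by rewrite ltn_neqAle eq_sym kq e.
    by have := wd _ _ l; have := wd _ _ l'; lia.
  rewrite negb_exists => /forallP h.
  have fc b : forall p, f p = f p0 -> f p0 = b -> (chi p == bump_par b p).
    move=> p e1 e2; rewrite -(inj_eq val_inj) /= bumpE.
    have := chiP p; move: e1; rewrite e2 /f !oddD => <-.
    by case/orP => /eqP ->; rewrite /=; case: (odd (a p)); case: (odd (_ - _)) => /=;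
       rewrite ?addn0 ?addn1.
  have fconst p : f p = f p0.
    case: p => p; elim: p => [|p IH] lp; first by congr f; apply: val_inj.
    rewrite -(IH (ltnW lp)); have := h (Ordinal (ltnW lp)).
    rewrite negb_exists => /forallP/(_ (Ordinal lp)); rewrite /= eqxx /= negbK.
    by move/eqP.
  case e: (f p0).
    by case/eqP: nt; apply/ffunP => p; apply/eqP; apply: fc.
  by case/eqP: nf; apply/ffunP => p; apply/eqP; apply: fc.
rewrite addr0 !prodE !val expr1 expr0 mul1r rmorphM /=; ring.
Qed.

End Pattern.
End ParityWeights.

(** * Change of basis and normalisation of the Pfaffian *)

Section GramDeterminant.
Variables w r : nat.
Local Notation n := (w + w + r)%N.
Variable K : comNzRingType.
Hypothesis K2 : forall x : K, x *+ 2 = 0 -> x = 0.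

Lemma pf_noninj I (A : I -> I -> K) (X : I -> 'I_r -> K) (phi : 'I_n -> I) p q :
  p != q -> phi p = phi q -> pf A X phi = 0.
Proof.
move=> pq e; apply: K2; rewrite mulr2n.
have {1}-> : pf A X phi = pf A X (phi \o tperm p q).
  by apply: eq_pf => k /=; case: tpermP => [->|->|].
by rewrite pf_perm odd_tperm pq mulN1r addNr.
Qed.

Lemma pf_gram_det (U W : 'M[K]_n) (Y : 'M[K]_(n, r)) :
  pf (U *m W *m U^T) (U *m Y) id = \det U * pf W Y id.
Proof.
rewrite (@pf_expand _ _ _ _ _ _ _ W Y U).
- rewrite (bigID (fun f : {ffun _} => injectiveb f)) /= addrC big1 ?add0r; last first.
    by move=> f /injectivePn[p [q pq e]]; rewrite (pf_noninj _ _ pq e) mulr0.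
  rewrite (reindex (@pval _)) /=; last first.
    pose in_Sn := insubd (1%g : 'S_n).
    by exists in_Sn => /= f Uf; first apply: val_inj; apply: insubdK.
  rewrite /determinant mulr_suml; apply: eq_big => [s|s _]; first by rewrite /= (valP s).
  have -> : pf W Y (pval s) = (-1) ^+ s * pf W Y id.
    by rewrite -pf_perm; apply: eq_pf => p; rewrite /= pvalE.
  rewrite mulrCA mulrA; congr (_ * _ * _).
  by apply: eq_bigr => p _; rewrite pvalE.
- move=> i i'; rewrite !mxE; under eq_bigr => j _ do rewrite mxE mulr_suml.
  rewrite exchange_big /=; apply: eq_bigr => j _; apply: eq_bigr => j' _.
  by rewrite mxE mulrAC.
- by move=> i c; rewrite mxE.
Qed.

End GramDeterminant.

Section Normalisation.
Variables w r : nat.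
Local Notation n := (w + w + r)%N.

Definition symp (K : comNzRingType) : 'M[K]_n :=
  block_mx (block_mx 0 1%:M (- 1%:M) 0) 0 0 0.
Definition symp_ends (K : comNzRingType) : 'M[K]_(n, r) := col_mx 0 1%:M.

Lemma pfterm_swap (K : comNzRingType) I (A : I -> I -> K) (X : I -> 'I_r -> K)
    (phi : 'I_n -> I) i : (forall a b, A b a = - A a b) ->
  pfterm A X (phi \o tperm (pl r i) (pr r i)) = - pfterm A X phi.
Proof.
move=> skew; rewrite /pfterm -mulNr; congr (_ * _); last first.
  apply: eq_bigr => c _ /=; rewrite tpermD //.
    by rewrite eq_lrshift.
  by rewrite eq_lrshift.
rewrite (bigD1 i) //= [in RHS](bigD1 i) //= tpermL tpermR skew mulNr; congr (- (_ * _)).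
apply: eq_bigr => j ji; rewrite !tpermD //.
- by rewrite /pl /pr !(inj_eq (@lshift_inj _ _)) eq_lrshift.
- by rewrite /pr !(inj_eq (@lshift_inj _ _)) (inj_eq (@rshift_inj _ _)) eq_sym.
- by rewrite /pl !(inj_eq (@lshift_inj _ _)) eq_sym.
- by rewrite /pl /pr !(inj_eq (@lshift_inj _ _)) eq_rlshift.
Qed.

Local Notation J := (symp int).
Local Notation X0 := (symp_ends int).

Lemma sympE (K : comNzRingType) :
  (forall i q, symp K (pl r i) q = (q == pr r i)%:R) *
  (forall i q, symp K (pr r i) q = - (q == pl r i)%:R) *
  (forall c q, symp K (px w c) q = 0).
Proof.
split; first split.
- move=> i; apply: ord_n_ind => j; rewrite /symp ?block_mxEul ?block_mxEur ?mxE.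
  + by rewrite !(inj_eq (@lshift_inj _ _)) eq_lrshift.
  + by rewrite !(inj_eq (@lshift_inj _ _)) (inj_eq (@rshift_inj _ _)) eq_sym.
  + by rewrite eq_rlshift.
- move=> i; apply: ord_n_ind => j; rewrite /symp ?block_mxEul ?block_mxEdl ?block_mxEdr ?block_mxEur ?mxE.
  + by rewrite !(inj_eq (@lshift_inj _ _)) eq_sym.
  + by rewrite !(inj_eq (@lshift_inj _ _)) eq_rlshift oppr0.
  + by rewrite eq_rlshift oppr0.
- by move=> c; apply: ord_n_ind => j; rewrite /symp ?block_mxEdl ?block_mxEdr mxE.
Qed.

Lemma symp_skew (K : comNzRingType) p q : symp K q p = - symp K p q.
Proof.
elim/ord_n_ind: p => i; elim/ord_n_ind: q => j; rewrite !sympE ?oppr0 ?opprK //;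
  rewrite /pl /pr /px ?eq_lrshift ?eq_rlshift ?(inj_eq (@lshift_inj _ _)) ?(inj_eq (@rshift_inj _ _)) ?eq_lrshift ?eq_rlshift ?oppr0 //.
- by rewrite eq_sym.
- by rewrite eq_sym.
Qed.

Lemma symp_endsE (K : comNzRingType) :
  (forall i c, symp_ends K (pl r i) c = 0) *
  (forall i c, symp_ends K (pr r i) c = 0) *
  (forall d c, symp_ends K (px w d) c = (d == c)%:R).
Proof. by split; first split; move=> ? ?; rewrite /symp_ends ?col_mxEu ?col_mxEd mxE. Qed.

(* A nonzero term permutes the pairs and swaps the members of some of them; each
   swap contributes a sign twice, and permuting the pairs is an even operation. *)
Lemma pf_symp_term_ge0 (s : 'S_n) : 0 <= (-1) ^+ s * pfterm J X0 (id \o s).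
Proof.
move: {2}(\sum_i (w <= s (pl r i)))%N (leqnn (\sum_i (w <= s (pl r i)))%N) => m.
elim: m s => [|m IH] s hm; last first.
  case: (boolP [exists i, (w <= s (pl r i))%N]) => [/existsP[i hi]|]; last first.
    rewrite negb_exists => /forallP h; apply: IH.
    by rewrite big1 // => i _; rewrite (negbTE (h i)).
  case: (eqVneq (J (s (pl r i)) (s (pr r i))) 0) => [e|nz].
    by rewrite /pfterm (bigD1 i) //= e !mul0r mulr0.
  pose s' := (tperm (pl r i) (pr r i) * s)%g.
  have -> : (-1) ^+ s * pfterm J X0 (id \o s) = (-1) ^+ s' * pfterm J X0 (id \o s') :> int.
    have -> : pfterm J X0 (id \o s') = - pfterm J X0 (id \o s).
      rewrite -(pfterm_swap _ _ i) ?symp_skew //; last exact: symp_skew.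
      by apply: eq_pfterm => p /=; rewrite permM.
    rewrite odd_permM odd_tperm signr_addb mulrN.
    by rewrite /pl /pr (inj_eq (@lshift_inj _ _)) eq_lrshift expr1 mulN1r mulNr opprK.
  apply: IH; rewrite -ltnS; apply: leq_trans hm; rewrite [X in (_ < X)%N](bigD1 i) //=.
  rewrite hi add1n ltnS (bigD1 i) //= /s' permM tpermL.
  have hJ p q : J p q != 0 -> (w <= p)%N -> (w <= q)%N = false.
    elim/ord_n_ind: p => j; rewrite !sympE /= ?eqxx //; first by rewrite leqNgt ltn_ord.
    by rewrite oppr_eq0 pnatr_eq0 eqb0 negbK => /eqP -> _ /=; rewrite leqNgt ltn_ord.
  rewrite (hJ _ _ nz hi) add0n leq_eqVlt; apply/orP; left; apply/eqP.
  apply: eq_bigr => j ji; rewrite permM tpermD //.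
    by rewrite /pl (inj_eq (@lshift_inj _ _)) (inj_eq (@lshift_inj _ _)) eq_sym.
  by rewrite /pl /pr (inj_eq (@lshift_inj _ _)) eq_rlshift.
have hl i : (s (pl r i) < w)%N.
  by move: hm; rewrite (bigD1 i) //= leqn0 addn_eq0 ltnNge; case: leqP.
case: (eqVneq (pfterm J X0 (id \o s)) 0) => [->|nz]; first by rewrite mulr0.
have nzJ i : J (s (pl r i)) (s (pr r i)) != 0.
  by apply: contraNneq nz => e; rewrite /pfterm (bigD1 i) //= e !mul0r.
have nzX c : s (px w c) = px w c.
  suff : X0 (s (px w c)) c != 0.
    by elim/ord_n_ind: (s _) => d; rewrite symp_endsE // pnatr_eq0 eqb0 negbK => /eqP ->.
  by apply: contraNneq nz => e; rewrite /pfterm [X in _ * X](bigD1 c) //= e mul0r mulr0.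
have lP i : {j | s (pl r i) = pl r j /\ s (pr r i) = pr r j}.
  exists (Ordinal (hl i)).
  move: (Ordinal (hl i)) (erefl (s (pl r i) : nat) : s (pl r i) = Ordinal (hl i) :> nat) => j jE.
  have e : s (pl r i) = pl r j by apply: val_inj.
  by split=> //; move: (nzJ i); rewrite e sympE pnatr_eq0 eqb0 negbK => /eqP.
have -> : pfterm J X0 (id \o s) = 1.
  rewrite /pfterm !big1 ?mulr1 // => i _ /=.
    by rewrite nzX symp_endsE eqxx.
  by have [j [-> ->]] := lP i; rewrite sympE eqxx.
rewrite mulr1 -det_perm.
pose P : 'M[int]_w := \matrix_(i, j) (s (pl r i) == pl r j)%:R.
have -> : perm_mx s = block_mx (block_mx P 0 0 P) 0 0 1%:M :> 'M[int]_n.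
  apply/matrixP; apply: ord_n_ind => i; apply: ord_n_ind => j; rewrite [LHS]mxE [LHS]mxE.
  - by rewrite !block_mxEul mxE.
  - have [k [-> _]] := lP i; rewrite block_mxEul block_mxEur mxE.
    by rewrite /pl /pr (inj_eq (@lshift_inj _ _)) eq_lrshift.
  - have [k [-> _]] := lP i; rewrite block_mxEur mxE.
    by rewrite /pl /px eq_lrshift.
  - have [k [_ ->]] := lP i; rewrite block_mxEul block_mxEdl mxE.
    by rewrite /pl /pr (inj_eq (@lshift_inj _ _)) eq_rlshift.
  - have [k [kE ->]] := lP i; rewrite block_mxEul block_mxEdr mxE kE.
    by rewrite /pl /pr !(inj_eq (@lshift_inj _ _)) (inj_eq (@rshift_inj _ _)).
  - have [k [_ ->]] := lP i; rewrite block_mxEur mxE.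
    by rewrite /pr /px eq_lrshift.
  - by rewrite nzX block_mxEdl mxE /px /pl eq_rlshift.
  - by rewrite nzX block_mxEdl mxE /px /pr eq_rlshift.
  - by rewrite nzX block_mxEdr mxE /px (inj_eq (@rshift_inj _ _)).
by rewrite det_ublock det_ublock det1 mulr1 -expr2 sqr_ge0.
Qed.

Definition pf_symp : int := pf J X0 id.

(** No term is negative and the identity permutation contributes 1. *)
Lemma pf_symp_neq0 : pf_symp != 0.
Proof.
rewrite /pf_symp /pf (bigD1 1%g) //= gt_eqF // ltr_pwDl //; last first.
  by apply: sumr_ge0 => s _; exact: pf_symp_term_ge0.
rewrite odd_perm1 expr0 mul1r /pfterm !big1 ?mulr1 // => i _ /=; rewrite !perm1.
  by rewrite symp_endsE eqxx.
by rewrite sympE eqxx.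
Qed.

End Normalisation.

Section BlockPfaffian.
Variables w r : nat.
Local Notation n := (w + w + r)%N.
Variable K : comNzRingType.
Hypothesis K2 : forall x : K, x *+ 2 = 0 -> x = 0.

(** The border forces [px c] into the slot [c], so the entries of [A] at border indices never enter.
    What remains is the standard symplectic form transformed by the block diagonal matrix of [C],
    the identity and [lam]. *)
Lemma pf_block (A : 'I_n -> 'I_n -> K) (X : 'I_n -> 'I_r -> K)
    (C : 'M[K]_w) (lam : 'I_r -> K) :
  (forall i j, A (pl r i) (pl r j) = 0) -> (forall i j, A (pr r i) (pr r j) = 0) ->
  (forall i j, A (pl r i) (pr r j) = C i j) ->
  (forall i j, A (pr r j) (pl r i) = - C i j) ->
  (forall i c, X (pl r i) c = 0) -> (forall i c, X (pr r i) c = 0) ->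
  (forall d c, X (px w d) c = lam c *+ (d == c)) ->
  pf A X id = \det C * (\prod_c lam c) * (pf_symp w r)%:~R.
Proof.
move=> All Arr Alr Arl Xl Xr Xx.
pose U : 'M[K]_n := block_mx (block_mx C 0 0 1%:M) 0 0 (diag_mx (\row_c lam c)).
have UWE : U *m symp w r K *m U^T = block_mx (block_mx 0 C (- C^T) 0) 0 0 0.
  rewrite /U /symp !tr_block_mx !trmx0 !trmx1 !mulmx_block.
  by rewrite !(mul0mx, mulmx0, addr0, add0r, mulmx1, mul1mx, mulmxN, mulNmx, mulmx_block).
have UYE : U *m symp_ends w r K = col_mx 0 (diag_mx (\row_c lam c)).
  by rewrite /U /symp_ends mul_block_col !(mul0mx, mulmx0, mulmx1, addr0, add0r).
have -> : pf A X id = pf (U *m symp w r K *m U^T) (U *m symp_ends w r K) id.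
  rewrite UWE UYE; apply: eq_bigr => s _; congr (_ * _).
  have XE p c : X p c = col_mx 0 (diag_mx (\row_c lam c)) p c.
    elim/ord_n_ind: p => i; rewrite ?Xl ?Xr ?Xx ?col_mxEu ?col_mxEd !mxE //.
    by case: (eqVneq i c) => [->|].
  rewrite /pfterm; under [X in _ * X]eq_bigr => c _ do rewrite XE.
  case: (eqVneq (\prod_c col_mx 0 (diag_mx (\row_c lam c)) (s (px w c)) c) 0) => [->|nz].
    by rewrite !mulr0.
  have nzX c : s (px w c) = px w c.
    have: X (s (px w c)) c != 0.
      by apply: contraNneq nz => e; rewrite (bigD1 c) //= -XE e mul0r.
    elim/ord_n_ind: (s _) => d; rewrite ?Xl ?Xr ?Xx ?eqxx //.
    by case: (eqVneq d c) => [->|]; rewrite ?eqxx.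
  have nx p q : (forall c, s p != px w c) -> (forall c, s q != px w c) ->
      A (s p) (s q) = block_mx (block_mx 0 C (- C^T) 0) 0 0 0 (s p) (s q).
    elim/ord_n_ind: (s p) => i; elim/ord_n_ind: (s q) => j hp hq;
      rewrite ?All ?Arr ?Alr ?Arl ?block_mxEul ?block_mxEur ?block_mxEdl ?block_mxEdr ?mxE //;
      first [by have := hp i; rewrite eqxx | by have := hq j; rewrite eqxx].
  congr (_ * _); apply: eq_bigr => i _ /=; apply: nx => c; rewrite -(nzX c) (inj_eq perm_inj).
  - by rewrite /pl /px eq_lrshift.
  - by rewrite /pr /px eq_lrshift.
rewrite pf_gram_det // /U det_ublock det_ublock det1 mulr1 det_diag.
congr (_ * _ * _); first by apply: eq_bigr => c _; rewrite mxE.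
rewrite /pf_symp (pf_morph (intmul (1 : K))).
apply: eq_pf_entries => [p q _|p c].
  by elim/ord_n_ind: p => i; rewrite !sympE ?rmorphN /= ?rmorph_nat ?rmorph0.
by elim/ord_n_ind: p => i; rewrite !symp_endsE ?rmorph_nat ?rmorph0.
Qed.

End BlockPfaffian.

(** * Pairings of polynomials *)

Section ParityPairing.
Variables (R : comNzRingType) (M : nat).
Hypothesis R2 : forall x : R, x *+ 2 = 0 -> x = 0.
Implicit Types P Q S : {poly R}.

(** The cutoff [M] keeps the sum over exponents finite; the size hypotheses of the lemmas below
    ensure that no coefficient is lost by a shift. *)
Definition par_pair P Q : R :=
  \sum_(a < M.+1) \sum_(b < M.+1) P`_a * Q`_b * (parity_form a b)%:~R.
Definition coef_pair P Q : R := \sum_(a < M.+1) P`_a * Q`_a.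

Lemma par_pairDl P Q S : par_pair (P + Q) S = par_pair P S + par_pair Q S.
Proof.
rewrite -big_split; apply: eq_bigr => a _ /=; rewrite -big_split; apply: eq_bigr => b _.
by rewrite coefD !mulrDl.
Qed.

Lemma par_pairDr P Q S : par_pair S (P + Q) = par_pair S P + par_pair S Q.
Proof.
rewrite -big_split; apply: eq_bigr => a _ /=; rewrite -big_split; apply: eq_bigr => b _.
by rewrite coefD mulrDr !mulrDl.
Qed.

Lemma par_pairNr P S : par_pair S (- P) = - par_pair S P.
Proof.
rewrite -sumrN; apply: eq_bigr => a _ /=; rewrite -sumrN; apply: eq_bigr => b _.
by rewrite coefN mulrN !mulNr.
Qed.

Lemma par_pair_skew P Q : par_pair Q P = - par_pair P Q.
Proof.
rewrite /par_pair exchange_big /= -sumrN; apply: eq_bigr => a _.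
rewrite -sumrN; apply: eq_bigr => b _.
by rewrite parity_form_skew rmorphN mulrN (mulrC Q`_b).
Qed.

Lemma par_pair_sum (J : finType) (c d : J -> R) (v v' : J -> {poly R}) :
  par_pair (\sum_j c j *: v j) (\sum_j d j *: v' j) =
  \sum_j \sum_j' c j * d j' * par_pair (v j) (v' j').
Proof.
have Zr a P Q : par_pair P (a *: Q) = a * par_pair P Q.
  rewrite mulr_sumr; apply: eq_bigr => i _; rewrite mulr_sumr; apply: eq_bigr => k _.
  by rewrite coefZ; ring.
have Zl a P Q : par_pair (a *: P) Q = a * par_pair P Q.
  by rewrite par_pair_skew Zr par_pair_skew mulrN opprK.
have z0 P : par_pair P 0 = 0 by rewrite -(scale0r 0) Zr mul0r.
have sumr (F : J -> {poly R}) P : par_pair P (\sum_j F j) = \sum_j par_pair P (F j).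
  by elim/big_rec2: _ => [//|j x y _ <-]; rewrite par_pairDr.
rewrite [LHS]par_pair_skew sumr -sumrN; apply: eq_bigr => j _ /=.
rewrite -par_pair_skew sumr; apply: eq_bigr => j' _; by rewrite Zr Zl; ring.
Qed.

Lemma sum_mulX P (F : nat -> R) : (size P <= M)%N ->
  \sum_(a < M.+1) ('X * P)`_a * F a = \sum_(a < M.+1) P`_a * F a.+1.
Proof.
move=> sP; rewrite big_ord_recl coefXM mul0r add0r [RHS]big_ord_recr /=.
rewrite (nth_default _ sP) mul0r addr0; apply: eq_bigr => a _.
by rewrite coefXM.
Qed.

Lemma par_pairE P Q :
  par_pair P Q = \sum_(a < M.+1) P`_a * \sum_(b < M.+1) Q`_b * (parity_form a b)%:~R.
Proof.
apply: eq_bigr => a _; rewrite mulr_sumr; apply: eq_bigr => b _; by rewrite mulrA.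
Qed.

Lemma coef_pair_shift P Q : (size P <= M)%N ->
  coef_pair ('X * P) ('X * Q) = coef_pair P Q.
Proof. by move=> sP; rewrite /coef_pair sum_mulX //; apply: eq_bigr => a _; rewrite coefXM. Qed.

Lemma par_pair_shift P Q : (size P <= M)%N -> (size Q <= M)%N ->
  par_pair ('X * P) ('X * Q) = par_pair P Q.
Proof.
move=> sP sQ; rewrite !par_pairE.
rewrite (@sum_mulX _ (fun a => \sum_(b < M.+1) ('X * Q)`_b * (parity_form a b)%:~R)) //.
apply: eq_bigr => a _; rewrite (@sum_mulX _ (fun b => (parity_form a.+1 b)%:~R)) //.
congr (_ * _); apply: eq_bigr => b _; congr (_ * _%:~R).
exact: (parity_formDl a b 1).
Qed.

Lemma sizeXM P : (size ('X * P)%R <= (size P).+1)%N.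
Proof. by apply: leq_trans (size_polyMleq _ _) _; rewrite size_polyX. Qed.

Lemma par_pairX2 P Q : ((size P).+1 <= M)%N -> (size Q <= M)%N ->
  par_pair ('X * ('X * P)) Q - par_pair P Q = coef_pair ('X * P) Q *+ 2.
Proof.
move=> sP sQ; rewrite !par_pairE.
rewrite (@sum_mulX _ (fun a => \sum_(b < M.+1) Q`_b * (parity_form a b)%:~R)); last first.
  exact: leq_trans (sizeXM _) sP.
rewrite (@sum_mulX _ (fun a => \sum_(b < M.+1) Q`_b * (parity_form a.+1 b)%:~R)); last first.
  exact: ltnW.
rewrite /coef_pair (@sum_mulX _ (fun a => Q`_a)); last exact: ltnW.
rewrite -sumrB -sumrMnl; apply: eq_bigr => a _; rewrite -mulrBr -mulrnAr -sumrB.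
congr (_ * _).
transitivity (\sum_(b < M.+1) (Q`_b * (a.+1 == b)%:R) *+ 2).
  apply: eq_bigr => b _; rewrite -mulrBr -rmorphB parity_formSS -mulrnAr; congr (_ * _).
  by rewrite rmorphMn rmorph_nat.
rewrite sumrMnl; congr (_ *+ 2).
case: (ltnP a.+1 M.+1) => ha.
  rewrite (bigD1 (Ordinal ha)) //= eqxx mulr1 big1 ?addr0 // => b.
  by rewrite -(inj_eq val_inj) /= eq_sym => /negbTE ->; rewrite mulr0.
rewrite nth_default ?(leq_trans sQ) ?(leq_trans _ ha) // big1 // => b _.
by case: eqP => [e|_]; rewrite ?mulr0 //; have := ltn_ord b; rewrite -e ltnNge ha.
Qed.

(** By shift invariance the four terms reduce to the pairing of [x] with ['X * z] minus that of
    ['X^2 * x] with ['X * z], which [par_pairX2] evaluates. A skew pairing thus yields the symmetric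
    pairing of coefficients. *)
Lemma par_pair_antisym (x z : {poly R}) : ((size x).+2 <= M)%N -> ((size z).+2 <= M)%N ->
  par_pair ((1 + 'X) * x) (('X - 1) * z) = - (coef_pair x z *+ 2).
Proof.
move=> sx sz; rewrite mulrDl mul1r mulrBl mul1r !par_pairDl !par_pairDr !par_pairNr.
rewrite (par_pair_shift (ltnW (ltnW sx)) (ltnW (ltnW sz))).
have sXz := leq_trans (sizeXM z) (ltnW sz).
have sXx := leq_trans (sizeXM x) (ltnW sx).
rewrite -(par_pair_shift sXx (ltnW (ltnW sz))).
rewrite -(coef_pair_shift z (ltnW (ltnW sx))) -(par_pairX2 (ltnW sx) sXz).
ring.
Qed.

(** Self-adjointness of multiplication by ['X + 'X^-1], cleared of denominators. *)
Lemma par_pair_move (u v : {poly R}) : ((size u).+2 <= M)%N -> ((size v).+2 <= M)%N ->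
  par_pair ((1 + 'X^2) * u) ('X * v) = par_pair ('X * u) ((1 + 'X^2) * v).
Proof.
move=> su sv; rewrite !mulrDl !mul1r expr2 -!mulrA !par_pairDl !par_pairDr.
rewrite (@par_pair_shift u ('X * v)) ?(par_pair_shift (P := 'X * u)) 1?addrC //;
  first [exact: ltnW (ltnW _) | exact: leq_trans (sizeXM _) (ltnW _)].
Qed.

Section Centred.
Variable w : nat.

(* [centred S i] is [T^i * S] for [T = 'X + 'X^-1], shifted by ['X^(w - 1)]. *)
Definition centred S (i : nat) : {poly R} := (1 + 'X^2) ^+ i * ('X^(w.-1 - i) * S).

Lemma size_centred S i : (i < w)%N -> (size (centred S i) <= w.-1 + i + size S)%N.
Proof.
move=> iw; apply: leq_trans (size_polyMleq _ _) _.
have h1 : (size (1 + 'X^2 : {poly R})%R <= 3)%N.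
  by apply: leq_trans (size_polyD _ _) _; rewrite size_poly1 size_polyXn.
have h2 : (size ((1 + 'X^2 : {poly R}) ^+ i)%R <= (2 * i).+1)%N.
  elim: i {iw} => [|i IH]; first by rewrite expr0 size_poly1.
  rewrite exprS; apply: leq_trans (size_polyMleq _ _) _; lia.
have h3 : (size ('X^(w.-1 - i) * S : {poly R})%R <= w.-1 - i + size S)%N.
  by apply: leq_trans (size_polyMleq _ _) _; rewrite size_polyXn.
lia.
Qed.

Lemma par_pair_centred S S' i j : (w + w + size S + 2 <= M)%N ->
  (w + w + size S' + 2 <= M)%N -> (i.+1 < w)%N -> (j.+1 < w)%N ->
  par_pair (centred S i.+1) (centred S' j) = par_pair (centred S i) (centred S' j.+1).
Proof.
move=> sS sS' iw jw.
have cS P k : (k.+1 < w)%N -> centred P k = 'X * ((1 + 'X^2) ^+ k * ('X^(w.-1 - k.+1) * P)).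
  by move=> kw; rewrite /centred (_ : w.-1 - k = (w.-1 - k.+1).+1)%N ?exprS; [ring|lia].
have cE P k : centred P k.+1 = (1 + 'X^2) * ((1 + 'X^2) ^+ k * ('X^(w.-1 - k.+1) * P)).
  by rewrite /centred exprS -mulrA.
have sz P k : (k.+1 < w)%N ->
    (size ((1 + 'X^2) ^+ k * ('X^(w.-1 - k.+1) * P))%R <= w + w + size P)%N.
  move=> kw; apply: (@leq_trans (w.-1 + k + size P)); last by lia.
  have := size_centred P (ltnW kw); rewrite (cS _ _ kw); set Q := (_ ^+ k * _).
  case: (eqVneq Q 0) => [-> _|nz]; first by rewrite size_poly0 leq0n.
  by rewrite mulrC size_mulX //; move/ltnW.
rewrite !cE (cS _ _ iw) (cS _ _ jw) par_pair_move //.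
  by have := sz S i iw; lia.
by have := sz S' j jw; lia.
Qed.

Lemma hankel_sym (T : Type) (f : nat -> nat -> T) :
  (forall i j, (i.+1 < w)%N -> (j.+1 < w)%N -> f i.+1 j = f i j.+1) ->
  forall i j, (i < w)%N -> (j < w)%N -> f i j = f j i.
Proof.
move=> h.
suff H d : forall i, (i + d < w)%N -> f i (i + d)%N = f (i + d)%N i.
  move=> i j iw jw; case: (leqP i j) => [l|/ltnW l].
    by rewrite -(subnKC l) H ?subnKC.
  by rewrite -(subnKC l) H ?subnKC.
(* The distance drops by two: one step inwards at each end, the induction hypothesis, then one step
   outwards. *)
elim/ltn_ind: d => -[|[|d]] IH i hi; first by rewrite addn0.
  by rewrite addn1 h //; rewrite addn1 in hi.
rewrite !addnS -h; [|lia|lia].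
rewrite -addSn IH //; last by lia.
by rewrite addSn [RHS]h //; lia.
Qed.

(** The values form a Hankel matrix, which is symmetric, while the pairing is skew. This empties the
    two diagonal blocks of the Gram matrix. *)
Lemma par_pair_centred0 S i j : (w + w + size S + 2 <= M)%N -> (i < w)%N -> (j < w)%N ->
  par_pair (centred S i) (centred S j) = 0.
Proof.
move=> sS iw jw; apply: R2; rewrite mulr2n {1}par_pair_skew.
have -> : par_pair (centred S j) (centred S i) = par_pair (centred S i) (centred S j).
  by apply: (hankel_sym (f := fun i j => par_pair (centred S i) (centred S j))) => // *;
     exact: par_pair_centred.
exact: addNr.
Qed.

Lemma centredM P S i : centred (P * S) i = P * centred S i.
Proof. by rewrite /centred; ring. Qed.

End Centred.
End ParityPairing.

Lemma poly_sum_coef (K : comNzRingType) n (P : {poly K}) : (size P <= n)%N ->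
  P = \sum_(j < n) P`_j *: 'X^j.
Proof.
move=> sP; rewrite -poly_def; apply/polyP => i; rewrite coef_poly.
by case: ltnP => // /(leq_trans sP) /leq_sizeP ->.
Qed.

(** * The basis that makes the Gram matrix block antidiagonal *)

Section Basis.
Variables w r : nat.
Local Notation n := (w + w + r)%N.
Variable eta : 'I_r -> int.

Section OverRing.
Variable K : comNzRingType.
Definition root_poly : {poly K} := \prod_c ('X - ((eta c)%:~R)%:P).
Definition coroot_poly (c : 'I_r) : {poly K} :=
  \prod_(d | d != c) ('X - ((eta d)%:~R)%:P).

Definition basis (p : 'I_n) : {poly K} :=
  match fintype.split p with
  | inl q => match fintype.split q with
             | inl i => (1 + 'X) * centred w root_poly i
             | inr i => ('X - 1) * centred w root_poly i
             end
  | inr c => coroot_poly c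
  end.

Lemma basisE :
  (forall i, basis (pl r i) = (1 + 'X) * centred w root_poly i) *
  (forall i, basis (pr r i) = ('X - 1) * centred w root_poly i) *
  (forall c, basis (px w c) = coroot_poly c).
Proof.
by split; first split; move=> i; rewrite /basis ?(unsplitK (inl _ _)) ?(unsplitK (inr _ _))
  ?(unsplitK (inl _ _)) ?(unsplitK (inr _ _)).
Qed.

Lemma size_root_poly : size root_poly = r.+1.
Proof. by rewrite size_prod_XsubC /index_enum unlock -enumT size_enum_ord. Qed.

Lemma size_basis p : (size (basis p) <= n)%N.
Proof.
have h (a : {poly K}) (i : 'I_w) : (size a <= 2)%N -> (size (a * centred w root_poly i)%R <= n)%N.
  move=> sa; apply: leq_trans (size_polyMleq _ _) _.
  have := size_centred root_poly (ltn_ord i); rewrite size_root_poly.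
  by have := ltn_ord i; lia.
elim/ord_n_ind: p => i; rewrite !basisE.
- apply: h; apply: leq_trans (size_polyD _ _) _.
  by rewrite size_poly1 size_polyX.
- by apply: h; rewrite -polyC1 size_XsubC.
- have -> : coroot_poly i = \prod_(d <- enum (predC1 i)) ('X - ((eta d)%:~R)%:P).
    by rewrite big_enum.
  rewrite size_prod_XsubC -cardE cardC1 card_ord.
  by have := ltn_ord i; lia.
Qed.

End OverRing.

(** Columns follow the descending powers [n.-1 - j], as in the staircase. The entries are integers,
    so that the determinant is one constant common to all coefficient rings. *)
Definition basis_mx : 'M[int]_n := \matrix_(p, j) (basis int p)`_(n.-1 - j).

Lemma map_root_poly (K : comNzRingType) : map_poly (intmul 1) (root_poly int) = root_poly K.
Proof.
rewrite rmorph_prod; apply: eq_bigr => c _.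
by rewrite rmorphB /= map_polyX map_polyC /= intz.
Qed.

Lemma map_coroot_poly (K : comNzRingType) c :
  map_poly (intmul 1) (coroot_poly int c) = coroot_poly K c.
Proof.
rewrite rmorph_prod; apply: eq_bigr => d _.
by rewrite rmorphB /= map_polyX map_polyC /= intz.
Qed.

Lemma map_basis (K : comNzRingType) p : map_poly (intmul 1) (basis int p) = basis K p.
Proof.
have mc i : map_poly (intmul 1) (centred w (root_poly int) i) = centred w (root_poly K) i.
  rewrite /centred !rmorphM rmorphXn rmorphD rmorph1 /= !map_polyXn map_root_poly //.
elim/ord_n_ind: p => i; rewrite !basisE ?map_coroot_poly // rmorphM ?rmorphD ?rmorphN ?rmorph1 /=
  ?map_polyX ?mc //.
Qed.

(** Up to sign the discriminant of [root_poly]. *)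
Definition coroot_const : int := \prod_c (coroot_poly int c).[eta c].

Lemma coroot_const_neq0 : injective eta -> coroot_const != 0.
Proof.
move=> ie; apply/prodf_neq0 => c _; rewrite horner_prod; apply/prodf_neq0 => d dc.
by rewrite hornerXsubC intz subr_eq0 (inj_eq ie) eq_sym.
Qed.

End Basis.

(** * The bordered Pfaffian evaluated in two ways *)

Section OmegaIdentity.
Variables w r : nat.
Local Notation n := (w + w + r)%N.
Variable eta : 'I_r -> int.
Hypothesis eta_sq : forall c, eta c ^+ 2 = 1.
Variables (R : comNzRingType) (t : R) (E : {poly R}) (M : nat).
Hypothesis R2 : forall x : R, x *+ 2 = 0 -> x = 0.
Hypothesis n_gt0 : (0 < n)%N.
Hypothesis M_big : (n + size E + 4 <= M)%N.

Local Notation G := (E * (1 + t *: 'X)).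
Local Notation etaR c := ((eta c)%:~R : R).
Let u (p : 'I_n) : {poly R} := 'X^(n.-1 - p) * G.
Let v (a : nat) : {poly R} := 'X^a * (1 + t *: 'X).
Let ev (P : {poly R}) (c : 'I_r) : R := P.[etaR c].

Let size_t : (size (1 + t *: 'X : {poly R})%R <= 2)%N.
Proof.
apply: leq_trans (size_polyD _ _) _; rewrite size_poly1 geq_max /=.
by apply: leq_trans (size_scale_leq _ _) _; rewrite size_polyX.
Qed.

Let coef_v (a k : nat) : (v a)`_k = (k == a)%:R + t *+ (k == a.+1).
Proof.
rewrite /v mulrDr mulr1 coefD coefXn -scalerAr -exprSr coefZ coefXn.
by rewrite mulr_natr.
Qed.

Let size_v a : (size (v a) <= a.+2)%N.
Proof.
apply: leq_trans (size_polyMleq _ _) _; rewrite size_polyXn.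
by have := size_t; lia.
Qed.

Let uE p : u p = \sum_(a < M) ('X^(n.-1 - p) * E)`_a *: v a.
Proof.
rewrite /u mulrA {1}(@poly_sum_coef _ M ('X^(n.-1 - p) * E)).
  by rewrite mulr_suml; apply: eq_bigr => a _; rewrite -scalerAl.
apply: leq_trans (size_polyMleq _ _) _; rewrite size_polyXn.
by have := ltn_ord p; move: M_big; lia.
Qed.

(* The minors of [u] on the monomials are replaced by those of [y^(n-1-p) E] on the
   [v a], so that the weight is the Pfaffian computed in [sum_pattern]. *)
Lemma pf_shifted :
  pf (fun p q => par_pair M (u p) (u q)) (fun p c => ev (u p) c) id =
  (pfw0 w eta)%:~R *
  \sum_(a : {ffun 'I_n -> 'I_M} | decr a)
     \det (\matrix_(p, q) ('X^(n.-1 - p) * E)`_(a q)) *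
     (t ^+ odd_gaps a + (sgprod eta)%:~R * t ^+ (n - odd_gaps a)).
Proof.
pose W (a b : 'I_M) := par_pair M (v a) (v b).
pose Y (a : 'I_M) (c : 'I_r) := ev (v a) c.
rewrite (@pf_expand w r R 'I_n 'I_M _ _ W Y (fun p a => ('X^(n.-1 - p) * E)`_a)).
- rewrite (@cauchy_binet n M R (fun p a => ('X^(n.-1 - p) * E)`_a)
             (fun psi => pf W Y psi)).
  + rewrite mulr_sumr; apply: eq_bigr => a da; rewrite [RHS]mulrCA; congr (_ * _).
    rewrite -(sum_pattern eta_sq t da n_gt0).
    (* Second expansion, now of each [v a] in monomials: its two coefficients 1 and [t] are the
       weights of staying and of rising in [sum_pattern]. *)
    rewrite (@pf_expand w r R 'I_M 'I_M.+1 W Y (fun a b => (parity_form a b)%:~R)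
       (fun a c => (sign_form eta a c)%:~R) (fun a b => (v a)`_b)).
    * apply: eq_bigr => chi _; congr (_ * _).
        by apply: eq_bigr => p _; rewrite coef_v.
      by rewrite /pfw (pf_morph (intmul (1 : R))); apply: eq_pf_entries.
    * by [].
    * move=> a' c; rewrite /Y /ev (@horner_coef_wide _ M.+1); last first.
        by apply: leq_trans (size_v _) _; rewrite ltnS; exact: ltn_ord.
      by apply: eq_bigr => j _; rewrite /sign_form rmorphXn.
  + by move=> psi /injectivePn[p [q pq e]]; exact: (pf_noninj R2 _ _ pq e).
  + by move=> psi s; rewrite -pf_perm; apply: eq_pf => p; rewrite ffunE.
- by move=> p q; rewrite !uE par_pair_sum.
- move=> p c; rewrite /ev uE horner_sum; apply: eq_bigr => a _.
  by rewrite hornerZ.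
Qed.

Let kapG := root_poly eta R * G.

Lemma pf_basis :
  pf (fun p q : 'I_n => par_pair M (basis eta R p * G) (basis eta R q * G))
     (fun (p : 'I_n) c => ev (basis eta R p * G) c) id =
  (\det (basis_mx w eta))%:~R *
  pf (fun p q => par_pair M (u p) (u q)) (fun p c => ev (u p) c) id.
Proof.
have bE (p : 'I_n) : basis eta R p * G = \sum_j (map_mx (intmul 1) (basis_mx w eta)) p j *: u j.
  rewrite (poly_sum_coef (size_basis eta R p)) (reindex_inj rev_ord_inj) mulr_suml /=.
  apply: eq_bigr => j _; rewrite -scalerAl !mxE; congr (_ *: _).
    rewrite -map_basis coef_map /=; congr (_ `_ _)%:~R.
    by have := ltn_ord j; lia.
  by congr ('X^ _ * _); have := ltn_ord j; lia.
rewrite -(det_map_mx (intmul (1 : R))).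
pose Wm : 'M[R]_n := \matrix_(p, q) par_pair M (u p) (u q).
pose Ym : 'M[R]_(n, r) := \matrix_(p, c) ev (u p) c.
transitivity (\det (map_mx (intmul (1 : R)) (basis_mx w eta)) * pf Wm Ym id); last first.
  by congr (_ * _); apply: eq_pf_entries => [p q _|p c]; rewrite mxE.
rewrite -(pf_gram_det R2); apply: eq_pf_entries => [p q _|p c] /=.
  rewrite !bE par_pair_sum mxE exchange_big /=; apply: eq_bigr => j _.
  rewrite [(_ *m Wm) p j]mxE mulr_suml; apply: eq_bigr => j' _.
  by rewrite [Wm _ _]mxE [(_^T) _ _]mxE; ring.
rewrite bE /ev horner_sum mxE; apply: eq_bigr => j _.
by rewrite hornerZ [Ym _ _]mxE.
Qed.

Definition moment_mx : 'M[R]_w :=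
  \matrix_(i, j) coef_pair M (centred w kapG i) (centred w kapG j).

(** On the right, [-2] per row comes from [par_pair_antisym]. Every [eta c] is a root of
    [root_poly], so the border vanishes on the first [2w] basis vectors, and [coroot_poly] makes it
    diagonal on the remaining ones, with values that give [coroot_const] and the values of
    [E * (1 + t *: 'X)] at the signs. *)
Lemma omega_identity :
  (\det (basis_mx w eta) * pfw0 w eta)%:~R *
  (\sum_(a : {ffun 'I_n -> 'I_M} | decr a)
     \det (\matrix_(p, q) ('X^(n.-1 - p) * E)`_(a q)) *
     (t ^+ odd_gaps a + (sgprod eta)%:~R * t ^+ (n - odd_gaps a))) =
  ((- 2) ^+ w * coroot_const eta * pf_symp w r)%:~R *
  (\prod_c G.[etaR c]) * \det moment_mx.
Proof.
rewrite rmorphM /= -mulrA -pf_shifted -pf_basis.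
have sk : (size kapG <= r + size E + 1)%N.
  apply: leq_trans (size_polyMleq _ _) _; rewrite size_root_poly /=.
  rewrite -addnA leq_add2l.
  apply: leq_trans (size_polyMleq _ _) _.
  apply: (@leq_trans (size E + 2).-1); last by rewrite addn2 addn1.
  by rewrite -!subn1 leq_sub2r // leq_add2l size_t.
have kM : (w + w + size kapG + 2 <= M)%N by move: M_big sk; lia.
have bl (i : 'I_w) : basis eta R (pl r i) * G = (1 + 'X) * centred w kapG i.
  by rewrite basisE -[LHS]mulrA [_ * G]mulrC /kapG [root_poly _ _ * _]mulrC centredM.
have br (i : 'I_w) : basis eta R (pr r i) * G = ('X - 1) * centred w kapG i.
  by rewrite basisE -[LHS]mulrA [_ * G]mulrC /kapG [root_poly _ _ * _]mulrC centredM.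
have sc (i : 'I_w) : ((size (centred w kapG i)).+2 <= M)%N.
  by have := size_centred kapG (ltn_ord i); have := ltn_ord i; move: kM; lia.
have cM P i : P * centred w kapG i = centred w (P * kapG) i by rewrite centredM.
have root0 i c : (centred w kapG i).[etaR c] = 0.
  rewrite /centred /kapG !hornerM /root_poly horner_prod (bigD1 c) //=.
  by rewrite hornerXsubC subrr !mul0r !mulr0.
have skX (P : {poly R}) : (size P <= 2)%N -> (w + w + size (P * kapG)%R + 2 <= M)%N.
  move=> sP; apply: (@leq_trans (w + w + (2 + (r + size E + 1)).-1 + 2)); last first.
    by move: M_big; lia.
  rewrite leq_add2r leq_add2l; apply: leq_trans (size_polyMleq _ _) _.
  by rewrite -!subn1 leq_sub2r // leq_add.
have s1X : (size (1 + 'X : {poly R})%R <= 2)%N.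
  by apply: leq_trans (size_polyD _ _) _; rewrite size_poly1 size_polyX.
have sX1 : (size ('X - 1 : {poly R})%R <= 2)%N by rewrite -polyC1 size_XsubC.
rewrite (@pf_block w r R R2 _ _ (- (2%:R *: moment_mx))
          (fun c => (coroot_poly eta R c).[etaR c] * G.[etaR c])).
- rewrite -scaleNr detZ big_split /= !rmorphM rmorphXn rmorphN /=.
  have -> : \prod_c (coroot_poly eta R c).[etaR c] = (coroot_const eta)%:~R.
    rewrite /coroot_const rmorph_prod; apply: eq_bigr => c _.
    rewrite -map_coroot_poly -[in RHS](intz (eta c)) -horner_map /=.
    by rewrite rmorph_int.
  ring.
- by move=> i j; rewrite !bl !cM par_pair_centred0 ?skX.
- by move=> i j; rewrite !br !cM par_pair_centred0 ?skX.
- move=> i j; rewrite bl br par_pair_antisym // !mxE.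
  by rewrite mulr_natl.
- move=> i j; rewrite par_pair_skew bl br par_pair_antisym // !mxE.
  by rewrite mulr_natl.
- by move=> i c; rewrite bl /ev hornerM root0 mulr0.
- by move=> i c; rewrite br /ev hornerM root0 mulr0.
- move=> d c; rewrite basisE /ev hornerM.
  case: eqVneq => [->|dc]; first by rewrite mulr1n.
  rewrite mulr0n /coroot_poly horner_prod (bigD1 c) //=; last by rewrite eq_sym.
  by rewrite hornerXsubC subrr !mul0r.
Qed.

End OmegaIdentity.

(** * Autocorrelations and tridiagonal recurrences *)

Section Sequences.
Variable K : comNzRingType.
Implicit Types (F : int -> K) (P : {poly K}).

Definition seqT F : int -> K := fun d => F (d - 1) + F (d + 1).
Definition even_seq F := forall d, F (- d) = F d.

Lemma seqT_even F : even_seq F -> even_seq (seqT F).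
Proof.
move=> eF d; rewrite /seqT addrC (_ : - d - 1 = - (d + 1)) 1?(_ : - d + 1 = - (d - 1)).
- by rewrite !eF.
- by ring.
- by ring.
Qed.

Lemma iter_seqT_even F j : even_seq F -> even_seq (iter j seqT F).
Proof. by move=> eF; elim: j => //= j; exact: seqT_even. Qed.

Lemma iter_seqT_lin F F' F'' (a b : K) j : (forall d, F d = a * F' d + b * F'' d) ->
  forall d, iter j seqT F d = a * iter j seqT F' d + b * iter j seqT F'' d.
Proof. by move=> e; elim: j => //= j IH d; rewrite /seqT !IH; ring. Qed.

(** The coefficient of [y^d] in [P(y) P(1/y)]. *)
Definition autocorr (P : {poly K}) : int -> K :=
  fun d => \sum_(i < size P) P`_i * P`_(i + `|d|%N).

Lemma autocorr_even P : even_seq (autocorr P).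
Proof. by move=> d; rewrite /autocorr abszN. Qed.

Lemma autocorr_wide M P d : (size P <= M)%N ->
  autocorr P d = \sum_(i < M) P`_i * P`_(i + `|d|%N).
Proof.
move=> sP; rewrite /autocorr (big_ord_widen M (fun i => P`_i * P`_(i + `|d|%N))) //.
rewrite big_mkcond; apply: eq_bigr => i _; case: ltnP => // h.
by rewrite (nth_default _ h) mul0r.
Qed.

Lemma coef_pairC M (P Q : {poly K}) : coef_pair M P Q = coef_pair M Q P.
Proof. by apply: eq_bigr => a _; rewrite mulrC. Qed.

Lemma coef_pairDl M (P Q S : {poly K}) :
  coef_pair M (P + Q) S = coef_pair M P S + coef_pair M Q S.
Proof. by rewrite -big_split; apply: eq_bigr => a _ /=; rewrite coefD mulrDl. Qed.

Lemma coef_pairZl M c (P Q : {poly K}) : coef_pair M (c *: P) Q = c * coef_pair M P Q.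
Proof. by rewrite mulr_sumr; apply: eq_bigr => a _ /=; rewrite coefZ mulrA. Qed.

Lemma size_XnM n P : (size ('X^n * P)%R <= n + size P)%N.
Proof. by apply: leq_trans (size_polyMleq _ _) _; rewrite size_polyXn. Qed.

Lemma coef_pair_Xn M P a b : (a + size P <= M.+1)%N -> (b + size P <= M.+1)%N ->
  coef_pair M ('X^a * P) ('X^b * P) = autocorr P (a%:Z - b%:Z).
Proof.
wlog: a b / (b <= a)%N => [hw ha hb|ba ha hb].
  case: (leqP b a) => [l|/ltnW l]; first exact: hw.
  by rewrite coef_pairC hw // -autocorr_even opprB.
have -> : 'X^a * P = 'X^b * ('X^(a - b) * P) by rewrite mulrA -exprD subnKC.
elim: b a ba ha hb => [|b IH] a ba ha hb.
  rewrite subn0 !expr0 !mul1r subr0 coef_pairC /coef_pair (@autocorr_wide M.+1) ?absz_nat; last by lia.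
  have sP : (size P <= M.+1)%N by lia.
  transitivity (\sum_(i < M.+1) if (a <= i)%N then P`_i * P`_(i - a) else 0).
    by apply: eq_bigr => i _; rewrite coefXnM ltnNge; case: leqP; rewrite ?mulr0.
  have aM : (a <= M.+1)%N by lia.
  rewrite -(big_mkord xpredT (fun i => if (a <= i)%N then P`_i * P`_(i - a) else 0)).
  rewrite -(big_mkord xpredT (fun i => P`_i * P`_(i + a))).
  rewrite (big_cat_nat (leq0n a) aM) //= big_nat_cond big1 ?add0r; last first.
    by move=> i; rewrite andbT => /andP[_]; rewrite ltnNge; case: leqP.
  rewrite -{1}[a]add0n big_addn [RHS](big_cat_nat (leq0n (M.+1 - a)) (leq_subr a _)) /=.
  rewrite [X in _ = _ + X]big_nat_cond [X in _ = _ + X]big1 ?addr0; last first.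
    move=> i; rewrite andbT => /andP[h _].
    by rewrite [P`_(i + a)]nth_default ?mulr0 //; apply: leq_trans sP _; lia.
  by apply: eq_bigr => i _; rewrite leq_addl addnK mulrC.
case: a ba ha => // a ba ha; rewrite subSS !exprS -!mulrA coef_pair_shift.
  by rewrite IH //; [congr autocorr; lia | lia | lia].
apply: leq_trans (size_XnM _ _) _.
by apply: (@leq_trans (b + (a - b + size P))); [rewrite leq_add2l size_XnM | lia].
Qed.

(** [1 + 'X^2] is ['X] times [T = 'X + 'X^-1]: the powers of ['X] add up in the shift, and [T],
    being self-adjoint, acts [i + j] times on the autocorrelation. *)
Lemma coef_pair_T M P i j a b :
  (a + i.*2 + size P <= M.+1)%N -> (b + j.*2 + size P <= M.+1)%N ->
  coef_pair M ((1 + 'X^2) ^+ i * ('X^a * P)) ((1 + 'X^2) ^+ j * ('X^b * P)) =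
  iter (i + j) seqT (autocorr P) ((a + i)%:Z - (b + j)%:Z).
Proof.
elim: i a => [|i IHi] a ha hb.
  rewrite expr0 mul1r addn0 add0n; elim: j b hb => [|j IHj] b hb.
    by rewrite expr0 mul1r addn0 coef_pair_Xn //; lia.
  have -> : (1 + 'X^2) ^+ j.+1 * ('X^b * P) =
      (1 + 'X^2) ^+ j * ('X^b * P) + (1 + 'X^2) ^+ j * ('X^(b.+2) * P).
    by rewrite !exprS; ring.
  rewrite coef_pairC coef_pairDl ![coef_pair _ _ ('X^a * _)]coef_pairC !IHj; [|lia|lia].
  by rewrite iterS /seqT addrC; congr (_ + _);
       apply: (congr1 (iter j seqT (autocorr P))); lia.
have -> : (1 + 'X^2) ^+ i.+1 * ('X^a * P) =
    (1 + 'X^2) ^+ i * ('X^a * P) + (1 + 'X^2) ^+ i * ('X^(a.+2) * P).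
  by rewrite !exprS; ring.
rewrite coef_pairDl !IHi; [|lia|lia|lia|lia].
by rewrite addSn iterS /seqT; congr (_ + _);
  apply: (congr1 (iter (i + j) seqT (autocorr P))); lia.
Qed.

(** This is [(al + be y)(al + be / y) = al^2 + be^2 + al be (y + 1/y)]. *)
Lemma autocorr_linear (al be : K) P d :
  autocorr ((al%:P + be *: 'X) * P) d =
  (al ^+ 2 + be ^+ 2) * autocorr P d + al * be * seqT (autocorr P) d.
Proof.
wlog: d / 0 <= d => [hw|d0].
  case: (leP 0 d) => [|h]; first exact: hw.
  rewrite -autocorr_even hw; last by lia.
  by rewrite autocorr_even (seqT_even (@autocorr_even P)).
case: d d0 => // k _; set Q := (_ + _) * P.
have QE a : 'X^a * Q = al *: ('X^a * P) + be *: ('X^(a.+1) * P).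
  by rewrite /Q exprS mulrDl mulrDr mul_polyC -!scalerAl -!scalerAr !mulrA ['X * 'X^a]mulrC.
pose M := (k + size P + size Q + 2)%N.
rewrite -[Posz k]subr0 -(@coef_pair_Xn M Q k 0) ?QE; [|by rewrite /M; lia|by rewrite /M; lia].
rewrite coef_pairDl !coef_pairZl ![coef_pair _ ('X^ _ * P) _]coef_pairC !coef_pairDl !coef_pairZl.
rewrite !(coef_pairC M _ ('X^k * P)) !(coef_pairC M _ ('X^(k.+1) * P)).
rewrite !coef_pair_Xn; try by rewrite /M; lia.
have e1 : k%:Z - 1%:Z = k%:Z - 0 - 1 by rewrite subr0.
have e2 : k.+1%:Z - 0%:Z = k%:Z - 0 + 1 by rewrite !subr0 -addn1 PoszD.
have e3 : k.+1%:Z - 1%:Z = k%:Z - 0 by rewrite subr0 -addn1 PoszD addrK.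
rewrite /seqT e1 e2 e3.
move: (autocorr P (k%:Z - 0)) (autocorr P (k%:Z - 0 - 1)) (autocorr P (k%:Z - 0 + 1)).
by move=> x y z; ring.
Qed.

End Sequences.

Lemma iter_seqT_morph (K L : comNzRingType) (f : {rmorphism K -> L}) (F : int -> K)
    (F' : int -> L) j : (forall d, F' d = f (F d)) ->
  forall d, iter j (@seqT L) F' d = f (iter j (@seqT K) F d).
Proof. by move=> e; elim: j => [d|j IH d] //=; rewrite /seqT !IH rmorphD. Qed.

Section TridiagonalMoments.
Variables al be : int.

(* Coefficients of [T^i u_0] on the family [u], when [T] is tridiagonal. *)
Fixpoint tri_coef (i b : nat) : int :=
  match i with
  | 0 => (b == 0)%:R
  | i'.+1 => (if b is b'.+1 then (if b' == 0 then al else 1) * tri_coef i' b'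
              else be * tri_coef i' 0) + tri_coef i' b.+1
  end.

Lemma tri_coef_gt i b : (i < b)%N -> tri_coef i b = 0.
Proof.
elim: i b => [|i IH] [|b] //= h.
by rewrite !IH ?mulr0 //; lia.
Qed.

Lemma tri_coef_diag i : tri_coef i.+1 i.+1 = al.
Proof.
elim: i => [|i IH]; first by rewrite /= mulr1 addr0.
rewrite -[LHS]/(1 * tri_coef i.+1 i.+1 + tri_coef i.+1 i.+3) IH.
by rewrite tri_coef_gt ?mul1r ?addr0.
Qed.

Variable R : comNzRingType.

(** The free recurrence of [T] on a half line; [al] and [be] record how an even sequence folds back
    at 0. *)
Definition tri_op (u : nat -> R) (b : nat) : R :=
  if b is b'.+1 then u b' + u b'.+2 else al%:~R * u 1%N + be%:~R * u 0%N.

Lemma sum_ord_shift (f : nat -> R) B : f B = 0 ->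
  \sum_(b < B.+1) (if b : nat is b'.+1 then f b' else 0) = \sum_(b < B.+1) f b.
Proof. by move=> fB; rewrite big_ord_recl [RHS]big_ord_recr /= fB add0r addr0. Qed.

(** Summation by parts: [tri_coef i.+1] is the transpose of [tri_op] applied to [tri_coef i]. There
    is no term at the far end because [tri_coef i] vanishes beyond [i]. *)
Lemma tri_coef_step (u : nat -> R) i B : (i.+1 < B)%N ->
  \sum_(b < B) (tri_coef i.+1 b)%:~R * u b = \sum_(b < B) (tri_coef i b)%:~R * tri_op u b.
Proof.
case: B => [|B] // iB.
pose fA b : R := (if b == 0%N then al else 1)%:~R * (tri_coef i b)%:~R * u b.+1.
pose fB b : R := (tri_coef i b.+1)%:~R * u b.
pose fC b : R := if b is 0%N then be%:~R * (tri_coef i 0)%:~R * u 0%N else 0.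
have fA0 : fA B = 0 by rewrite /fA tri_coef_gt ?mulr0 ?mul0r.
have fB0 : fB B = 0 by rewrite /fB tri_coef_gt ?mul0r // ltnW.
transitivity (\sum_(b < B.+1) ((if b : nat is b'.+1 then fA b' else 0) + fC b + fB b)).
  apply: eq_bigr => -[[|b] hb] _ /=; rewrite /fA /fB /fC !rmorphD !rmorphM /=; ring.
rewrite !big_split /= sum_ord_shift // -(sum_ord_shift fB0) -!big_split /=.
apply: eq_bigr => -[[|b] hb] _ /=; rewrite /fA /fB /fC /=; ring.
Qed.

Variables (M : nat -> nat -> R).
Hypothesis M_rec : forall b j, M b j.+1 = tri_op (M ^~ j) b.

Lemma tri_coef_row i j B : (i < B)%N ->
  M 0 (i + j)%N = \sum_(b < B) (tri_coef i b)%:~R * M b j.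
Proof.
elim: i j => [|i IH] j iB.
  case: B iB => // B _; rewrite big_ord_recl /= mul1r big1 ?addr0 // => b _.
  by rewrite mul0r.
rewrite (tri_coef_step (M ^~ j)) // addSnnS IH; last exact: ltnW.
by apply: eq_bigr => b _; rewrite M_rec.
Qed.

Variables (w : nat) (t : R) (v : nat -> R).
Hypothesis v_ker : forall b, (b < w)%N -> t * tri_op v b = - (1 + t ^+ 2) * v b.

Arguments tri_coef : simpl never.

(** Border the moments by the column [v] to get [B], and let the rows of [A] after the first hold
    the coordinates of [T^i u_0] under [(1 + t^2) + t T]. These rows kill [v], so [A *m B] has first
    column [v 0] followed by zeros, and its complementary block is the matrix on the left. [A] is
    triangular with diagonal 1, [t al], ..., [t al], and expanding [B] along [v] gives the minors on
    the right. *)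
Lemma det_tridiagonal :
  v 0%N * \det (\matrix_(i < w, j < w)
     ((1 + t ^+ 2) * M 0 (i + j)%N + t * M 0 (i + j).+1)) =
  (t * al%:~R) ^+ w *
  \sum_(b < w.+1) (-1) ^+ b * v b * \det (\matrix_(i < w, j < w) M (bump b i) j).
Proof.
pose Q i b : R := (1 + t ^+ 2) * (tri_coef i b)%:~R + t * (tri_coef i.+1 b)%:~R.
pose A : 'M[R]_w.+1 :=
  \matrix_(i, b) (if i : nat is i'.+1 then Q i' b else (b == 0 :> nat)%:R).
pose B : 'M[R]_w.+1 :=
  \matrix_(b, j) (if j : nat is j'.+1 then M b j' else v b).
have Qv i : (i < w)%N -> \sum_(b < w.+1) Q i b * v b = 0.
  move=> iw; under eq_bigr => b _ do rewrite mulrDl -!mulrA.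
  rewrite big_split /= -!mulr_sumr (tri_coef_step v) // [X in _ + X]mulr_sumr.
  under [X in _ + X]eq_bigr => b _.
    rewrite (_ : _ * _ = - ((1 + t ^+ 2) * ((tri_coef i b)%:~R * v b))); last first.
      (* The kernel relation is assumed only below [w]; at [b = w] the coefficient [tri_coef i w]
         vanishes since [i < w]. *)
      case: (ltnP b w) => hb; first by rewrite mulrCA v_ker //; ring.
      by rewrite tri_coef_gt ?(leq_trans iw) //; ring.
    over.
  by rewrite sumrN -mulr_sumr subrr.
have QM i j : (i < w)%N -> \sum_(b < w.+1) Q i b * M b j =
    (1 + t ^+ 2) * M 0 (i + j)%N + t * M 0 (i + j).+1.
  move=> iw; under eq_bigr => b _ do rewrite mulrDl -!mulrA.
  rewrite big_split /= -!mulr_sumr -!tri_coef_row ?addSn //; exact: leqW.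
have detA : \det A = (t * al%:~R) ^+ w.
  rewrite det_trig; last first.
    apply/is_trig_mxP => -[[|i] hi] [b hb] /= ib; rewrite mxE /=.
      by rewrite gtn_eqF.
    by rewrite /Q !tri_coef_gt ?mulr0 ?addr0 //; exact: ltnW.
  rewrite big_ord_recl mxE /= mul1r -[w in RHS]card_ord -prodr_const; apply: eq_bigr => i _.
  by rewrite mxE /= /bump /= ?add1n ?add0n /Q tri_coef_diag tri_coef_gt // mulr0 add0r.
have detB : \det B =
    \sum_(b < w.+1) (-1) ^+ b * v b * \det (\matrix_(i < w, j < w) M (bump b i) j).
  rewrite (expand_det_col _ ord0); apply: eq_bigr => b _.
  rewrite /cofactor mxE /= addn0 mulrCA mulrA; congr (_ * \det _).
  by apply/matrixP => i j; rewrite !mxE.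
rewrite -detB -detA -det_mulmx [RHS](expand_det_col _ ord0) big_ord_recl.
rewrite [X in _ = _ + X]big1 ?addr0.
  rewrite mxE (bigD1 ord0) //= !mxE /= mul1r big1 ?addr0; last first.
    by case=> [[|b] hb] //= _; rewrite !mxE /= mul0r.
  congr (_ * _); rewrite /cofactor /= expr0 mul1r; congr (\det _).
  apply/matrixP => i j; rewrite !mxE -QM //; apply: eq_bigr => b _.
  by rewrite !mxE.
move=> i _; rewrite mxE; rewrite [X in X * _](_ : _ = 0) ?mul0r //.
transitivity (\sum_(b < w.+1) Q i b * v b); last exact: Qv.
by apply: eq_bigr => b _; rewrite !mxE.
Qed.

End TridiagonalMoments.

(** The rows of the four determinants: with [sig] equal to 0, [-s], [-1] for [r = 0, 1, 2] these are
    [F b], [F b - s F (b+1)] and [F b - F (b+2)]. *)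
Definition psi (sig : int) (r : nat) (K : comNzRingType) (F : int -> K) (b : nat) : K :=
  F b%:Z + sig%:~R * F (b + r)%N%:Z.

(* The numerical data attached to a choice of signs [eta]: the determinant with
   signs [eta] has the rows [psi sig r (T^j f) b], which satisfy the tridiagonal
   relations of [tri_op al be]. *)
Record sign_case (r : nat) (eta : 'I_r -> int) (sig al be cc nu : int) : Prop := SignCase {
  sc_sq : forall c, eta c ^+ 2 = 1;
  sc_sig : r = 0%N -> sig = 0;
  sc_inj : injective eta;
  sc_root : forall (K : comNzRingType) (P : {poly K}) j,
    iter j (@seqT K) (autocorr (root_poly eta K * P)) 0 =
    cc%:~R * psi sig r (iter j (@seqT K) (autocorr P)) 0;
  sc_rec : forall (K : comNzRingType) (F : int -> K), even_seq F ->
    forall b, psi sig r (seqT F) b = tri_op al be (psi sig r F) b;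
  sc_nu : forall (K : comNzRingType) (t : K),
    1 + (sgprod eta)%:~R * t ^+ r = nu%:~R * \prod_c (1 + (eta c)%:~R * t);
  sc_ker : forall (K : comNzRingType) (t : K),
    al%:~R * (1 + (sgprod eta)%:~R * t ^+ r.+2)
      - be%:~R * t * (1 + (sgprod eta)%:~R * t ^+ r) =
    (1 + t ^+ 2) * (1 + (sgprod eta)%:~R * t ^+ r);
  sc_nz : [&& al != 0, cc != 0 & nu != 0] }.

Definition torsion_free (K : comNzRingType) :=
  forall (x : K) m, (0 < m)%N -> x *+ m = 0 -> x = 0.

Section SignedDeterminant.
Variables (r : nat) (eta : 'I_r -> int) (sig al be cc nu : int).
Hypothesis sc : sign_case eta sig al be cc nu.
Variable w : nat.
Local Notation n := (w + w + r)%N.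
Hypothesis n_gt0 : (0 < n)%N.

(* The coefficient of [t^k] of the sum in [omega_identity]. *)
Definition gap_sum (K : comNzRingType) (E : {poly K}) (M k : nat) : K :=
  \sum_(a : {ffun 'I_n -> 'I_M} | decr a)
     \det (\matrix_(p, q) ('X^(n.-1 - p) * E)`_(a q)) *
     ((odd_gaps a == k)%:R + (sgprod eta)%:~R * (n - odd_gaps a == k)%N%:R).

Definition psi_det (K : comNzRingType) (F : int -> K) (b : nat) : K :=
  \det (\matrix_(i < w, j < w) psi sig r (iter j (@seqT K) F) (bump b i)).

(* [omega_identity] is applied with an indeterminate [t]; the factor
   [prod_c (1 + eta_c t)] is cancelled through [sc_nu]. *)
Lemma gap_sum_proportional : exists C1 C2 : int, C2 != 0 /\
  forall (K : comNzRingType) (E : {poly K}) (M k : nat), torsion_free K ->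
    (n + size E + 4 <= M)%N -> (k <= w)%N ->
  C1%:~R * gap_sum E M k =
  C2%:~R * (\prod_c E.[(eta c)%:~R]) * (1 + ((r == 0%N) && (k == w))%:R) *
    psi_det (autocorr E) (w - k).
Proof.
exists (nu * (\det (basis_mx w eta) * pfw0 w eta)).
exists ((- 2) ^+ w * coroot_const eta * pf_symp w r * cc ^+ w * al ^+ w).
have /and3P[al0 cc0 nu0] := sc_nz sc.
split.
  rewrite !mulf_neq0 ?expf_neq0 ?oppr_eq0 ?coroot_const_neq0 ?pf_symp_neq0 //.
  exact: sc_inj sc.
move=> K E M k tfK M_big kw.
pose R : comNzRingType := {poly K}.
have R2 (x : R) : x *+ 2 = 0 -> x = 0.
  move=> e; apply/polyP => i; rewrite coef0; apply: (tfK _ 2%N) => //.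
  by rewrite -coefMn e coef0.
pose E' : {poly R} := map_poly polyC E.
have sE' : size E' = size E by apply: size_map_inj_poly => //; exact: polyC_inj.
have coefE' m i : ('X^m * E')`_i = (('X^m * E)`_i)%:P.
  by rewrite /E' -(map_polyXn polyC) -rmorphM /= coef_map.
have evE' c : E'.[(eta c)%:~R] = (E.[(eta c)%:~R])%:P.
  by rewrite -horner_map /= rmorph_int.
have acE' d : autocorr E' d = (autocorr E d)%:P.
  rewrite /autocorr sE' rmorph_sum; apply: eq_bigr => i _.
  by rewrite rmorphM /= !coef_map.
have itE' j d : iter j (@seqT R) (autocorr E') d = (iter j (@seqT K) (autocorr E) d)%:P.
  exact: (iter_seqT_morph (f := polyC)).
have psiE' j b : psi sig r (iter j (@seqT R) (autocorr E')) b =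
                 (psi sig r (iter j (@seqT K) (autocorr E)) b)%:P.
  by rewrite /psi !itE' polyCD polyCM -[(sig%:~R)%:P]/(polyC _) rmorph_int.
have M_big' : (n + size E' + 4 <= M)%N by rewrite sE'.
have om := omega_identity (sc_sq sc) ('X : R) R2 n_gt0 M_big'.
pose Mt b j : R := psi sig r (iter j (@seqT R) (autocorr E')) b.
have Mt_rec b j : Mt b j.+1 = tri_op al be (Mt^~ j) b.
  rewrite /Mt /=; apply: (sc_rec sc); apply: iter_seqT_even.
  exact: autocorr_even.
pose G : {poly R} := E' * (1 + 'X *: 'X).
have acG m b : psi sig r (iter m (@seqT R) (autocorr G)) b =
    (1 + 'X ^+ 2) * Mt b m + 'X * Mt b m.+1.
  have h d : iter m (@seqT R) (autocorr G) d =
     (1 + 'X ^+ 2) * iter m (@seqT R) (autocorr E') d +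
     'X * iter m.+1 (@seqT R) (autocorr E') d.
    rewrite iterSr; apply: iter_seqT_lin => d'.
    rewrite /G mulrC -[1 in RHS](expr1n _ 2) -['X in RHS]mul1r.
    by rewrite (_ : 1 = (1 : R)%:P) // autocorr_linear mul1r.
  by rewrite /Mt /psi !h; ring.
(* The factor [root_poly] turns the central value into [cc] times [psi] at 0, and [1 + t y] turns
   each moment into [(1 + t^2) + t T] of it. *)
have momE : moment_mx w eta ('X : R) E' M = cc%:~R *:
    \matrix_(i < w, j < w) ((1 + 'X ^+ 2) * Mt 0 (i + j)%N + 'X * Mt 0 (i + j).+1).
  apply/matrixP => i j; rewrite !mxE /centred.
  have hs : (size (root_poly eta R * G)%R <= r + size E' + 1)%N.
    apply: leq_trans (size_polyMleq _ _) _; rewrite size_root_poly /=.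
    rewrite -addnA leq_add2l; apply: leq_trans (size_polyMleq _ _) _.
    apply: (@leq_trans (size E' + 2).-1); last by rewrite addn2 addn1.
    rewrite -!subn1 leq_sub2r // leq_add2l.
    apply: leq_trans (size_polyD _ _) _; rewrite size_poly1 geq_max /=.
    by apply: leq_trans (size_scale_leq _ _) _; rewrite size_polyX.
  have bnd (i' : 'I_w) : (w.-1 - i' + i'.*2 + size (root_poly eta R * G)%R <= M.+1)%N.
    apply: (@leq_trans (w.-1 - i' + i'.*2 + (r + size E' + 1))); first by rewrite leq_add2l.
    by have := ltn_ord i'; move: M_big'; lia.
  rewrite coef_pair_T ?bnd //.
  have -> : (w.-1 - i + i)%:Z - (w.-1 - j + j)%:Z = 0 :> int.
    by have := ltn_ord i; have := ltn_ord j; lia.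
  by rewrite (sc_root sc) acG.
(* Both [(-1)^b t^b] and [(-1)^b t^(-b)] solve [t (v_(b-1) + v_(b+1)) = - (1 + t^2) v_b]. This
   combination also meets the boundary relation at 0, by [sc_ker], and [t^w] clears the
   denominators. *)
pose v b : R := (-1) ^+ b * ('X ^+ (w - b) + (sgprod eta)%:~R * 'X ^+ (w + b + r)).
have v_ker b : (b < w)%N -> 'X * tri_op al be v b = - (1 + 'X ^+ 2) * v b.
  case: b => [|b] bw.
    have := sc_ker sc ('X : R); rewrite /tri_op /v.
    case: (w) bw => // w' _; rewrite subn0 addn0 subSS subn0.
    rewrite (_ : (w'.+1 + 1 + r = w' + r.+2)%N); last by lia.
    rewrite (_ : (w'.+1 + r = w' + r.+1)%N); last by lia.
    rewrite expr0 expr1 !exprD !(exprS 'X) expr0.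
    move: ('X : R) ((sgprod eta)%:~R : R) (al%:~R : R) (be%:~R : R) => x ep a b.
    move: (x ^+ r) (x ^+ w') => xr xw /(congr1 (fun y => - (x * xw) * y)) /= h.
    transitivity (- (x * xw) * (a * (1 + ep * (x * (x * xr))) - b * x * (1 + ep * xr))).
      by ring.
    by rewrite h; ring.
  rewrite /tri_op /v (_ : w - b = (w - b.+2).+2)%N; last by lia.
  rewrite (_ : w - b.+1 = (w - b.+2).+1)%N; last by lia.
  by rewrite !addnS !addSn !exprS; ring.
have dt := det_tridiagonal Mt_rec v_ker.
have v0 : v 0%N = 'X ^+ w * (nu%:~R * \prod_c (1 + (eta c)%:~R * 'X)).
  by rewrite /v -(sc_nu sc) subn0 addn0 expr0 exprD; ring.
have Gev : \prod_c G.[(eta c)%:~R] =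
    (\prod_c E.[(eta c)%:~R])%:P * \prod_c (1 + (eta c)%:~R * 'X) :> R.
  rewrite rmorph_prod -big_split; apply: eq_bigr => c _.
  by rewrite hornerM evE' hornerD hornerZ hornerX hornerC [_ * 'X]mulrC.
pose N : R :=
   \det (\matrix_(i < w, j < w) ((1 + 'X ^+ 2) * Mt 0 (i + j)%N + 'X * Mt 0 (i + j).+1)).
have dN : \det (moment_mx w eta ('X : R) E' M) = cc%:~R ^+ w * N.
  by rewrite momE detZ.
rewrite -/N in dt.
have dM b : \det (\matrix_(i < w, j < w) Mt (bump b i) j) = (psi_det (autocorr E) b)%:P.
  rewrite /psi_det -det_map_mx; congr (\det _); apply/matrixP => i j.
  by rewrite !mxE; exact: psiE'.
have key : (nu * (\det (basis_mx w eta) * pfw0 w eta))%:~R * ('X ^+ w *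
  (\sum_(a : {ffun 'I_n -> 'I_M} | decr a)
     (\det (\matrix_(p, q) ('X^(n.-1 - p) * E)`_(a q)))%:P *
     ('X ^+ odd_gaps a + (sgprod eta)%:~R * 'X ^+ (n - odd_gaps a)))) =
  ((- 2) ^+ w * coroot_const eta * pf_symp w r * cc ^+ w * al ^+ w)%:~R *
  (\prod_c E.[(eta c)%:~R])%:P * ('X ^+ w *
  \sum_(b < w.+1) ('X ^+ (w - b) + (sgprod eta)%:~R * 'X ^+ (w + b + r)) *
    (psi_det (autocorr E) b)%:P) :> R.
  have -> : \sum_(b < w.+1) ('X ^+ (w - b) + (sgprod eta)%:~R * 'X ^+ (w + b + r)) *
    (psi_det (autocorr E) b)%:P =
    \sum_(b < w.+1) (-1) ^+ b * v b * \det (\matrix_(i < w, j < w) Mt (bump b i) j) :> R.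
    apply: eq_bigr => b _; rewrite dM /v mulrA -expr2 sqrr_sign mul1r.
    by [].
  have -> : \sum_(a : {ffun 'I_n -> 'I_M} | decr a)
     (\det (\matrix_(p, q) ('X^(n.-1 - p) * E)`_(a q)))%:P *
     ('X ^+ odd_gaps a + (sgprod eta)%:~R * 'X ^+ (n - odd_gaps a)) =
     \sum_(a : {ffun 'I_n -> 'I_M} | decr a)
     \det (\matrix_(p, q) ('X^(n.-1 - p) * E')`_(a q)) *
     ('X ^+ odd_gaps a + (sgprod eta)%:~R * 'X ^+ (n - odd_gaps a)) :> R.
    apply: eq_bigr => a _; congr (_ * _); rewrite -det_map_mx; congr (\det _).
    by apply/matrixP => p q; rewrite !mxE coefE'.
  rewrite [X in X * _ = _]rmorphM /= mulrACA om Gev dN.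
  move: dt; rewrite v0 exprMn => dt.
  transitivity (((- 2) ^+ w * coroot_const eta * pf_symp w r)%:~R * (\prod_c E.[(eta c)%:~R])%:P *
     cc%:~R ^+ w * ('X ^+ w * (nu%:~R * \prod_c (1 + (eta c)%:~R * 'X)) * N)); first by ring.
  by rewrite dt !rmorphM /= !rmorphXn /=; ring.
(* Reading the coefficient at [w + k] removes the common factor [t^w] without dividing by it. *)
move/(congr1 (fun P : {poly K} => P`_(w + k))): key.
have intC (z : int) : z%:~R = (z%:~R : K)%:P by rewrite rmorph_int.
rewrite [X in X * _]intC [(_ * al ^+ w)%:~R in RHS]intC -polyCM !coefCM !coefXnM.
rewrite !ltnNge !leq_addr /= addKn => key.
rewrite -[X in X = _]/(_ * _); move: key; rewrite !coef_sum.
have -> : \sum_(a : {ffun 'I_n -> 'I_M} | decr a)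
  ((\det (\matrix_(p, q) ('X^(n.-1 - p) * E)`_(a q)))%:P *
     ('X ^+ odd_gaps a + (sgprod eta)%:~R * 'X ^+ (n - odd_gaps a)))`_k = gap_sum E M k.
  apply: eq_bigr => a _; rewrite coefCM; congr (_ * _).
  by rewrite intC coefD coefCM !coefXn !(eq_sym k).
move=> ->; rewrite -!mulrA; congr (_ * (_ * _)).
(* The exponent [w - b] equals [k] for [b = w - k] only. The reflected exponent [w + b + r] is at
   least [w >= k], with equality only if [r = 0], [b = 0] and [k = w]: this is the origin of the
   factor 2 in the third identity. *)
have wk : (w - k < w.+1)%N by lia.
rewrite (bigD1 (Ordinal wk)) //= intC mulrC coefCM coefD coefCM !coefXn subKn // eqxx.
rewrite [X in _ + X]big1 ?addr0.
  rewrite mulrC; congr ((_ + _) * _); case: (eqVneq r 0%N) => r0 /=.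
    have -> : sgprod eta = 1 by rewrite /sgprod big1 // => c _; exfalso; move: (ltn_ord c); lia.
    by rewrite mul1r; congr (nat_of_bool _)%:R; lia.
  rewrite (_ : (k == _) = false) ?mulr0 //; lia.
move=> b; rewrite -(inj_eq val_inj) /= => bk; rewrite mulrC coefCM coefD coefCM !coefXn.
rewrite (_ : (k == w - b)%N = false); last by have := ltn_ord b; lia.
rewrite (_ : (k == w + b + r)%N = false) ?mulr0 ?addr0 ?mulr0 //; lia.
Qed.

End SignedDeterminant.

Lemma decr_gap n M (a : {ffun 'I_n -> 'I_M}) (p q : 'I_n) :
  decr a -> (p <= q)%N -> (a q + (q - p) <= a p)%N.
Proof.
move=> /decrP da; case: q => q; elim: q => [|q IH] hq pq /=.
  by rewrite (_ : Ordinal hq = p) ?addn0 //; apply: val_inj; move: pq => /=; lia.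
move: pq; rewrite leq_eqVlt => /orP[/eqP e|pq] /=.
  by rewrite (_ : Ordinal hq = p) ?e /= ?subnn ?addn0 //; exact: val_inj.
have := IH (ltnW hq) pq; have /= := da (Ordinal (ltnW hq)) (Ordinal hq) (ltnSn q).
by lia.
Qed.

Lemma torsion_free_int : torsion_free int.
Proof. by move=> x m m0 /eqP; rewrite mulrn_eq0 eqn0Ngt m0 /= => /eqP. Qed.

(** * The constants, from the polynomial 1 *)

Section Normalised.
Variables (r : nat) (eta : 'I_r -> int) (sig al be cc nu : int).
Hypothesis sc : sign_case eta sig al be cc nu.
Variable w : nat.
Local Notation n := (w + w + r)%N.
Hypothesis n_gt0 : (0 < n)%N.

(* Only the staircase survives: the minors of the [y^(n-1-p)] are 0 or 1. *)
Lemma gap_sum1 M : (n <= M)%N -> gap_sum eta w (1 : {poly int}) M 0 = 1.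
Proof.
move=> nM; pose a0 : {ffun 'I_n -> 'I_M} := [ffun p => widen_ord nM (rev_ord p)].
have a0E p : a0 p = (n.-1 - p)%N :> nat by rewrite ffunE /=; have := ltn_ord p; lia.
have d0 : decr a0.
  by apply/decrP => p q pq; rewrite !a0E; have := ltn_ord q; lia.
have odd0 : odd_gaps a0 = 0%N.
  by rewrite /odd_gaps big1 // => p _; rewrite a0E addnn odd_double.
rewrite /gap_sum (bigD1 a0) //= odd0 big1 ?addr0.
  rewrite subn0 (gtn_eqF n_gt0) mulr0 addr0 mulr1 -[RHS](det1 _ n); congr (\det _).
  apply/matrixP => p q; rewrite !mxE mulr1 coefXn -[p == q](inj_eq val_inj).
  congr (nat_of_bool _)%:R; have := a0E q; move: (a0 q) => x xE.
  rewrite xE -[\val p]/(nat_of_ord p) -[\val q]/(nat_of_ord q).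
  have key (x1 x2 : nat) : (x1 < n)%N -> (x2 < n)%N ->
    (n.-1 - x2 == n.-1 - x1)%N = (x1 == x2) by lia.
  exact: key.
move=> a /andP[da na].
case: (ltnP (a (Ordinal n_gt0)) n) => h.
  have hn : (n.-1 < n)%N by move: n_gt0; lia.
  case/eqP: na; apply/ffunP => p; apply: val_inj.
  rewrite -[LHS]/(nat_of_ord (a p)) -[RHS]/(nat_of_ord (a0 p)) a0E.
  have h1 := decr_gap da (leq0n p : (Ordinal n_gt0 <= p)%N).
  have pn : (p <= Ordinal hn)%N by rewrite /=; have := ltn_ord p; lia.
  by have := decr_gap da pn; move: h h1; rewrite /=; lia.
rewrite (expand_det_col _ (Ordinal n_gt0)) big1 ?mul0r // => p _.
rewrite mxE mulr1 coefXn (_ : (_ == _) = false) ?mul0r //.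
by have := ltn_ord p; lia.
Qed.

(** The autocorrelation of 1 is the delta at 0, and [T] moves one step left or right: [j] steps
    reach no farther than [j], and reach [j] in one way. *)
Lemma iter_seqT_delta j (d : int) :
  ((j < `|d|)%N -> iter j (@seqT int) (autocorr 1) d = 0) /\
  iter j (@seqT int) (autocorr 1) j%:Z = 1.
Proof.
have a1 d' : autocorr (1 : {poly int}) d' = (`|d'|%N == 0%N)%:R.
  by rewrite /autocorr size_poly1 big_ord1 coef1 mul1r coef1 add0n.
elim: j d => [|j IH] d; first by rewrite /= !a1; split=> // h; rewrite gtn_eqF.
rewrite /= /seqT; split.
  by move=> h; rewrite (IH (d - 1)).1 ?(IH (d + 1)).1 //; lia.
rewrite (_ : j.+1%:Z - 1 = j%:Z) ?(IH 0).2; last by lia.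
by rewrite (IH _).1 ?addr0 //; lia.
Qed.

Lemma psi_det1 : psi_det r sig w (autocorr (1 : {poly int})) w = 1.
Proof.
have F0 i j : (j < i)%N -> iter j (@seqT int) (autocorr 1) i%:Z = 0.
  by move=> h; apply: (iter_seqT_delta _ _).1; rewrite absz_nat.
rewrite /psi_det -det_tr det_trig.
  rewrite big1 // => i _; rewrite !mxE (_ : bump w i = i); last first.
    by rewrite /bump leqNgt ltn_ord.
  rewrite /psi (iter_seqT_delta _ 0).2.
  case: (posnP r) => [/(sc_sig sc) ->|r0]; first by rewrite mul0r addr0.
  by rewrite F0 ?mulr0 ?addr0 //; lia.
apply/is_trig_mxP => i j ij; rewrite !mxE (_ : bump w j = j); last first.
  by rewrite /bump leqNgt ltn_ord.
by rewrite /psi !F0 ?mulr0 ?addr0 //; apply: ltn_addr.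
Qed.

(** The case [E = 1], [k = 0] over the integers, where [gap_sum] and [psi_det] are both 1, gives
    [C1 = C2]; this nonzero integer is then cancelled in the torsion-free ring [K]. *)
Theorem gap_sum_det (K : comNzRingType) (E : {poly K}) (M k : nat) : torsion_free K ->
    (n + size E + 4 <= M)%N -> (k <= w)%N ->
  gap_sum eta w E M k =
  (\prod_c E.[(eta c)%:~R]) * (1 + ((r == 0%N) && (k == w))%:R) *
    psi_det r sig w (autocorr E) (w - k).
Proof.
have [C1 [C2 [C20 h]]] := gap_sum_proportional sc n_gt0.
move=> tfK M_big kw.
have C12 : C1 = C2.
  (* The cutoff [n + 5] is the least one allowed, [n + size E + 4] with [E = 1]. *)
  have := h int 1 (n + 5)%N 0%N torsion_free_int.
  rewrite size_poly1 -addnA leqnn leq0n gap_sum1 ?leq_addr // subn0 psi_det1.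
  rewrite big1 => [|c _]; last by rewrite -polyC1 hornerC.
  rewrite (_ : (r == 0%N) && (0%N == w) = false) ?addr0 ?mulr1; last by move: n_gt0; lia.
  by rewrite !intz => ->.
have := h K E M k tfK M_big kw; rewrite C12 -!mulrA => /eqP.
rewrite -subr_eq0 -mulrBr => /eqP e; apply/eqP; rewrite -subr_eq0; apply/eqP.
move: e C20; case: (C2) => [m|m] e C20.
  by apply: (tfK _ m); [move: C20; case: m {e} | rewrite -[LHS]mulr_natl; exact: e].
apply: (tfK _ m.+1) => //; rewrite -[LHS]mulr_natl; apply: oppr_inj.
by rewrite oppr0 -mulNr -[RHS]e NegzE mulrNz.
Qed.

End Normalised.

Lemma seqT_S (K : comNzRingType) (F : int -> K) (b : nat) :
  seqT F b.+1%:Z = F b%:Z + F b.+2%:Z.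
Proof.
have e1 : b.+1%:Z - 1 = b%:Z by rewrite -addn1 PoszD addrK.
have e2 : b.+1%:Z + 1 = b.+2%:Z by rewrite -PoszD addn1.
by rewrite /seqT e1 e2.
Qed.

Lemma seqT_0 (K : comNzRingType) (F : int -> K) : even_seq F ->
  seqT F 0 = F 1%N%:Z *+ 2.
Proof. by move=> eF; rewrite /seqT sub0r add0r eF mulr2n. Qed.

(** [al = 2] because an even sequence has [(T F)_0 = 2 F_1]; [nu = 2] because [1 + t^0 = 2] faces an
    empty product. *)
Lemma sign_case0 : sign_case (fun _ : 'I_0 => 1) 0 2 0 1 2.
Proof.
have sg1 : sgprod (fun _ : 'I_0 => 1) = 1 by rewrite /sgprod big_ord0.
split=> //.
- by case.
- move=> K P j; rewrite /psi mul0r addr0 mul1r; congr (iter _ _ (autocorr _) _).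
  by rewrite /root_poly big_ord0 mul1r.
- move=> K F eF [|b]; rewrite /psi /tri_op ?mul0r ?addr0.
    by rewrite seqT_0 //; ring.
  by rewrite seqT_S.
- by move=> K t; rewrite sg1 big_ord0 expr0; ring.
- by move=> K t; rewrite sg1 expr0; ring.
Qed.

(** Multiplying by ['X - s] turns the autocorrelation [F] into [2 F - s T F], whose value at 0 is
    [2 (F_0 - s F_1)], hence [cc = 2]. At the boundary, [2 F_1 - s (F_0 + F_2)] equals
    [psi_1 - s psi_0] because [s^2 = 1]. *)
Lemma sign_case1 (s : int) : s ^+ 2 = 1 -> sign_case (fun _ : 'I_1 => s) (- s) 1 (- s) 2 1.
Proof.
move=> s2; have sg1 : sgprod (fun _ : 'I_1 => s) = s by rewrite /sgprod big_ord1.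
have s2K (K : comNzRingType) : (s%:~R : K) ^+ 2 = 1 by rewrite -rmorphXn s2.
split=> //.
- by move=> i j _; rewrite !ord1.
- move=> K P j; rewrite /root_poly big_ord1.
  have -> : 'X - (s%:~R)%:P = (- s%:~R)%:P + 1 *: 'X :> {poly K}.
    by rewrite polyCN scale1r addrC.
  rewrite (iter_seqT_lin _ (autocorr_linear _ _ P)) -iterSr /= /psi.
  set F := iter j _ _; have eF : even_seq F by exact/iter_seqT_even/autocorr_even.
  rewrite (seqT_0 eF) sqrrN s2K mulrNz add0n.
  by move: (F 0) (F 1%N%:Z) => x y; ring.
- move=> K F eF [|b]; rewrite /psi /tri_op ?addSn !seqT_S ?addSn.
    rewrite seqT_0 // !add0n mulrNz.
    move: (F 1%N%:Z) (F 0%N%:Z) (F 2%N%:Z) => x y z.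
    by have h := s2K K; move: (s%:~R : K) h => u h; ring: h.
  by move: (F b) (F b.+2) (F (b + 1)%N.+1) (F _) => x y z u; ring.
- by move=> K t; rewrite sg1 big_ord1 expr1 mul1r.
- move=> K t; rewrite sg1 mulrNz; have h := s2K K; move: (s%:~R : K) h => u h.
  by ring: h.
Qed.

Definition pm (c : 'I_2) : int := if c == ord0 then 1 else -1.

(** The two roots give [(2 - T)(2 + T) F], whose value at 0 is [4 F_0 - (T^2 F)_0 = 2 (F_0 - F_2)];
    again [cc = 2]. *)
Lemma sign_case2 : sign_case pm (-1) 1 0 2 1.
Proof.
have sg1 : sgprod pm = -1 by rewrite /sgprod !big_ord_recl big_ord0 /pm /= mulr1 mul1r.
split=> //.
- by move=> c; rewrite /pm; case: ifP.
- move=> c d; rewrite /pm; case: eqP => [->|h1]; case: eqP => [->|h2] //.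
  move=> _; apply: val_inj; case: c d h1 h2 => [[|[|]]] // ? [[|[|]]] // ? h1 h2.
    by case: h1; apply: val_inj.
  by case: h2; apply: val_inj.
- move=> K P j; rewrite /root_poly !big_ord_recl big_ord0 /pm /= mulr1 -mulrA.
  have -> : 'X - (1%:~R)%:P = (-1)%:P + 1 *: 'X :> {poly K}.
    by rewrite polyCN scale1r addrC.
  have -> : 'X - ((-1)%:~R)%:P = 1%:P + 1 *: 'X :> {poly K}.
    by rewrite mulrNz polyCN opprK scale1r addrC.
  rewrite (iter_seqT_lin _ (autocorr_linear _ _ _)) -iterSr.
  have h m d : iter m (@seqT K) (autocorr ((1%:P + 1 *: 'X) * P)) d =
     2 * iter m (@seqT K) (autocorr P) d + iter m.+1 (@seqT K) (autocorr P) d.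
    rewrite (iter_seqT_lin _ (autocorr_linear _ _ P)) -iterSr.
    by rewrite expr1n !mul1r.
  rewrite !h /= /psi.
  set F := iter j _ _; have eF : even_seq F by exact/iter_seqT_even/autocorr_even.
  rewrite (seqT_0 eF) (seqT_0 (seqT_even eF)) seqT_S sqrrN expr1n mulrNz add0n.
  by move: (F 0) (F 1%N%:Z) (F 2%N%:Z) => x y z; ring.
- move=> K F eF [|b]; rewrite /psi /tri_op ?addSn !seqT_S ?addSn.
    rewrite seqT_0 // ?add0n.
    by move: (F 0%N%:Z) (F 1%N%:Z) (F 2%N%:Z) (F 3%N%:Z) => x y z u; ring.
  by move: (F b) (F b.+2) (F (b + 2)%N.+1) (F _) => x y z u; ring.
- move=> K t; rewrite sg1 !big_ord_recl big_ord0 /pm /= !mulrNz; ring.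
- by move=> K t; rewrite sg1; ring.
Qed.

(** * Restriction of series to finitely many variables *)

Section FiniteRestriction.

Local Open Scope mset_scope.
Implicit Types (m a b : monomial) (f g : series).

Lemma fsum_seq (T : choiceType) (A : set T) (r : seq T) (F : T -> rat) :
  uniq r -> (forall i, i \in r -> A i) -> (forall i, A i -> i \notin r -> F i = 0) ->
  (\sum_(i \in A) F i)%R = \sum_(i <- r) F i.
Proof.
move=> ur rA F0; rewrite (fsbigE r) //; rewrite big_mkcond big_seq [RHS]big_seq.
by apply: eq_bigr => i /rA Ai; rewrite mem_set.
Qed.

Definition below (N : nat) (m : monomial) := all (fun x => x < N)%N m.

Lemma belowP N m : reflect (forall x, x \in m -> (x < N)%N) (below N m).
Proof. exact: allP. Qed.

Lemma belowD N a b : below N (a `+` b) = below N a && below N b.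
Proof.
apply/belowP/andP => [h|[/belowP ha /belowP hb] x]; last first.
  by rewrite in_msetD => /orP[/ha|/hb].
by split; apply/belowP => x xm; apply: h; rewrite in_msetD xm ?orbT.
Qed.

Lemma below_mset0 N : below N mset0.
Proof. by apply/belowP => x; rewrite in_mset0. Qed.

Lemma below_mset1 N x : below N [mset x] = (x < N)%N.
Proof.
apply/belowP/idP => [h|h y]; first by apply: h; rewrite mset11.
by rewrite in_mset1 => /eqP ->.
Qed.

Lemma below_exists m : exists N, below N m.
Proof.
exists (\max_(x <- m) x).+1; apply/belowP => x xm; rewrite ltnS.
exact: (leq_bigmax_seq (F := fun x => x)).
Qed.

Lemma below_widen N N' m : (N <= N')%N -> below N m -> below N' m.
Proof. by move=> h /belowP hm; apply/belowP => x /hm /leq_trans; apply. Qed.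

Lemma scoefD f g m : coef (f + g) m = coef f m + coef g m. Proof. by []. Qed.
Lemma scoef0 m : coef 0 m = 0. Proof. by []. Qed.
Lemma scoef1 m : coef 1 m = (m == mset0)%:R. Proof. by []. Qed.
Lemma scoefM f g m : coef (f * g) m = \sum_(p <- divs m) coef f p.1 * coef g p.2.
Proof. exact: coef_mul. Qed.
Lemma scoefZ (c : rat) f m : coef (c *: f) m = c * coef f m. Proof. by []. Qed.

Lemma scoef_sum (I : Type) (r : seq I) (P : pred I) (F : I -> series) m :
  coef (\sum_(i <- r | P i) F i) m = \sum_(i <- r | P i) coef (F i) m.
Proof.
apply: (big_morph (coef^~ m)) => //.
Qed.

Lemma scoefMn f k m : coef (f *+ k) m = coef f m *+ k.
Proof. by elim: k => [|k IH]; rewrite ?mulr0n // !mulrS scoefD IH. Qed.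

Lemma torsion_free_series : torsion_free series.
Proof.
move=> f k k0 e; apply: seriesP => m; have := congr1 (coef^~ m) e.
by rewrite scoefMn scoef0 => /eqP; rewrite mulrn_eq0 eqn0Ngt k0 => /eqP.
Qed.

(** The specialisation [x_N = x_(N+1) = ... = 0], as an endomorphism of [series]. *)
Definition restr N f := Series (fun m => if below N m then coef f m else 0).

Lemma coef_restr N f m : coef (restr N f) m = if below N m then coef f m else 0.
Proof. by []. Qed.

Lemma restr_inj f g : (forall N, restr N f = restr N g) -> f = g.
Proof.
move=> h; apply: seriesP => m; have [N Nm] := below_exists m.
by have := congr1 (coef^~ m) (h N); rewrite /= Nm.
Qed.

Lemma restr_is_zmod_morphism N : zmod_morphism (restr N).
Proof.
by move=> f g; apply: seriesP => m /=; case: ifP; rewrite ?subr0.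
Qed.

Lemma restr_is_monoid_morphism N : monoid_morphism (restr N).
Proof.
split; first by apply: seriesP => m; rewrite /=; case: eqP => [->|_]; rewrite ?below_mset0 ?if_same.
move=> f g; apply: seriesP => m; rewrite coef_restr !scoefM.
case: ifP => h.
  rewrite [LHS]big_seq [RHS]big_seq; apply: eq_bigr => p.
  by rewrite mem_divs => /eqP e; move: h; rewrite -e belowD /= => /andP[-> ->].
rewrite big_seq big1 // => p; rewrite mem_divs => /eqP e; move: h; rewrite -e belowD /=.
by case: (below N p.1) => /= [->|]; rewrite ?mulr0 ?mul0r.
Qed.

HB.instance Definition _ N := GRing.isZmodMorphism.Build series series (restr N)
  (restr_is_zmod_morphism N).
HB.instance Definition _ N := GRing.isMonoidMorphism.Build series series (restr N)
  (restr_is_monoid_morphism N).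

Definition mset_map (s : nat -> nat) (m : monomial) : monomial := seq_mset (map s m).

Lemma mset_mapD s a b : mset_map s (a `+` b) = mset_map s a `+` mset_map s b.
Proof.
have e : perm_eq (a `+` b) ((a : seq nat) ++ b).
  apply/allP => x _; rewrite /= count_cat !count_mem_mset.
  by rewrite msetE2.
apply/msetP => x; rewrite msetE2 !mset_seqE !count_map.
by rewrite (seq.permP e) count_cat.
Qed.

Lemma mem_mset_map s m x : (x \in mset_map s m) = (x \in map s m).
Proof. exact: (perm_mem (perm_eq_seq_mset _)). Qed.

Lemma mset_mapK s s' : cancel s s' -> cancel (mset_map s) (mset_map s').
Proof.
move=> sK m; rewrite /mset_map -[RHS]seq_mset_id; apply/eq_seq_msetP.
apply: perm_trans (perm_map _ (perm_eq_seq_mset _)) _.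
by rewrite -map_comp (eq_map (g := id)) ?map_id // => x /=; rewrite sK.
Qed.

Lemma mset_map1 s x : mset_map s [mset x] = [mset s x].
Proof. by apply/msetP => y; rewrite mset_seqE enum_msetn /= msetnE addn0 eq_sym; case: eqP. Qed.

Definition act s f := Series (fun m => coef f (mset_map s m)).

Lemma act_is_zmod_morphism s : zmod_morphism (act s).
Proof. by move=> f g; apply: seriesP. Qed.

HB.instance Definition _ s := GRing.isZmodMorphism.Build series series (act s)
  (act_is_zmod_morphism s).

Lemma actM s f g : bijective s -> act s (f * g) = act s f * act s g.
Proof.
case=> s' sK s'K; apply: seriesP => m.
rewrite -[LHS]/(coef (f * g) (mset_map s m)) !scoefM.
rewrite (perm_big [seq (mset_map s p.1, mset_map s p.2) | p <- divs m]) /=.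
  by rewrite big_map.
have K := mset_mapK sK; have K' := mset_mapK s'K.
apply: uniq_perm; rewrite ?divs_uniq // ?map_inj_uniq ?divs_uniq //.
  by move=> [x y] [x' y'] [] /(can_inj K) -> /(can_inj K) ->.
move=> [x y]; rewrite mem_divs /=; apply/eqP/mapP => [e|[[x' y']]]; last first.
  by rewrite mem_divs => /eqP /= <- [-> ->]; rewrite mset_mapD.
exists (mset_map s' x, mset_map s' y); last by rewrite /= !K'.
by rewrite mem_divs /= -mset_mapD e K.
Qed.

Lemma act1 s : act s 1 = 1.
Proof.
apply: seriesP => m; rewrite /= -!size_mset_eq0 /mset_map.
by rewrite (perm_size (perm_eq_seq_mset _)) size_map.
Qed.

Lemma symmetricP f : symmetric_series f <-> forall s, bijective s -> act s f = f.
Proof.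
split=> h s bs; first by apply: seriesP => m; exact: h.
by move=> m; rewrite -[RHS](congr1 (coef^~ m) (h s bs)).
Qed.

Lemma act_det s n (A : 'M[series]_n) : bijective s ->
  (forall i j, act s (A i j) = A i j) -> act s (\det A) = \det A.
Proof.
move=> bs h; rewrite /determinant raddf_sum; apply: eq_bigr => u _ /=.
rewrite actM //; congr (_ * _); first by case: (odd_perm u); rewrite ?raddfN /= act1.
by apply: (big_ind (fun x => act s x = x)) => [|x y ex ey|i _]; rewrite ?act1 ?actM ?ex ?ey.
Qed.

Lemma coef_monomM a f m :
  coef (monom a * f) m = if (a `<=` m)%mset then coef f (m `\` a) else 0.
Proof.
rewrite scoefM; case: ifP => h.
  rewrite (bigD1_seq (a, m `\` a)) ?divs_uniq ?mem_divs /= ?msetBDKC ?eqxx //.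
  rewrite mul1r big_seq_cond big1 ?addr0 // => -[x y]; rewrite mem_divs xpair_eqE /=.
  case/andP => /eqP <-; case: eqP => [->|]; last by rewrite mul0r.
  by rewrite msetDKB eqxx.
rewrite big_seq big1 // => -[x y]; rewrite mem_divs /= => /eqP e.
case: eqP => [xa|]; last by rewrite mul0r.
by move: h; rewrite -e xa; have /msubsetP -> // : forall z, (a z <= (a `+` y) z)%N by
  move=> z; rewrite msetE2 leq_addr.
Qed.

Lemma monomM a b : monom a * monom b = monom (a `+` b).
Proof.
apply: seriesP => m; rewrite coef_monomM /=; case: ifP => h.
  congr (nat_of_bool _)%:R; apply/eqP/eqP => [<-|->]; first by rewrite msetBDKC.
  by rewrite msetDKB.
case: eqP => // e; move: h; rewrite e.
by have /msubsetP -> : forall z, (a z <= (a `+` b) z)%N by move=> z; rewrite msetE2 leq_addr.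
Qed.

Lemma monom0 : monom mset0 = 1.
Proof. by []. Qed.

Lemma coef_varM N f m : coef (monom [mset N] * f) m = if N \in m then coef f (m `\ N) else 0.
Proof. by rewrite coef_monomM msub1set. Qed.

Lemma perm_mset1D x m : perm_eq (x +` m) (x :: (m : seq nat)).
Proof.
by apply/eq_seq_msetP; rewrite seq_mset_id mset_cons seq_mset_id.
Qed.

Lemma coef_elementary n m : coef (elementary n) m = (uniq m && (size m == n))%:R.
Proof.
rewrite /=; case: (boolP (uniq m && (size m == n))) => [/andP[um /eqP sm]|h].
  have ss : sorted ltn (sort leq m) by rewrite ltn_sorted_uniq_leq sort_uniq um sort_sorted //; exact: leq_total.
  have e : seq_mset (sort leq m) = m.
    by rewrite -[RHS]seq_mset_id; apply/eq_seq_msetP; rewrite perm_sort.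
  rewrite (@fsum_seq _ _ [:: sort leq m]) //=.
  - by rewrite big_seq1 e eqxx.
  - by move=> s; rewrite inE => /eqP ->; rewrite size_sort.
  move=> s [s1 s2]; rewrite inE => ns; case: eqP => // e'; case/eqP: ns.
  apply: (irr_sorted_eq ltn_trans ltnn) => // x; rewrite mem_sort e'.
  by rewrite (perm_mem (perm_eq_seq_mset s)).
rewrite fsbig1 // => s [s1 s2] /=; case: eqP => // e; case/negP: h; rewrite e.
by rewrite (perm_uniq (perm_eq_seq_mset s)) (perm_size (perm_eq_seq_mset s)) s2 eqxx
   andbT; exact: (sorted_uniq ltn_trans ltnn).
Qed.

Lemma elementary0 : elementary 0 = 1.
Proof.
apply: seriesP => m; rewrite coef_elementary scoef1 size_mset_eq0.
by case: eqP => [->|_]; rewrite ?andbF // enum_mset0.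
Qed.

Lemma act_elementary s n : bijective s -> act s (elementary n) = elementary n.
Proof.
move=> bs; apply: seriesP => m; rewrite /= -[LHS]/(coef (elementary n) (mset_map s m)).
rewrite -[RHS]/(coef (elementary n) m) !coef_elementary /mset_map.
rewrite (perm_uniq (perm_eq_seq_mset _)) (perm_size (perm_eq_seq_mset _)) size_map.
by rewrite map_inj_uniq //; exact: bij_inj.
Qed.

Local Notation var N := (monom [mset N]).

Lemma restr_elementaryS N n :
  restr N.+1 (elementary n.+1) =
  restr N (elementary n.+1) + var N * restr N (elementary n).
Proof.
apply: seriesP => m; rewrite scoefD coef_varM !coef_restr !coef_elementary.
case: (boolP (N \in m)) => Nm; last first.
  rewrite addr0; congr (if _ then _ else _); apply/belowP/belowP => h x xm; last first.
    exact: leq_trans (h _ xm) _.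
  have := h _ xm; rewrite ltnS leq_eqVlt => /orP[/eqP e|//].
  by rewrite -e xm in Nm.
have -> : below N m = false.
  by apply/negbTE/negP => /belowP/(_ _ Nm); rewrite ltnn.
rewrite add0r; move: (msetB1K Nm); set m' := m `\ N => e; rewrite -e.
rewrite (perm_uniq (perm_mset1D _ _)) (perm_size (perm_mset1D _ _)) /= eqSS.
rewrite belowD below_mset1 ltnSn /=.
case: (boolP (below N m')) => h.
  rewrite (below_widen (leqnSn N) h) (_ : N \in _ = false) //.
  by apply/negbTE/negP => /(belowP _ _ h); rewrite ltnn.
case: ifP => // h'; case: (boolP (N \in (m' : seq nat))) => //= Nm'.
case/negP: h; apply/belowP => x xm; have := belowP _ _ h' x xm.
rewrite ltnS leq_eqVlt => /orP[/eqP ex|//].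
by move: Nm'; rewrite -ex => /negP; case.
Qed.

Lemma restr_elementary_gt N n : (N < n)%N -> restr N (elementary n) = 0.
Proof.
move=> h; apply: seriesP => m; rewrite coef_restr coef_elementary.
case: ifP => // /belowP bm; case: andP => // -[um /eqP sm].
have : (size m <= size (iota 0 N))%N.
  by apply: uniq_leq_size => // x /bm; rewrite mem_iota.
by rewrite size_iota sm leqNgt h.
Qed.

End FiniteRestriction.

(** * Columns of partitions and the Jacobi-Trudi determinant *)

(* The lengths of the first [n] columns. *)
Definition cj (n : nat) (s : seq nat) : seq nat := mkseq (fun q => count (ltn q) s) n.

Lemma size_cj n s : size (cj n s) = n. Proof. exact: size_mkseq. Qed.

Lemma nth_cj n s q : nth 0%N (cj n s) q = (if q < n then count (ltn q) s else 0)%N.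
Proof.
case: ltnP => h; first by rewrite nth_mkseq.
by rewrite nth_default // size_cj.
Qed.

Lemma geq_trans : transitive geq.
Proof. by move=> y x z /= xy yz; apply: leq_trans yz xy. Qed.

Lemma sorted_geq_nth s i j : sorted geq s -> (i <= j)%N -> (nth 0 s j <= nth 0 s i)%N.
Proof.
move=> ss ij; case: (ltnP j (size s)) => h; last by rewrite (nth_default _ h).
exact: (sorted_leq_nth geq_trans leqnn 0%N ss _ _ (leq_ltn_trans ij h) h ij).
Qed.

Lemma sorted_geqP s : (forall i, nth 0 s i.+1 <= nth 0 s i)%N -> sorted geq s.
Proof. by move=> h; apply/(sortedP 0%N) => i _; exact: h. Qed.

(** Both sides say that the cell in row [i] and column [q] belongs to the diagram, counting from
    0. *)
Lemma count_galois s i q : sorted geq s -> (q < nth 0 s i)%N = (i < count (ltn q) s)%N.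
Proof.
elim: s i => [|x s IH] i ss; first by rewrite nth_nil.
have ss' := path_sorted ss.
have h := sorted_geq_nth ss (leqnSn 0); rewrite /= in h.
have h0 := IH 0%N ss'; case: i => [|i]; rewrite [nth _ _ _]/= [count _ _]/= ?IH //;
  by case: (ltnP q x) => qx; move: h h0 qx; lia.
Qed.

Lemma count_ltn_anti s q q' : (q <= q')%N -> (count (ltn q') s <= count (ltn q) s)%N.
Proof. by move=> h; apply: sub_count => x /=; apply: leq_ltn_trans. Qed.

Lemma cj_sorted n s : sorted geq (cj n s).
Proof.
apply: sorted_geqP => i; rewrite !nth_cj; case: ltnP => // h.
by rewrite (ltnW h); exact: count_ltn_anti.
Qed.

Lemma count_cj n s i : sorted geq s ->
  count (ltn i) (cj n s) = minn n (nth 0%N s i).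
Proof.
move=> ss; rewrite count_map.
rewrite (eq_count (a2 := fun q => (q < nth 0 s i)%N)); last first.
  by move=> q /=; rewrite count_galois.
move: (nth _ _ _) => x; elim: n => [|n IH]; first by rewrite min0n.
by rewrite -addn1 iotaD count_cat IH /= add0n; case: ltnP; lia.
Qed.

Lemma cjK n l s : sorted geq s -> size s = l -> (nth 0 s 0 <= n)%N -> cj l (cj n s) = s.
Proof.
move=> ss sl sn; apply: (@eq_from_nth _ 0%N); rewrite size_cj // => i il.
rewrite nth_cj il count_cj //; apply/minn_idPr; apply: leq_trans sn.
exact: sorted_geq_nth.
Qed.

Lemma sumn_cj n s : sorted geq s -> (nth 0 s 0 <= n)%N -> sumn (cj n s) = sumn s.
Proof.
elim: s => [|x s IH] ss sn.
  by rewrite /cj /mkseq; elim: (iota 0 n) => //= q t ->.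
have h := sorted_geq_nth ss (leqnSn 0).
rewrite /= -(IH (path_sorted ss)); last by apply: leq_trans sn.
have E t : sumn [seq count (ltn q) (x :: s) | q <- t] =
    (count (fun q => q < x)%N t + sumn [seq count (ltn q) s | q <- t])%N.
  by elim: t => //= q t ->; lia.
rewrite {1}/cj /mkseq E; congr (_ + _)%N; move: sn {IH E}; rewrite /=.
elim: n => [|n IHn] sn; first by move: sn; rewrite leqn0 => /eqP.
rewrite -addn1 iotaD count_cat /= add0n; case: (ltnP n x) => nx; last first.
  by rewrite IHn ?addn0.
have -> : x = n.+1 by apply/eqP; rewrite eqn_leq nx sn.
rewrite (eq_in_count (a2 := xpredT)) ?count_predT ?size_iota ?addn1 //.
by move=> q; rewrite mem_iota add0n => /andP[_ /ltnW]; rewrite ltnS.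
Qed.

(** The lists interlacing with [s], that is, what remains after removing a horizontal strip. The
    length is kept, so trailing zeros occur. *)
Fixpoint strips (s : seq nat) : seq (seq nat) :=
  if s is x :: s' then
    [seq y :: v | y <- iota (head 0%N s') (x.+1 - head 0%N s'), v <- strips s']
  else [:: [::]].

Lemma stripsP s v :
  reflect (size v = size s /\
           forall i, (i < size s)%N -> (nth 0 s i.+1 <= nth 0 v i <= nth 0 s i)%N)
          (v \in strips s).
Proof.
elim: s v => [|x s IH] v.
  by rewrite inE; apply: (iffP eqP) => [->|[/size0nil ->]].
apply: (iffP allpairsP) => [[[y v'] /= [hy hv ->]]|[sv h]].
  have [sv' hv'] := IH _ hv; split; first by rewrite /= sv'.
  case=> [|i] /= hi; last exact: hv'.
  by move: hy; rewrite mem_iota nth0; lia.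
case: v sv h => // y v [sv] h; exists (y, v); split=> //=.
  by have := h 0%N isT; rewrite mem_iota /= nth0; lia.
by apply/IH; split=> // i hi; apply: (h i.+1).
Qed.

Lemma strips_uniq s : uniq (strips s).
Proof.
elim: s => //= x s IH; apply: allpairs_uniq; rewrite ?iota_uniq //.
by move=> [y v] [y' v'] _ _ [-> ->].
Qed.

Lemma strips_sorted s v : v \in strips s -> sorted geq v.
Proof.
case/stripsP => sv h; apply: sorted_geqP => i.
case: (ltnP i.+1 (size s)) => hi; last by rewrite nth_default // sv.
by have := h _ (ltnW hi); have := h _ hi; lia.
Qed.

Lemma strips_sumn_le s v : v \in strips s -> (sumn v <= sumn s)%N.
Proof.
elim: s v => [|x s IH] v; first by rewrite inE => /eqP ->.
case/allpairsP => -[y v'] /= [hy /IH h ->] /=; rewrite leq_add //.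
by move: hy; rewrite mem_iota; lia.
Qed.

Lemma strips_count s v q : sorted geq s -> v \in strips s ->
  (count (ltn q) v <= count (ltn q) s <= (count (ltn q) v).+1)%N.
Proof.
move=> ss vs; have vv := strips_sorted vs; have /stripsP[sv h] := vs.
apply/andP; split.
  case: (ltnP (count (ltn q) s) (count (ltn q) v)) => // c.
  have c' := c; rewrite -count_galois // in c.
  have hi : (count (ltn q) s < size s)%N.
    by apply: leq_trans c' _; rewrite -sv; exact: count_size.
  have := h _ hi; have := count_galois (count (ltn q) s) q ss; rewrite ltnn; lia.
case: (ltnP (count (ltn q) v).+1 (count (ltn q) s)) => // c.
have c' := c; rewrite -count_galois // in c.
have hi : (count (ltn q) v < size s)%N.
  by apply: leq_trans (ltnW c') _; exact: count_size.
have := h _ hi; have := count_galois (count (ltn q) v) q vv; rewrite ltnn; lia.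
Qed.

Section ShiftedDeterminant.
Variable K : comNzRingType.
Implicit Types e : nat -> K.

Definition ec e (a b : nat) : K := if (a < b)%N then 0 else e (a - b)%N.

(** The dual Jacobi-Trudi determinant, with the column lengths already shifted by the staircase in
    [a]; [ec] makes [e] vanish at negative indices. *)
Definition jt n e (a : 'I_n -> nat) : K := \det (\matrix_(p, q) ec e (a q) (n.-1 - p)).

Lemma eq_jt n e (a a' : 'I_n -> nat) : a =1 a' -> jt e a = jt e a'.
Proof. by move=> h; congr (\det _); apply/matrixP => p q; rewrite !mxE h. Qed.

Lemma det_col0 n (A : 'M[K]_n) q : (forall p, A p q = 0) -> \det A = 0.
Proof. by move=> h; rewrite (expand_det_col _ q) big1 // => p _; rewrite h mul0r. Qed.

Lemma det_eq_cols n (A : 'M[K]_n) q q' : q != q' -> (forall p, A p q = A p q') -> \det A = 0.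
Proof.
move=> qq h; rewrite -det_tr; apply: (determinant_alternate qq) => p.
by rewrite !mxE h.
Qed.

Lemma jt_alternate n e (a : 'I_n -> nat) q q' : q != q' -> a q = a q' -> jt e a = 0.
Proof. by move=> qq h; apply: (det_eq_cols qq) => p; rewrite !mxE h. Qed.

Lemma det_add_cols n (A B : 'M[K]_n) x :
  \det (A + x *: B) = \sum_(eps : {ffun 'I_n -> bool})
     x ^+ (\sum_q eps q) * \det (\matrix_(p, q) if eps q then B p q else A p q).
Proof.
under [RHS]eq_bigr => eps _ do rewrite -det_tr /determinant mulr_sumr.
rewrite -det_tr /determinant.
rewrite exchange_big /=; apply: eq_bigr => s _.
under eq_bigr => i _.
  rewrite (_ : _ i (s i) = \sum_(b : bool) (if b then x * B (s i) i else A (s i) i)); last first.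
    by rewrite big_bool !mxE addrC.
  over.
rewrite bigA_distr_bigA mulr_sumr; apply: eq_bigr => eps _.
rewrite mulrCA; congr (_ * _); rewrite -prodrXr -big_split /=.
by apply: eq_bigr => i _; rewrite !mxE; case: (eps i); rewrite ?expr1 ?expr0 ?mul1r.
Qed.

(** Both sides are the derivative of [\det (A + x B)] at [x = 0]. *)
Lemma det_derivative n (A B : 'M[K]_n) :
  \sum_q \det (\matrix_(i, j) if j == q then B i j else A i j) =
  \sum_p \det (\matrix_(i, j) if i == p then B i j else A i j).
Proof.
rewrite exchange_big [RHS]exchange_big /=; apply: eq_bigr => s _.
rewrite -!mulr_sumr; congr (_ * _); rewrite (reindex_inj (@perm_inj _ s)) /=.
apply: eq_bigr => p _; apply: eq_bigr => i _; rewrite !mxE.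
by rewrite (inj_eq perm_inj).
Qed.

(** A new variable splits each column into itself and [x] times the column one step lower. The guard
    excludes lowering an entry 0: that column is zero, whereas truncated subtraction would keep
    it. *)
Lemma jt_extend n e e' x (a : 'I_n -> nat) :
  e' 0%N = e 0%N -> (forall k, e' k.+1 = e k.+1 + x * e k) ->
  jt e' a = \sum_(eps : {ffun 'I_n -> bool})
     x ^+ (\sum_q eps q) *
     (if [forall q, (a q == 0%N) ==> ~~ eps q] then jt e (fun q => a q - eps q)%N else 0).
Proof.
move=> e0 eS; pose B : 'M[K]_n := \matrix_(p, q)
  (if a q is a'.+1 then ec e a' (n.-1 - p) else 0).
have -> : jt e' a = \det (\matrix_(p, q) ec e (a q) (n.-1 - p) + x *: B).
  congr (\det _); apply/matrixP => p q; rewrite !mxE /ec.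
  case: (a q) => [|b]; first by rewrite mulr0 addr0; case: ltnP => //; case: (_ - _)%N.
  case: (ltngtP b.+1 (n.-1 - p)) => h.
  - by rewrite mulr0 addr0.
  - by rewrite subSn // eS.
  - by rewrite -h subnn e0 mulr0 addr0.
rewrite det_add_cols; apply: eq_bigr => eps _; congr (_ * _); case: ifP => h.
  congr (\det _); apply/matrixP => p q; rewrite !mxE.
  have := forallP h q; case: (eps q); last by rewrite subn0.
  by case: (a q) => //= b _; rewrite subn1.
move/negbT: h; rewrite negb_forall => /existsP[q]; rewrite negb_imply negbK => /andP[/eqP aq eq].
by apply: (@det_col0 _ _ q) => p; rewrite !mxE eq aq.
Qed.

(** By [det_derivative], shifting columns amounts to shifting rows. A shifted row repeats the next
    one, except for the last; there the last column, which has its only entry in the last row, gets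
    [e 1] in place of [e 0]. *)
Lemma pieri_shift n e (a : 'I_n.+1 -> nat) : a ord_max = 0%N -> e 0%N = 1 ->
  \sum_q jt e (fun i => a i + (i == q))%N = e 1%N * jt e a.
Proof.
move=> a0 e0.
pose A : 'M[K]_n.+1 := \matrix_(p, q) ec e (a q) (n - p).
pose B : 'M[K]_n.+1 := \matrix_(p, q) ec e (a q).+1 (n - p).
have -> : \sum_q jt e (fun i => a i + (i == q))%N =
    \sum_q \det (\matrix_(i, j) if j == q then B i j else A i j).
  apply: eq_bigr => q _; congr (\det _); apply/matrixP => i j; rewrite !mxE.
  by case: eqP => _; rewrite ?addn1 ?addn0.
rewrite det_derivative (bigD1 ord_max) //= big1 ?addr0; last first.
  move=> p pm; have pn : (p.+1 < n.+1)%N.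
    by rewrite ltnS ltn_neqAle -ltnS ltn_ord andbT -(inj_eq val_inj) in pm *.
  have pp : p != Ordinal pn by rewrite -(inj_eq val_inj) /= neq_ltn ltnSn.
  apply: (determinant_alternate pp) => q; rewrite !mxE eqxx eq_sym (negbTE pp) /=.
  rewrite /ec (_ : n - p = (n - p.+1).+1)%N ?ltnS ?subSS //; lia.
rewrite /jt (expand_det_col _ ord_max) [X in _ = _ * X](expand_det_col _ ord_max).
have ltm (p : 'I_n.+1) : p != ord_max -> (p < n)%N.
  by move=> pm; rewrite ltn_neqAle -ltnS ltn_ord andbT -(inj_eq val_inj) in pm *.
rewrite (bigD1 ord_max) //= [X in _ + X = _]big1 ?addr0; last first.
  by move=> p pm; rewrite !mxE (negbTE pm) a0 /ec ifT ?mul0r // subn_gt0 ltm.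
rewrite [in RHS](bigD1 ord_max) //= [X in _ = _ * (_ + X)]big1 ?addr0; last first.
  by move=> p pm; rewrite !mxE a0 /ec ifT ?mul0r // subn_gt0 ltm.
rewrite !mxE eqxx a0 /ec subnn /= subn0 e0 mul1r; congr (_ * _).
rewrite /cofactor; congr (_ * \det _); apply/matrixP => i j; rewrite !mxE.
by rewrite eq_sym (negbTE (neq_lift _ _)).
Qed.

End ShiftedDeterminant.

(** * Schur functions *)

Section Tableaux.

Local Open Scope mset_scope.

Definition tableau (s : seq nat) (T : seq (seq nat)) :=
  [/\ shape T = s, forall r, r \in T -> sorted leq r
    & forall i j, (j < nth 0%N s i.+1)%N ->
        (nth 0%N (nth [::] T i) j < nth 0%N (nth [::] T i.+1) j)%N].

Definition glue (N : nat) (s : seq nat) (T : seq (seq nat)) : seq (seq nat) :=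
  [seq p.2 ++ nseq (p.1 - size p.2) N | p <- zip s T].

(** Recursion on the largest letter, whose cells form a horizontal strip. With no letter left, only
    shapes whose parts are all 0 have a filling. *)
Fixpoint tableaux (N : nat) (s : seq nat) : seq (seq (seq nat)) :=
  if N is N'.+1 then [seq glue N' s T | v <- strips s, T <- tableaux N' v]
  else if all (pred1 0%N) s then [:: nseq (size s) [::]] else [::].

Lemma nth_glue N s T i : size T = size s -> (i < size s)%N ->
  nth [::] (glue N s T) i = nth [::] T i ++ nseq (nth 0%N s i - size (nth [::] T i)) N.
Proof.
move=> sT h; rewrite (nth_map (0%N, [::])) ?size_zip ?sT ?minnn //.
by rewrite nth_zip ?sT.
Qed.

Lemma size_glue N s T : size T = size s -> size (glue N s T) = size s.
Proof. by move=> e; rewrite size_map size_zip e minnn. Qed.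

Lemma nth_shape (T : seq (seq nat)) i : nth 0%N (shape T) i = size (nth [::] T i).
Proof.
case: (ltnP i (size T)) => h; first by rewrite (nth_map [::]).
by rewrite !nth_default ?size_map.
Qed.

Lemma glue_filter N s T : (forall r, r \in T -> all (ltn^~ N) r) -> size T = size s ->
  map (filter (ltn^~ N)) (glue N s T) = T.
Proof.
move=> hT sT; apply: (@eq_from_nth _ [::]); rewrite size_map size_glue // => i hi.
rewrite (nth_map [::]) ?size_glue // nth_glue // filter_cat.
have hi' : (i < size T)%N by rewrite sT.
have -> : [seq x <- nth [::] T i | (x < N)%N] = nth [::] T i.
  by apply/all_filterP; apply: hT; exact: mem_nth.
by elim: (_ - _)%N => [|k] /=; rewrite ?cats0 ?ltnn.
Qed.

(* In a weakly increasing word with letters at most [N], the letters [N] come last. *)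
Lemma sorted_max_last N r : sorted leq r -> all (fun x => x < N.+1)%N r ->
  r = filter (ltn^~ N) r ++ nseq (size r - size (filter (ltn^~ N) r)) N.
Proof.
elim: r => //= x r IH sr /andP[xN rN].
have IH' := IH (path_sorted sr) rN; case: (ltnP x N) => h /=.
  by rewrite subSS -IH'.
have xe : x = N by apply/eqP; rewrite eqn_leq h andbT.
have e : filter (ltn^~ N) r = [::].
  apply/eqP; rewrite -[_ == _]negbK -has_filter -all_predC; apply/allP => y yr /=.
  by move: (order_path_min leq_trans sr) => /allP /(_ _ yr); rewrite xe -leqNgt.
by move: IH'; rewrite e /= subn0 xe => <-.
Qed.

Lemma tableau_sizes s T : tableau s T -> forall i, size (nth [::] T i) = nth 0%N s i.
Proof. by move=> [<- _ _] i; rewrite nth_shape. Qed.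

Lemma shape_size s T : tableau s T -> size T = size s.
Proof. by move=> [<- _ _]; rewrite size_map. Qed.

Lemma glue_tableau N s v T : sorted geq s -> v \in strips s -> tableau v T ->
  (forall r, r \in T -> all (ltn^~ N) r) ->
  tableau s (glue N s T) /\ forall r, r \in glue N s T -> all (ltn^~ N.+1) r.
Proof.
move=> ss vs tT hT; have szT := tableau_sizes tT; have /stripsP[sv hv] := vs.
have sT : size T = size s by rewrite (shape_size tT).
have vles i : (nth 0 v i <= nth 0 s i)%N.
  case: (ltnP i (size s)) => h; last by rewrite nth_default ?sv.
  by have := hv _ h; lia.
have szG i : (i < size s)%N -> size (nth [::] (glue N s T) i) = nth 0%N s i.
  move=> h; rewrite nth_glue // size_cat size_nseq szT subnKC //.
have allT i : all (ltn^~ N) (nth [::] T i).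
  case: (ltnP i (size T)) => h; last by rewrite nth_default.
  by apply: hT; exact: mem_nth.
split; last first.
  move=> r /(nthP [::])[i]; rewrite size_glue // => hi <-.
  rewrite nth_glue // all_cat; apply/andP; split.
    by apply: sub_all (allT i) => x /=; apply: leqW.
  by apply/allP => x; rewrite mem_nseq => /andP[_ /eqP ->] /=.
split.
- apply: (@eq_from_nth _ 0%N); rewrite size_map size_glue // => i hi.
  by rewrite nth_shape szG.
- move=> r /(nthP [::])[i]; rewrite size_glue // => hi <-; rewrite nth_glue //.
  rewrite sorted_pairwise; last exact: leq_trans.
  rewrite pairwise_cat; apply/and3P; split.
  + apply/allrelP => x y xT; rewrite mem_nseq => /andP[_ /eqP ->].
    by apply: ltnW; exact: (allP (allT i)).
  + rewrite -sorted_pairwise; last exact: leq_trans.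
    by case: tT => _ h _; apply: h; apply: mem_nth; rewrite sT.
  + rewrite -sorted_pairwise; last exact: leq_trans.
    by elim: (_ - _)%N => // -[|k] //= ->; rewrite leqnn.
- move=> i j hj; have hi1 : (i.+1 < size s)%N.
    by case: (ltnP i.+1 (size s)) hj => // h; rewrite nth_default.
  have hi := ltnW hi1; rewrite !nth_glue // !nth_cat !szT.
  (* The strip condition places the cell above inside [v], where all letters are smaller than
     [N]. *)
  have jv : (j < nth 0 v i)%N by have := hv _ hi; lia.
  have Tij : (nth 0 (nth [::] T i) j < N)%N.
    by apply: (allP (allT i)); rewrite mem_nth ?szT.
  rewrite jv; case: (ltnP j (nth 0 v i.+1)) => h.
    by case: tT => _ _ /(_ _ _ h).
  by rewrite nth_nseq ifT //; rewrite ltn_sub2r // (leq_ltn_trans h hj).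
Qed.

Lemma unglue_tableau N s T : sorted geq s -> tableau s T ->
  (forall r, r \in T -> all (ltn^~ N.+1) r) ->
  let T' := map (filter (ltn^~ N)) T in
  [/\ shape T' \in strips s, tableau (shape T') T',
      forall r, r \in T' -> all (ltn^~ N) r & glue N s T' = T].
Proof.
move=> ss tT hT T'; have szT := tableau_sizes tT; have sT := shape_size tT.
have sT' : size T' = size s by rewrite size_map.
have nT' i : nth [::] T' i = filter (ltn^~ N) (nth [::] T i).
  case: (ltnP i (size T)) => h; first by rewrite (nth_map [::]).
  by rewrite !nth_default ?size_map.
have sortT i : sorted leq (nth [::] T i).
  case: (ltnP i (size T)) => h; last by rewrite nth_default.
  by case: tT => _ h' _; apply: h'; exact: mem_nth.
have allT i : all (ltn^~ N.+1) (nth [::] T i).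
  case: (ltnP i (size T)) => h; last by rewrite nth_default.
  by apply: hT; exact: mem_nth.
have split_row i := sorted_max_last (sortT i) (allT i).
have nle i : (size (nth [::] T' i) <= nth 0 s i)%N.
  by rewrite nT' -szT size_filter; exact: count_size.
(* A cell with another cell below it holds a letter smaller than [N], because columns increase
   strictly, so it survives the filter. *)
have keep i j : (j < nth 0 s i.+1)%N -> (j < size (nth [::] T' i))%N.
  move=> hj; rewrite ltnNge; apply/negP => h.
  have ji : (j < nth 0 s i)%N by apply: leq_trans hj _; exact: sorted_geq_nth.
  have : (nth 0 (nth [::] T i) j < N)%N.
    have h1 : (nth 0 (nth [::] T i) j < nth 0 (nth [::] T i.+1) j)%N.
      by case: tT => _ _; apply.
    apply: leq_trans h1 _; rewrite -ltnS.
    by apply: (allP (allT i.+1)); rewrite mem_nth // szT.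
  rewrite split_row nth_cat -nT' ifF; last by apply/negbTE; rewrite -leqNgt.
  rewrite nth_nseq ifT ?ltnn //.
  by rewrite ltn_sub2r ?szT // (leq_ltn_trans h ji).
split.
- apply/stripsP; split; first by rewrite size_map.
  move=> i hi; rewrite nth_shape nle andbT leqNgt; apply/negP => h.
  by have := keep i _ h; rewrite ltnn.
- split=> //.
    move=> r /mapP[r' r'T ->]; apply: (sorted_filter leq_trans).
    by case: tT => _ h _; exact: h.
  move=> i j; rewrite nth_shape => hj.
  have hj' : (j < nth 0 s i.+1)%N by exact: leq_trans hj (nle _).
  have := keep _ _ hj' => hk.
  have : (nth 0 (nth [::] T i) j < nth 0 (nth [::] T i.+1) j)%N.
    by case: tT => _ _; apply.
  by rewrite (split_row i) (split_row i.+1) !nth_cat -!nT' hk hj.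
- by move=> r /mapP[r' _ ->]; exact: filter_all.
- apply: (@eq_from_nth _ [::]); rewrite size_glue // => i hi.
  by rewrite nth_glue // nT' -szT -split_row.
Qed.

Lemma mem_tableaux N s T : sorted geq s ->
  (T \in tableaux N s) <-> tableau s T /\ (forall r, r \in T -> all (ltn^~ N) r).
Proof.
elim: N s T => [|N IH] s T ss.
  rewrite /=; split.
    case: ifP => // /allP h; rewrite inE => /eqP ->.
    have n0 i : nth 0%N s i = 0%N.
      case: (ltnP i (size s)) => hi; last by rewrite nth_default.
      by apply/eqP/h; exact: mem_nth.
    split; last by move=> r; rewrite mem_nseq => /andP[_ /eqP ->].
    split.
    - apply: (@eq_from_nth _ 0%N); rewrite size_map size_nseq // => i hi.
      by rewrite nth_shape nth_nseq hi n0.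
    - by move=> r; rewrite mem_nseq => /andP[_ /eqP ->].
    - by move=> i j; rewrite n0.
  move=> [tT hT].
  have r0 r : r \in T -> r = [::].
    by move=> /hT; case: r.
  have -> : T = nseq (size s) [::].
    apply: (@eq_from_nth _ [::]); rewrite ?size_nseq ?(shape_size tT) // => i hi.
    by rewrite nth_nseq hi; apply: r0; rewrite mem_nth ?(shape_size tT).
  rewrite ifT ?inE //; apply/allP => x /(nthP 0%N)[i hi <-] /=.
  by rewrite -(tableau_sizes tT) (r0 (nth _ _ _)) // mem_nth // (shape_size tT).
split.
  case/allpairsPdep => v [T' [vs T'v ->]].
  have [tT' hT'] := (IH v T' (strips_sorted vs)).1 T'v.
  exact: (glue_tableau ss vs).
move=> [tT hT]; have [h1 h2 h3 h4] := unglue_tableau ss tT hT.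
apply/allpairsPdep; exists (shape (map (filter (ltn^~ N)) T)), (map (filter (ltn^~ N)) T).
by split=> //; apply/(IH _ _ (strips_sorted h1)).
Qed.

Lemma tableaux_uniq N s : sorted geq s -> uniq (tableaux N s).
Proof.
elim: N s => [|N IH] s ss /=; first by case: ifP.
apply: allpairs_uniq_dep; rewrite ?strips_uniq //.
  by move=> v /strips_sorted; exact: IH.
move=> z z' /allpairsPdep[v [T [vs Tv ->]]] /allpairsPdep[v' [T' [vs' Tv' ->]]] /= e.
have [tT hT] := (mem_tableaux N T (strips_sorted vs)).1 Tv.
have [tT' hT'] := (mem_tableaux N T' (strips_sorted vs')).1 Tv'.
have /stripsP[sv _] := vs; have /stripsP[sv' _] := vs'.
have eT : T = T'.
  have := congr1 (map (filter (ltn^~ N))) e.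
  by rewrite !glue_filter // ?(shape_size tT) ?(shape_size tT').
by rewrite eT in tT *; case: tT => <- _ _; case: tT' => <- _ _.
Qed.

Definition content (T : seq (seq nat)) : monomial := seq_mset (flatten T).
Definition tab_sum N s : series := \sum_(T <- tableaux N s) monom (content T).

Lemma seq_mset_cat (u v : seq nat) : seq_mset (u ++ v) = seq_mset u `+` seq_mset v.
Proof. by apply/msetP => x; rewrite msetE2 !mset_seqE count_cat. Qed.

Lemma sumn_le (u v : seq nat) : size u = size v ->
  (forall i, nth 0 u i <= nth 0 v i)%N -> (sumn u <= sumn v)%N.
Proof.
elim: u v => [|x u IH] [|y v] // [suv] h /=.
by rewrite leq_add ?IH ?(h 0%N) // => i; exact: (h i.+1).
Qed.

Lemma content_glue N s T : size T = size s ->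
  (forall i, (size (nth [::] T i) <= nth 0 s i)%N) ->
  content (glue N s T) = content T `+` seq_mset (nseq (sumn s - sumn (shape T)) N).
Proof.
elim: s T => [|x s IH] [|r T] // sT h; first by rewrite /= seq_mset_nil msetD0.
case: sT => sT.
rewrite /content /= -/(glue N s T) !seq_mset_cat -/(content _) -/(content T).
rewrite IH //; last by move=> i; exact: (h i.+1).
have h0 : (size r <= x)%N := h 0%N.
have hs : (sumn (shape T) <= sumn s)%N.
  apply: sumn_le => [|i]; first by rewrite size_map.
  by rewrite nth_shape; exact: (h i.+1).
have -> : (x + sumn s - (size r + sumn (shape T)) =
   (x - size r) + (sumn s - sumn (shape T)))%N by lia.
rewrite nseqD seq_mset_cat -!msetDA; congr (_ `+` _).
by rewrite !msetDA; congr (_ `+` _); rewrite msetDC.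
Qed.

Lemma monom_nseq N k : monom (seq_mset (nseq k N)) = monom [mset N] ^+ k.
Proof.
elim: k => [|k IH]; first by rewrite expr0 seq_mset_nil monom0.
by rewrite exprS -IH monomM /= mset_cons.
Qed.

Lemma tab_sumS N s : sorted geq s ->
  tab_sum N.+1 s = \sum_(v <- strips s) monom [mset N] ^+ (sumn s - sumn v) * tab_sum N v.
Proof.
move=> ss; rewrite /tab_sum /= big_allpairs_dep [LHS]big_seq [RHS]big_seq.
apply: eq_bigr => v vs; rewrite mulr_sumr [LHS]big_seq [RHS]big_seq.
apply: eq_bigr => T /(mem_tableaux N T (strips_sorted vs))[tT _].
have /stripsP[sv hv] := vs.
rewrite content_glue ?(shape_size tT) //; last first.
  move=> i; rewrite (tableau_sizes tT); case: (ltnP i (size s)) => hi.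
    by have := hv _ hi; lia.
  by rewrite nth_default ?sv.
by rewrite -monomM monom_nseq mulrC; case: tT => ->.
Qed.

Lemma int_partition_sorted (la : int_partition) : sorted geq la.
Proof. by case: la => s /= /andP[]. Qed.

Lemma int_partition_pos (la : int_partition) : 0%N \notin (la : seq nat).
Proof. by case: la => s /= /andP[]. Qed.

Lemma restr_schur N la : restr N (schur la) = tab_sum N la.
Proof.
have ss := int_partition_sorted la.
apply: seriesP => m; rewrite coef_restr scoef_sum; case: ifP => h.
  rewrite /= (@fsum_seq _ _ (tableaux N la)) ?tableaux_uniq //.
    by move=> T /(mem_tableaux N T ss)[].
  move=> T sT nT /=; case: eqP => // e; case/negP: nT.
  apply/(mem_tableaux N T ss); split=> // r rT; apply/allP => x xr.
  move/belowP: h => /(_ x); apply; rewrite e (perm_mem (perm_eq_seq_mset _)).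
  by apply/flattenP; exists r.
rewrite big_seq big1 // => T /(mem_tableaux N T ss)[_ hT] /=; case: eqP => // e.
case/negP: h; apply/belowP => x; rewrite e (perm_mem (perm_eq_seq_mset _)).
by case/flattenP => r /hT /allP; apply.
Qed.

End Tableaux.

Definition shifted_cols n (s : seq nat) (q : 'I_n) : nat := (count (ltn q) s + (n.-1 - q))%N.

Section Jacobi_Trudi_step.
Variables (K : comNzRingType) (n : nat) (s : seq nat).
Hypothesis ss : sorted geq s.
Hypothesis sn : (nth 0 s 0 <= n)%N.

Let strip_eps (v : seq nat) : {ffun 'I_n -> bool} :=
  [ffun q : 'I_n => count (ltn q) s != count (ltn q) v].

Let strip_epsE v (q : 'I_n) : v \in strips s ->
  (count (ltn q) s = count (ltn q) v + strip_eps v q)%N.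
Proof.
move=> vs; rewrite ffunE; have := strips_count q ss vs.
by case: eqP => /= [->|h]; [rewrite addn0 | lia].
Qed.

Let strip_le v : v \in strips s -> (nth 0 v 0 <= n)%N.
Proof.
case/stripsP => sv h; case: (posnP (size s)) => [s0|/h]; last by lia.
by rewrite nth_default ?sv ?s0.
Qed.

Let strip_eps_inj : {in strips s &, injective strip_eps}.
Proof.
move=> v v' vs vs' e.
have h : cj n v = cj n v'.
  apply: (@eq_from_nth _ 0%N); rewrite !size_cj // => q qn; rewrite !nth_cj qn.
  have := strip_epsE (Ordinal qn) vs; have := strip_epsE (Ordinal qn) vs'.
  by rewrite e /= => -> /addIn.
have /stripsP[sv _] := vs; have /stripsP[sv' _] := vs'.
rewrite -(@cjK n (size s) v) ?h ?(@cjK n (size s) v') ?(strips_sorted vs) ?(strips_sorted vs') //;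
  exact: strip_le.
Qed.

Let sum_strip_eps v : v \in strips s ->
  (\sum_q strip_eps v q = sumn s - sumn v)%N.
Proof.
move=> vs; have vv := strips_sorted vs.
rewrite -(sumn_cj ss sn) -(sumn_cj vv (strip_le vs)) /cj /mkseq !sumn_map.
have E (F : nat -> nat) : (\sum_(q <- iota 0 n) F q = \sum_(q < n) F q)%N.
  by rewrite -(big_mkord xpredT) /index_iota subn0.
rewrite !E.
rewrite [X in (_ = X - _)%N](eq_bigr (fun q : 'I_n => (count (ltn q) v + strip_eps v q)%N)); last first.
  by move=> q _; exact: strip_epsE.
by rewrite big_split /= addKn.
Qed.

Variables (e : nat -> K) (x : K).
Local Notation a := (shifted_cols (n := n) s).
Let ok (eps : {ffun 'I_n -> bool}) := [forall q, (a q == 0%N) ==> ~~ eps q].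

(** Neighbouring entries must stay distinct, since equal columns kill the determinant. The lowered
    column lengths are therefore still weakly decreasing and lose at most one cell each, which
    describes a horizontal strip. *)
Lemma strip_of_eps eps : ok eps -> jt e (fun q => a q - eps q)%N != 0 ->
  eps \in [seq strip_eps v | v <- strips s].
Proof.
move=> /forallP oke nz.
have alt (q q' : 'I_n) : q' = q.+1 :> nat -> (a q - eps q != a q' - eps q')%N.
  move=> qq; apply: contra_neqN nz => /eqP h.
  by apply: (jt_alternate _ (q := q) (q' := q')) => //; apply/eqP => qe;
     move: qq; rewrite qe; lia.
have c_anti (q q' : nat) : (q <= q')%N -> (count (ltn q') s <= count (ltn q) s)%N.
  exact: count_ltn_anti.
(* Downwards from the last column: lowering an empty column collides with the next one, which is
   empty and not lowered; for the last column the guard [ok] forbids it. *)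
have zero_eps (q : 'I_n) : count (ltn q) s = 0%N -> eps q = false.
  have [k hk] : {k | k = (n - q)%N} by eexists.
  elim: k q hk => [|k IH] q hk cq; first by have := ltn_ord q; lia.
  case: (ltnP q.+1 n) => hq; last first.
    have := oke q; rewrite /shifted_cols cq (_ : (0 + (n.-1 - q) == 0)%N) /=; last by lia.
    by move/negbTE.
  have cq1 : count (ltn (Ordinal hq)) s = 0%N.
    by apply/eqP; rewrite -leqn0 -cq; apply: c_anti => /=.
  have e1 := IH (Ordinal hq) ltac:(rewrite /=; lia) cq1.
  have := alt q (Ordinal hq) erefl; rewrite e1 /shifted_cols cq cq1 subn0 /=.
  by case: (eps q) => //=; lia.
pose epsn (q : nat) : bool := [exists i : 'I_n, (i == q :> nat) && eps i].
have epsnE (q : 'I_n) : epsn q = eps q.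
  apply/existsP/idP => [[i /andP[/eqP/val_inj -> //]]|h].
  by exists q; rewrite eqxx.
pose c' := mkseq (fun q => count (ltn q) s - epsn q)%N n.
have nth_c' q : nth 0%N c' q = (if q < n then count (ltn q) s - epsn q else 0)%N.
  case: ltnP => h; first by rewrite nth_mkseq.
  by rewrite nth_default // size_mkseq.
have c's : sorted geq c'.
  apply: sorted_geqP => q; rewrite !nth_c'; case: (ltnP q.+1 n) => // hq.
  rewrite (ltnW hq).
  have := alt (Ordinal (ltnW hq)) (Ordinal hq) erefl.
  rewrite -!epsnE /shifted_cols /=; have := c_anti _ _ (leqnSn q).
  by case: (epsn q); case: (epsn q.+1) => /=; rewrite ?subn0; lia.
have l0 : (nth 0 c' 0 <= size s)%N.
  rewrite nth_c'; case: ifP => // _; apply: leq_trans (leq_subr _ _) _.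
  exact: count_size.
pose v := cj (size s) c'.
have vs : v \in strips s.
  apply/stripsP; rewrite size_cj; split=> // i hi; rewrite nth_cj hi.
  have cs k : count (ltn k) (cj n s) = nth 0%N s k.
    rewrite count_cj //; apply/minn_idPr; apply: leq_trans sn.
    exact: sorted_geq_nth.
  rewrite -[nth 0 s i.+1]cs -[nth 0 s i]cs /c' /cj /mkseq !count_map.
  apply/andP; split; apply: sub_count => q /=; last by lia.
  by case: (epsn q) => /=; lia.
apply/mapP; exists v => //; apply/ffunP => q; rewrite ffunE.
have -> : count (ltn q) v = (count (ltn q) s - eps q)%N.
  rewrite count_cj // nth_c' ltn_ord epsnE; apply/minn_idPr.
  by apply: leq_trans (leq_subr _ _) _; exact: count_size.
have := zero_eps q; case: (eps q); last by rewrite subn0 eqxx.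
by case: (count _ s) => [/(_ erefl)|c _] //; apply/esym/eqP; lia.
Qed.

Lemma sum_strips_jt :
  \sum_(eps : {ffun 'I_n -> bool})
     x ^+ (\sum_q eps q) * (if ok eps then jt e (fun q => a q - eps q)%N else 0) =
  \sum_(v <- strips s) x ^+ (sumn s - sumn v) * jt e (shifted_cols (n := n) v).
Proof.
have vE v : v \in strips s -> ok (strip_eps v) /\
    jt e (fun q => a q - strip_eps v q)%N = jt e (shifted_cols (n := n) v).
  move=> vs; split.
    apply/forallP => q; apply/implyP; rewrite /shifted_cols (strip_epsE q vs).
    by case: (strip_eps v q) => //; rewrite addn1 addSn.
  by apply: eq_jt => q; rewrite /shifted_cols (strip_epsE q vs) addnAC addnK.
rewrite [RHS]big_seq.
rewrite (eq_bigr (fun v => x ^+ (\sum_q strip_eps v q) *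
   (if ok (strip_eps v) then jt e (fun q => a q - strip_eps v q)%N else 0))); last first.
  by move=> v vs; have [-> ->] := vE _ vs; rewrite sum_strip_eps.
rewrite -big_seq -(big_map strip_eps xpredT (fun eps => x ^+ (\sum_q eps q) *
   (if ok eps then jt e (fun q => a q - eps q)%N else 0))).
rewrite [RHS]big_uniq; last by rewrite map_inj_in_uniq ?strips_uniq //; exact: strip_eps_inj.
rewrite [LHS](bigID (mem [seq strip_eps v | v <- strips s])) /=.
rewrite [X in _ + X]big1 ?addr0 // => eps ne.
case: ifP => h; last by rewrite mulr0.
case: (eqVneq (jt e (fun q => a q - eps q)%N) 0) => [->|nz]; first by rewrite mulr0.
by move: ne; rewrite strip_of_eps.
Qed.

End Jacobi_Trudi_step.

(** The branching rule for tableaux and the column splitting of the determinant are the same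
    recursion in the number of variables. Without variables, [e_k] is 1 at [k = 0] and 0
    elsewhere. *)
Lemma tab_sum_jt N n s : sorted geq s -> (nth 0 s 0 <= n)%N ->
  tab_sum N s = jt (fun k => restr N (elementary k)) (shifted_cols (n := n) s).
Proof.
elim: N s => [|N IH] s ss sn; last first.
  rewrite tab_sumS //.
  rewrite (@jt_extend _ _ (fun k => restr N (elementary k)) _ (monom [mset N]%mset)).
  - rewrite sum_strips_jt // [LHS]big_seq [RHS]big_seq; apply: eq_bigr => v vs.
    rewrite IH ?(strips_sorted vs) //; have /stripsP[sv h] := vs.
    case: (posnP (size s)) => [s0|/h]; last by lia.
    by rewrite nth_default ?sv ?s0.
  - by rewrite elementary0 !rmorph1.
  - by move=> k; exact: restr_elementaryS.
have e0 k : restr 0 (elementary k) = (k == 0%N)%:R.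
  case: k => [|k]; first by rewrite elementary0 rmorph1.
  by rewrite restr_elementary_gt.
rewrite /tab_sum /=; case: ifP => h.
  rewrite big_seq1.
  have -> : content (nseq (size s) [::]) = mset0.
    rewrite /content (_ : flatten _ = [::]); first by rewrite seq_mset_nil.
    by elim: (size s).
  rewrite monom0 -(det1 _ n); congr (\det _); apply/matrixP => p q; rewrite !mxE.
  have -> : shifted_cols s q = (n.-1 - q)%N.
    rewrite /shifted_cols (_ : count _ s = 0%N) //; apply/eqP; rewrite -leqn0 leqNgt -has_count.
    by apply/hasPn => y /(allP h) /eqP ->.
  rewrite /ec e0; case: ltnP => pq.
    rewrite (_ : (p == q) = false) //; apply/eqP => e; by rewrite e ltnn in pq.
  have key (x y : nat) : (x < n)%N -> (y < n)%N -> (n.-1 - x <= n.-1 - y)%N ->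
    (n.-1 - y - (n.-1 - x) == 0)%N = (x == y) by move=> h1 h2 h3; apply/eqP/eqP; lia.
  by rewrite key.
rewrite big_nil; have [x xs x0] : exists2 x, x \in s & x != 0%N.
  by apply/hasP; rewrite has_predC h.
have c0 : (0 < count (ltn 0) s)%N by rewrite -has_count; apply/hasP; exists x => //=; rewrite lt0n.
have n0 : (0 < n)%N.
  by apply: leq_trans sn; rewrite count_galois.
apply/esym; apply: (@det_col0 _ _ _ (Ordinal n0)) => p; rewrite mxE /ec /shifted_cols /=.
case: ltnP => // hp; rewrite e0 (_ : (_ == _) = false) //; apply/eqP; lia.
Qed.

Lemma restr_jt N n (a : 'I_n -> nat) :
  restr N (jt elementary a) = jt (fun k => restr N (elementary k)) a.
Proof.
rewrite /jt -det_map_mx; congr (\det _); apply/matrixP => p q; rewrite !mxE /ec.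
by case: ifP => // _; rewrite rmorph0.
Qed.

(** Allowing any [n] above the first part makes all Schur functions of the sums minors of a single
    matrix with [n] rows. *)
Theorem jacobi_trudi n (la : int_partition) : (first_part la <= n)%N ->
  schur la = jt elementary (shifted_cols (n := n) la).
Proof.
move=> h; apply: restr_inj => N; rewrite restr_schur restr_jt.
by apply: tab_sum_jt; [exact: int_partition_sorted | rewrite nth0].
Qed.

(** Symmetry is read off the determinant, whose entries are symmetric; the tableau sum does not show
    it. *)
Lemma act_schur s la : bijective s -> act s (schur la) = schur la.
Proof.
move=> bs; rewrite (jacobi_trudi (leqnn _)); apply: act_det => // p q.
by rewrite !mxE /ec; case: ifP => _; rewrite ?raddf0 ?act_elementary.
Qed.

(** * Schur expansions and triangularity of Kostka numbers *)

Section SchurBasis.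

Implicit Types (la mu : int_partition) (m : monomial).

Lemma ptn_of_proof c : sorted geq (cj (head 0 c) c) && (0%N \notin cj (head 0 c) c).
Proof.
rewrite cj_sorted /=; apply/mapP => -[q]; rewrite mem_iota add0n => hq.
case: c hq => //= x c hq; by rewrite hq.
Qed.

(** Conjugation: [c] lists column lengths, possibly with trailing zeros. *)
Definition ptn_of c : int_partition := IntPartition (ptn_of_proof c).

Lemma nth_int_partition_pos (la : int_partition) i : (i < size la)%N -> (0 < nth 0 la i)%N.
Proof.
move=> h; rewrite lt0n; apply/eqP => e; move: (int_partition_pos la).
by rewrite -e mem_nth.
Qed.

Lemma first_part_nth (la : int_partition) : first_part la = nth 0%N la 0.
Proof. by rewrite nth0. Qed.

Lemma cj_ptn_of n c : sorted geq c -> size c = n -> cj n (ptn_of c) = c.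
Proof. by move=> sc szc; rewrite /= -nth0 cjK. Qed.

Lemma ptn_of_cj n la : (first_part la <= n)%N -> ptn_of (cj n la) = la.
Proof.
move=> h; apply: val_inj => /=.
have sl := int_partition_sorted la.
have -> : head 0%N (cj n la) = size la.
  rewrite -nth0 nth_cj; case: n h => [|n] /= h.
    move: (@nth_int_partition_pos la 0); rewrite -first_part_nth.
    by case: (size la) => // k /(_ isT); lia.
  apply/eqP; rewrite -all_count; apply/allP => x xla /=; rewrite lt0n.
  by apply/eqP => e; move: (int_partition_pos la); rewrite -e xla.
by rewrite cjK // -first_part_nth.
Qed.

Lemma sumn_ptn_of n c : sorted geq c -> size c = n -> sumn (ptn_of c) = sumn c.
Proof. by move=> sc szc; rewrite /= sumn_cj // nth0. Qed.

Lemma size_le_sumn (la : int_partition) : (size la <= sumn la)%N.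
Proof.
have := int_partition_pos la; elim: (la : seq nat) => //= x s IH.
by rewrite inE negb_or => /andP[x0 /IH]; lia.
Qed.

Lemma first_part_le_sumn (la : int_partition) : (first_part la <= sumn la)%N.
Proof. by rewrite /first_part; case: (la : seq nat) => //= x s; exact: leq_addr. Qed.

(** A partition of [d] has at most [d] columns, each of length at most [d]; the enumeration runs
    over all such lists of column lengths. *)
Definition ptns (d : nat) : seq int_partition :=
  filter (fun la : int_partition => sumn la == d)
    (undup [seq ptn_of [seq val (phi i) | i <- enum 'I_d] | phi : {ffun 'I_d -> 'I_d.+1}]).

Lemma ptns_uniq d : uniq (ptns d).
Proof. by rewrite filter_uniq ?undup_uniq. Qed.

Lemma mem_ptns d la : (la \in ptns d) = (sumn la == d).
Proof.
rewrite mem_filter mem_undup; case: eqP => //= e; apply/mapP.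
have hq (q : nat) : (count (ltn q) la < d.+1)%N.
  by rewrite ltnS -e; apply: leq_trans (count_size _ _) _; exact: size_le_sumn.
exists [ffun q : 'I_d => Ordinal (hq q)]; first by rewrite mem_enum.
rewrite -[LHS](@ptn_of_cj d); last by rewrite -e first_part_le_sumn.
congr ptn_of; apply: (@eq_from_nth _ 0%N); rewrite size_cj.
  by rewrite size_map size_enum_ord.
move=> q qd; rewrite nth_cj qd.
rewrite (nth_map (Ordinal qd)) ?size_enum_ord // ffunE /=.
by rewrite nth_enum_ord.
Qed.

Lemma fsum_ptns D (F : int_partition -> rat) :
  (forall la, (D < sumn la)%N -> F la = 0) ->
  (\sum_(la \in [set: int_partition]) F la = \sum_(d < D.+1) \sum_(la <- ptns d) F la)%R.
Proof.
move=> F0; rewrite (@fsum_seq _ _ (flatten [seq ptns d | d <- iota 0 D.+1])) //.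
- rewrite big_flatten big_map -(big_mkord xpredT (fun d => \sum_(la <- ptns d) F la)).
  by rewrite /index_iota subn0.
- elim: (iota 0 D.+1) (iota_uniq 0 D.+1) => //= d s IH /andP[ds us].
  rewrite cat_uniq ptns_uniq IH // andbT; apply/hasPn => la /flattenP[t /mapP[d' d's ->]].
  by rewrite !mem_ptns => /eqP e; apply: contra ds => /eqP <-; rewrite e.
move=> la _ h; apply: F0; rewrite ltnNge; apply: contra h => h.
apply/flattenP; exists (ptns (sumn la)); last by rewrite mem_ptns.
by apply/mapP; exists (sumn la) => //; rewrite mem_iota.
Qed.

Lemma fsum_ptns1 d (F : int_partition -> rat) :
  (forall la, sumn la != d -> F la = 0) ->
  (\sum_(la \in [set: int_partition]) F la = \sum_(la <- ptns d) F la)%R.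
Proof.
move=> F0; rewrite (@fsum_seq _ _ (ptns d)) ?ptns_uniq // => la _.
by rewrite mem_ptns; exact: F0.
Qed.

Lemma size_content s T : tableau s T -> size (content T) = sumn s.
Proof.
by move=> [<- _ _]; rewrite (perm_size (perm_eq_seq_mset _)) size_flatten.
Qed.

Lemma coef_tab_sum N la m : below N m -> coef (schur la) m = coef (tab_sum N la) m.
Proof. by move=> h; rewrite -restr_schur coef_restr h. Qed.

Lemma schur_homogeneous la m : sumn la != size m -> coef (schur la) m = 0.
Proof.
move=> h; have [N Nm] := below_exists m; rewrite (coef_tab_sum _ Nm) scoef_sum.
rewrite big_seq big1 // => T /(mem_tableaux N T (int_partition_sorted la))[tT _] /=.
by case: eqP => // e; case/eqP: h; rewrite e (size_content tT).
Qed.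

Lemma coef_schur_sum (a : int_partition -> rat) m :
  coef (ssum [set: int_partition] (fun la => a la *: schur la)) m =
  \sum_(la <- ptns (size m)) a la * coef (schur la) m.
Proof.
apply: (@fsum_ptns1 (size m) (fun la => a la * coef (schur la) m)) => la h.
by rewrite schur_homogeneous ?mulr0.
Qed.

Local Open Scope mset_scope.

Fixpoint pmon (N : nat) (f : nat -> nat) : monomial :=
  if N is N'.+1 then pmon N' f `+` seq_mset (nseq (f N') N') else mset0.

Lemma pmonE N f x : pmon N f x = if (x < N)%N then f x else 0%N.
Proof.
elim: N => [|N IH] /=; first by rewrite mset0E.
rewrite msetE2 IH mset_seqE count_nseq /= ltnS.
rewrite [N == x]eq_sym; case: (ltngtP x N) => [h|h|->] /=; by rewrite ?mul0n ?addn0 ?mul1n.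
Qed.

Lemma below_pmon N f : below N (pmon N f).
Proof.
apply/belowP => x; rewrite in_mset pmonE; by case: ifP.
Qed.

Lemma size_msetD (x y : monomial) : size (x `+` y) = (size x + size y)%N.
Proof.
rewrite -size_cat; apply: perm_size; apply/allP => z _.
by rewrite /= count_cat !count_mem_mset msetE2.
Qed.

Lemma size_pmon N f : size (pmon N f) = (\sum_(i < N) f i)%N.
Proof.
elim: N => [|N IH] /=; first by rewrite size_mset0 big_ord0.
by rewrite size_msetD IH (perm_size (perm_eq_seq_mset _)) size_nseq big_ord_recr.
Qed.

Lemma coef_varX N k g m : coef (monom [mset N] ^+ k * restr N g) m =
  if (m N == k) && below N (m `\` seq_mset (nseq k N))
  then coef g (m `\` seq_mset (nseq k N)) else 0.
Proof.
rewrite -monom_nseq coef_monomM coef_restr; set a := seq_mset _.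
have aE x : a x = if x == N then k else 0%N.
  by rewrite mset_seqE count_nseq /= eq_sym; case: eqP; rewrite ?mul1n.
case: (boolP (a `<=` m)) => h; last first.
  case: eqP => //= e; case/msubsetP: h => x; rewrite aE; case: eqP => [->|//].
  by rewrite e.
case: (boolP (below N _)) => hb; last by rewrite andbF.
have := belowP _ _ hb N; rewrite in_mset msetE2 aE eqxx => hN.
have kN : (k <= m N)%N by have := msubsetP h N; rewrite aE eqxx.
case: eqP => //= ne; exfalso; suff : (N < N)%N by rewrite ltnn.
by apply: hN; rewrite subn_gt0 ltn_neqAle kN andbT; apply/eqP => e; apply: ne.
Qed.

Lemma restr_tab_sum N v : sorted geq v -> restr N (tab_sum N v) = tab_sum N v.
Proof.
move=> sv; apply: seriesP => m; rewrite coef_restr; case: ifP => // h.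
rewrite scoef_sum big_seq big1 // => T /(mem_tableaux N T sv)[_ hT] /=.
case: eqP => // e; case/negP: h; apply/belowP => x.
rewrite e (perm_mem (perm_eq_seq_mset _)) => /flattenP[r /hT /allP]; exact.
Qed.

Lemma coef_tab_sumS N s f : sorted geq s ->
  coef (tab_sum N.+1 s) (pmon N.+1 f) =
  \sum_(v <- strips s) (sumn s - sumn v == f N)%N%:R * coef (tab_sum N v) (pmon N f).
Proof.
move=> ss; rewrite tab_sumS // scoef_sum [LHS]big_seq [RHS]big_seq.
apply: eq_bigr => v /strips_sorted sv.
rewrite -(restr_tab_sum N sv) coef_varX coef_restr below_pmon pmonE ltnSn.
rewrite eq_sym; case: eqP => e; last by rewrite mul0r.
by rewrite mul1r e /= msetDKBC below_pmon.
Qed.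

Lemma sumn_nth s N : (forall i, (N <= i)%N -> nth 0 s i = 0%N) ->
  sumn s = (\sum_(i < N) nth 0 s i)%N.
Proof.
elim: s N => [|x s IH] N h; first by rewrite big1 // => i _; rewrite nth_nil.
case: N h => [|N] h /=.
  have := h 0%N (leqnn _); rewrite /= => ->; rewrite big_ord0 (IH 0%N) ?big_ord0 //.
  by move=> i _; exact: (h i.+1).
rewrite big_ord_recl /= (IH N) // => i hi; exact: (h i.+1).
Qed.

(** A nonzero coefficient of the branching rule provides a strip complement [v] inside [s] with
    content [f] on the smaller letters; its partial sums are bounded by those of [s]. *)
Lemma tab_sum_dominance N s f : sorted geq s -> coef (tab_sum N s) (pmon N f) != 0 ->
  [/\ forall i, (N <= i)%N -> nth 0 s i = 0%N,
      sumn s = (\sum_(i < N) f i)%N &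
      forall k, (k <= N)%N -> (\sum_(i < k) f i <= \sum_(i < k) nth 0 s i)%N].
Proof.
elim: N s => [|N IH] s ss.
  rewrite /tab_sum /=; case: ifP => [/allP h|_]; last by rewrite big_nil eqxx.
  have s0 i : nth 0 s i = 0%N.
    case: (ltnP i (size s)) => hi; last by rewrite nth_default.
    by apply/eqP/h; exact: mem_nth.
  move=> _; split=> [i _|//|k]; rewrite ?s0 //.
    by rewrite big_ord0 (@sumn_nth _ 0) ?big_ord0.
  by rewrite leqn0 => /eqP ->; rewrite !big_ord0.
rewrite coef_tab_sumS // => nz.
have [v vs nzv] : exists2 v, v \in strips s &
    (sumn s - sumn v == f N)%N%:R * coef (tab_sum N v) (pmon N f) != 0.
  apply/hasP; apply: contraNT nz; rewrite -all_predC => /allP h.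
  by rewrite big_seq big1 // => v /h /=; rewrite negbK => /eqP.
move: nzv; case: (eqVneq (sumn s - sumn v)%N (f N)) => [e|_]; last by rewrite mul0r eqxx.
rewrite mul1r => /(IH _ (strips_sorted vs))[h1 h2 h3].
have /stripsP[sv hv] := vs.
have vle i : (nth 0 v i <= nth 0 s i)%N.
  case: (ltnP i (size s)) => h; last by rewrite nth_default ?sv.
  by have := hv _ h; lia.
have sle i : (nth 0 s i.+1 <= nth 0 v i)%N.
  case: (ltnP i (size s)) => h; last by rewrite nth_default // ltnW.
  by have := hv _ h; lia.
have s0 i : (N.+1 <= i)%N -> nth 0 s i = 0%N.
  by case: i => // i hi; have := sle i; rewrite h1 // leqn0 => /eqP.
have sE : sumn s = (\sum_(i < N.+1) f i)%N.
  rewrite big_ord_recr /= -h2 -e subnKC //; exact: strips_sumn_le.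
split=> // k; rewrite leq_eqVlt => /orP[/eqP ->|].
  by rewrite -sE -(sumn_nth s0).
rewrite ltnS => kN; apply: leq_trans (h3 _ kN) _.
by apply: leq_sum => i _; exact: vle.
Qed.

Lemma tab_sum_diag N s : sorted geq s -> (forall i, (N <= i)%N -> nth 0 s i = 0%N) ->
  coef (tab_sum N s) (pmon N (nth 0%N s)) = 1.
Proof.
elim: N s => [|N IH] s ss s0.
  rewrite /tab_sum /= ifT; last first.
    by apply/allP => x /(nthP 0%N)[i _ <-]; rewrite /= s0.
  rewrite big_seq1 (_ : content _ = mset0) /= ?eqxx //.
  rewrite /content (_ : flatten _ = [::]); first by rewrite seq_mset_nil.
  by elim: (size s).
pose v0 := mkseq (fun i => if (i < N)%N then nth 0%N s i else 0%N) (size s).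
have nth_v0 i : nth 0%N v0 i = if (i < N)%N then nth 0%N s i else 0%N.
  case: (ltnP i (size s)) => h; first by rewrite nth_mkseq.
  by rewrite nth_default ?size_mkseq // nth_default // if_same.
have v0s : v0 \in strips s.
  apply/stripsP; rewrite size_mkseq; split=> // i hi; rewrite nth_v0.
  have := sorted_geq_nth ss (leqnSn i); case: ltnP => // Ni; last by rewrite s0.
  by rewrite leqnn => ->.
have v00 i : (N <= i)%N -> nth 0%N v0 i = 0%N by rewrite nth_v0 ltnNge => ->.
have sumv0 : sumn v0 = (\sum_(i < N) nth 0 s i)%N.
  by rewrite (sumn_nth v00); apply: eq_bigr => i _; rewrite nth_v0 ltn_ord.
have sums := sumn_nth s0.
have pm0 : pmon N (nth 0%N s) = pmon N (nth 0%N v0).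
  by apply/msetP => x; rewrite !pmonE; case: ifP => // h; rewrite nth_v0 h.
rewrite coef_tab_sumS // (bigD1_seq v0) ?strips_uniq //= big_seq_cond.
rewrite [X in _ + X]big1 ?addr0.
  by rewrite pm0 IH ?(strips_sorted v0s) // sums sumv0 big_ord_recr /= addKn eqxx mul1r.
move=> v /andP[vs nv]; apply/eqP; apply: contraNT nv; rewrite mulf_eq0 negb_or.
case/andP => _ /(tab_sum_dominance (strips_sorted vs))[h1 h2 _].
have /stripsP[sv hv] := vs.
have vle (i : 'I_N) : (nth 0 v i <= nth 0 s i)%N.
  case: (ltnP i (size s)) => h; last by rewrite nth_default ?sv.
  by have := hv _ h; lia.
apply/eqP; apply: (@eq_from_nth _ 0%N) => [|i _]; first by rewrite size_mkseq.
rewrite nth_v0; case: ltnP => hi; last by rewrite h1.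
have := h2; rewrite (sumn_nth h1) => /esym e.
have := leqif_sum (fun (j : 'I_N) (_ : true) => conj (vle j) (erefl (nth 0 v j == nth 0 s j))).
case=> _; rewrite -e eqxx => /esym/forallP/(_ (Ordinal hi)) /=.
by move/eqP.
Qed.

Definition ptn_mon (mu : int_partition) : monomial := pmon (size mu) (nth 0%N mu).

Lemma ptn_mon_wide N (mu : int_partition) : (size mu <= N)%N ->
  pmon N (nth 0%N mu) = ptn_mon mu.
Proof.
move=> h; apply/msetP => x; rewrite !pmonE; case: (ltnP x (size mu)) => hx.
  by rewrite (leq_trans hx h).
by rewrite nth_default // if_same.
Qed.

Definition kostka (la mu : int_partition) : rat := coef (schur la) (ptn_mon mu).
(** A number that grows strictly along the dominance order, so that triangularity becomes an
    inequality of integers. *)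
Definition ptn_weight (d : nat) (la : int_partition) : nat :=
  \sum_(k < d.+1) \sum_(i < k) nth 0 la i.

Lemma kostkaE d la mu : sumn mu = d ->
  kostka la mu = coef (tab_sum d la) (pmon d (nth 0%N mu)).
Proof.
move=> e; have h : (size mu <= d)%N by rewrite -e size_le_sumn.
by rewrite /kostka -(ptn_mon_wide h); apply: coef_tab_sum; exact: below_pmon.
Qed.

Lemma kostka_diag la : kostka la la = 1.
Proof.
rewrite (kostkaE _ erefl) tab_sum_diag ?int_partition_sorted // => i h.
by rewrite nth_default // (leq_trans (size_le_sumn la)).
Qed.

Lemma kostka_triangular d la mu : sumn la = d -> sumn mu = d ->
  kostka la mu != 0 ->
  (ptn_weight d mu <= ptn_weight d la ?= iff (la == mu))%N.
Proof.
move=> ela emu; rewrite (kostkaE _ emu) => /(tab_sum_dominance (int_partition_sorted la)).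
case=> h1 h2 h3.
have le (k : 'I_d.+1) : (\sum_(i < k) nth 0 mu i <= \sum_(i < k) nth 0 la i)%N.
  by apply: h3; rewrite -ltnS.
have H := leqif_sum (fun (k : 'I_d.+1) (_ : true) => conj (le k) (erefl
  ((\sum_(i < k) nth 0 mu i)%N == (\sum_(i < k) nth 0 la i)%N))).
split; first by case: H.
rewrite /ptn_weight; case: H => _ ->; apply/forallP/eqP => [h|-> k]; last by rewrite eqxx.
have nthE i : (i < d)%N -> nth 0%N mu i = nth 0%N la i.
  move=> id; have /= /eqP e1 := h (Ordinal (ltnW id : i < d.+1)%N).
  have /= /eqP := h (Ordinal (id : i.+1 < d.+1)%N).
  by rewrite !big_ord_recr /= e1 => /addnI.
have e i : nth 0%N la i = nth 0%N mu i.
  case: (ltnP i d) => id; first by rewrite nthE.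
  rewrite !nth_default //; first by apply: leq_trans id; rewrite -emu size_le_sumn.
  by apply: leq_trans id; rewrite -ela size_le_sumn.
have szE : size la = size mu.
  apply/eqP; rewrite eqn_leq; apply/andP; split; rewrite leqNgt; apply/negP => hs.
    by have := nth_int_partition_pos hs; rewrite e nth_default.
  by have := nth_int_partition_pos hs; rewrite -e nth_default.
by apply: val_inj; apply: (@eq_from_nth _ 0%N).
Qed.

(** Unitriangularity: evaluate at a partition of largest weight among those with a nonzero
    coefficient; only its own term is left. *)
Lemma kostka_inj d (v : int_partition -> rat) :
  (forall mu, sumn mu = d -> \sum_(la <- ptns d) v la * kostka la mu = 0) ->
  forall la, sumn la = d -> v la = 0.
Proof.
move=> h la0 e0; apply/eqP/negPn/negP => nz0.
pose B := (\sum_(la <- ptns d) ptn_weight d la)%N.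
have [t [la [ela vla lat]] hmax] : exists2 t : nat,
    exists la, [/\ sumn la = d, v la != 0 & ptn_weight d la = t] &
    forall la, sumn la = d -> v la != 0 -> (ptn_weight d la <= t)%N.
  have ex : exists t, has (fun la => (v la != 0) && (ptn_weight d la == t)) (ptns d).
    exists (ptn_weight d la0); apply/hasP; exists la0; first by rewrite mem_ptns e0.
    by rewrite nz0 eqxx.
  have bnd t : has (fun la => (v la != 0) && (ptn_weight d la == t)) (ptns d) -> (t <= B)%N.
    by case/hasP => la lap /andP[_ /eqP <-]; rewrite /B (big_rem la) //= leq_addr.
  case: (ex_maxnP ex bnd) => t /hasP[la]; rewrite mem_ptns => /eqP ela /andP[vla /eqP lat] mx.
  exists t; first by exists la.
  move=> la' ela' vla'; apply: mx; apply/hasP; exists la'; first by rewrite mem_ptns ela'.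
  by rewrite vla' eqxx.
case/eqP: vla; rewrite -(h _ ela) (bigD1_seq la) ?ptns_uniq ?mem_ptns ?ela //=.
rewrite kostka_diag mulr1 big_seq_cond big1 ?addr0 // => la' /andP[].
rewrite mem_ptns => /eqP ela' nla.
case: (eqVneq (v la') 0) => [->|vla']; first by rewrite mul0r.
case: (eqVneq (kostka la' la) 0) => [->|nk]; first by rewrite mulr0.
have [le eq] := kostka_triangular ela' ela nk.
have := hmax _ ela' vla'; rewrite -lat => le'.
by move: eq; rewrite eqn_leq le le' (negbTE nla).
Qed.

(** The Kostka matrix of degree [d] is square, so its trivial kernel makes it invertible. *)
Lemma kostka_surj d (u : int_partition -> rat) : exists v : int_partition -> rat,
  forall mu, sumn mu = d -> u mu = \sum_(la <- ptns d) v la * kostka la mu.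
Proof.
pose L := in_tuple (ptns d); pose n := size (ptns d).
pose A : 'M[rat]_n := \matrix_(i, j) kostka (tnth L i) (tnth L j).
have tinj : injective (tnth L).
  move=> i j; have x0 := tnth L i; rewrite !(tnth_nth x0) => /eqP.
  by rewrite nth_uniq ?ptns_uniq //= => /eqP/val_inj.
have sumL i : sumn (tnth L i) = d.
  by apply/eqP; rewrite -mem_ptns; exact: mem_tnth.
have memL mu : sumn mu = d -> exists i, mu = tnth L i.
  move=> e; have : mu \in L by rewrite mem_ptns e.
  by case/tnthP => i ->; exists i.
pose vec (w : 'rV[rat]_n) la : rat := \sum_i w 0 i * (la == tnth L i)%:R.
have vecE w i : vec w (tnth L i) = w 0 i.
  rewrite /vec (bigD1 i) //= eqxx mulr1 big1 ?addr0 // => j ji.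
  by rewrite (inj_eq tinj) eq_sym (negbTE ji) mulr0.
have prodE w j : (w *m A) 0 j = \sum_(la <- ptns d) vec w la * kostka la (tnth L j).
  rewrite mxE (big_tnth _ _ (ptns d)); apply: eq_bigr => i _.
  by rewrite mxE -(vecE w i).
have Aunit : A \in unitmx.
  rewrite -row_free_unit -kermx_eq0; apply/eqP/row_matrixP => i; rewrite row0.
  apply/rowP => k; rewrite [RHS]mxE -(vecE (row i (kermx A)) k).
  apply: (@kostka_inj d) => // mu /memL[j ->]; rewrite -prodE.
  by rewrite -row_mul mulmx_ker row0 mxE.
exists (vec ((\row_j u (tnth L j)) *m invmx A)) => mu /memL[j ->].
by rewrite -prodE mulmxKV // mxE.
Qed.

Lemma extend_bij (s : seq nat) N : uniq s -> all (fun x => x < N)%N s ->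
  exists f : nat -> nat, bijective f /\ forall x, x \in s -> f x = index x s.
Proof.
move=> us sN; pose L := s ++ [seq x <- iota 0 N | x \notin s].
have Lp : perm_eq L (iota 0 N).
  apply: uniq_perm; rewrite ?iota_uniq //.
    rewrite cat_uniq us filter_uniq ?iota_uniq // andbT.
    by apply/hasPn => x; rewrite mem_filter => /andP[].
  move=> x; rewrite mem_cat mem_filter mem_iota /= add0n.
  by case: (boolP (x \in s)) => //= /(allP sN) ->.
have sL : size L = N by rewrite (perm_size Lp) size_iota.
have uL : uniq L by rewrite (perm_uniq Lp) iota_uniq.
have mL x : (x \in L) = (x < N)%N by rewrite (perm_mem Lp) mem_iota.
exists (fun x => if (x < N)%N then index x L else x); split; last first.
  by move=> x xs; rewrite (allP sN _ xs) index_cat xs.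
exists (fun i => if (i < N)%N then nth 0%N L i else i) => x.
  case: (ltnP x N) => h; last by rewrite ltnNge h.
  by rewrite -{1}sL index_mem mL h nth_index // mL.
case: (ltnP x N) => h; last by rewrite ltnNge h.
by rewrite -mL mem_nth ?sL // index_uniq ?sL.
Qed.

(** List the variables of [m] by decreasing multiplicity and rename them 0, 1, 2, ... by a bijection
    of all variables. *)
Lemma symmetric_ptn_mon m : exists2 mu : int_partition, sumn mu = size m &
  forall f, symmetric_series f -> coef f m = coef f (ptn_mon mu).
Proof.
pose r (x y : nat) := (m y <= m x)%N.
have rt : transitive r by move=> y x z; rewrite /r => h1 h2; exact: leq_trans h2 h1.
have rtot : total r by move=> x y; exact: leq_total.
pose s := sort r (undup m).
have us : uniq s by rewrite sort_uniq undup_uniq.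
have ms x : (x \in s) = (x \in m) by rewrite mem_sort mem_undup.
have [N /belowP Nm] := below_exists m.
have sN : all (fun x => x < N)%N s by apply/allP => x; rewrite ms; exact: Nm.
have [f [bf fs]] := extend_bij us sN.
have mus : sorted geq (map m s) && (0%N \notin map m s).
  rewrite sorted_map (sort_sorted rtot); apply/mapP => -[x]; rewrite ms in_mset => h e.
  by rewrite -e in h.
pose mu := IntPartition mus.
have e : mset_map f m = ptn_mon mu.
  apply/msetP => i; rewrite mset_seqE /ptn_mon pmonE /= size_map count_map.
  case: ltnP => hi.
    rewrite (nth_map 0%N) // -count_mem_mset; apply: eq_in_count => x; rewrite -ms => xs /=.
    by rewrite fs //; apply/eqP/eqP => [<-|->]; rewrite ?nth_index ?index_uniq.
  apply/eqP; rewrite -leqn0 leqNgt -has_count; apply/hasPn => x; rewrite -ms => xs /=.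
  by rewrite fs // ltn_eqF // (leq_trans _ hi) // index_mem.
exists mu; last by move=> g sg; rewrite -e -(sg f bf).
have <- : size (mset_map f m) = size m.
  by rewrite (perm_size (perm_eq_seq_mset _)) size_map.
rewrite e /ptn_mon size_pmon; apply: sumn_nth => k hk.
by rewrite nth_default.
Qed.

Lemma schur_symmetric la : symmetric_series (schur la).
Proof. by apply/symmetricP => s bs; exact: act_schur. Qed.

Lemma schur_expansion_exists f : symmetric_series f ->
  exists a, schur_expansion f a.
Proof.
move=> sf.
have /choice [A hA] : forall d, exists v : int_partition -> rat, forall mu, sumn mu = d ->
    coef f (ptn_mon mu) = \sum_(la <- ptns d) v la * kostka la mu.
  by move=> d; exact: kostka_surj.
exists (fun la => A (sumn la) la); apply: seriesP => m; rewrite coef_schur_sum.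
have [mu emu hmu] := symmetric_ptn_mon m.
rewrite (hmu _ sf) (hA _ _ emu) [LHS]big_seq [RHS]big_seq; apply: eq_bigr => la.
by rewrite mem_ptns => /eqP ->; rewrite /kostka -(hmu _ (schur_symmetric la)).
Qed.

Lemma schur_expansion_unique f a a' :
  schur_expansion f a -> schur_expansion f a' -> a = a'.
Proof.
move=> ea ea'; apply/funext => la; apply/eqP; rewrite -subr_eq0; apply/eqP.
apply: (@kostka_inj (sumn la) (fun la => a la - a' la)) => // mu emu.
under eq_bigr => la' _ do rewrite mulrBl.
have sz : size (ptn_mon mu) = sumn la.
  rewrite -emu /ptn_mon size_pmon; apply/esym/sumn_nth => k hk.
  by rewrite nth_default.
have := congr1 (coef^~ (ptn_mon mu)) ea; have := congr1 (coef^~ (ptn_mon mu)) ea'.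
rewrite !coef_schur_sum sz => h h'.
by rewrite sumrB -[X in X - _]h' -[X in _ - X]h subrr.
Qed.

Lemma schur_coefP f : symmetric_series f -> schur_expansion f (schur_coef f).
Proof. by move=> /schur_expansion_exists ex; exact: xgetPex ex. Qed.

Lemma schur_coef_eq f a : schur_expansion f a -> schur_coef f = a.
Proof.
move=> ea; apply: schur_expansion_unique (ea).
have ex : exists a, schur_expansion f a by exists a.
exact: xgetPex ex.
Qed.

Lemma coef_schur_coef f m : symmetric_series f ->
  coef f m = \sum_(la <- ptns (size m)) schur_coef f la * coef (schur la) m.
Proof. by move=> sf; rewrite {1}(schur_coefP sf) coef_schur_sum. Qed.

End SchurBasis.

Section Derivation.

Local Open Scope mset_scope.
Implicit Types (la mu : int_partition) (m : monomial) (f g : series).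
Local Notation var N := (monom [mset N]).

(** * The adjoint of multiplication by p_1 *)

Definition fresh m : nat := (\max_(x <- m) x).+1.

Lemma below_fresh m : below (fresh m) m.
Proof.
apply/belowP => x xm; rewrite ltnS.
exact: (leq_bigmax_seq (F := fun x => x)).
Qed.

Lemma fresh_notin m : fresh m \notin m.
Proof. by apply/negP => /(belowP _ _ (below_fresh m)); rewrite ltnn. Qed.

Definition swap_nat (a b x : nat) : nat := if x == a then b else if x == b then a else x.

Lemma swap_nat_bij a b : bijective (swap_nat a b).
Proof.
apply: inv_bij => x; rewrite /swap_nat.
case: (eqVneq x a) => [->|xa]; first by rewrite eqxx; case: eqVneq.
by case: (eqVneq x b) => [->|xb]; rewrite ?eqxx // (negbTE xa) (negbTE xb).
Qed.

Lemma mset_map_id s m : (forall x, x \in m -> s x = x) -> mset_map s m = m.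
Proof.
move=> h; rewrite /mset_map -[RHS]seq_mset_id; congr seq_mset.
by rewrite -[RHS]map_id; apply/seq.eq_in_map => x xm; exact: h.
Qed.

Lemma mset_map_swap a b m : a \notin m -> b \notin m ->
  mset_map (swap_nat a b) (a +` m) = b +` m.
Proof.
move=> am bm; rewrite mset_mapD mset_map1 /swap_nat eqxx mset_map_id // => x xm.
by case: eqP => [e|_]; [rewrite -e xm in am | case: eqP => [e|//]; rewrite -e xm in bm].
Qed.

(* For symmetric [f] this is the derivative with respect to the power sum [p_1]:
   any variable absent from [m] may replace the chosen one ([coef_dser]). *)
Definition dser f : series := Series (fun m => coef f (fresh m +` m)).

Lemma coef_dser f m N : symmetric_series f -> N \notin m ->
  coef f (N +` m) = coef (dser f) m.
Proof.
move=> sf Nm; rewrite /= -(mset_map_swap Nm (fresh_notin m)).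
by rewrite [RHS](sf _ (swap_nat_bij _ _)).
Qed.

Lemma dser_symmetric f : symmetric_series f -> symmetric_series (dser f).
Proof.
move=> sf s bs m; rewrite -/(mset_map s m).
have [s' sK s'K] := bs.
have h : s (fresh m) \notin mset_map s m.
  by rewrite mem_mset_map mem_map ?fresh_notin //; exact: bij_inj.
rewrite -(coef_dser sf h) -(coef_dser sf (fresh_notin m)).
by rewrite -mset_map1 -mset_mapD; exact: sf.
Qed.

Lemma coef_var_head N k g m : below N m ->
  coef (var N ^+ k * restr N g) (N +` m) = (k == 1%N)%:R * coef g m.
Proof.
move=> Nm; have Nm' : N \notin m.
  by apply/negP => /(belowP _ _ Nm); rewrite ltnn.
have NE : (N +` m) N = 1%N by rewrite mset1DE eqxx (mset_eq0P Nm').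
rewrite coef_varX NE eq_sym; case: eqP => [->|_]; last by rewrite mul0r.
have -> : seq_mset (nseq 1 N) = [mset N].
  by apply/msetP => x; rewrite mset_seqE /= msetnE eq_sym addn0; case: eqP.
by rewrite msetD1K Nm mul1r.
Qed.

(* 1 if [la] is [mu] plus one box, and 0 otherwise. *)
Definition adj la mu : nat :=
  \sum_(q < (sumn la).+1) (cj (sumn la).+1 la == incr_nth (cj (sumn la).+1 mu) q).

Definition jt_cols n (c : seq nat) : series :=
  jt elementary (fun q : 'I_n => nth 0 c q + (n.-1 - q))%N.

Lemma schur_jt_cols n la : (first_part la <= n)%N -> schur la = jt_cols n (cj n la).
Proof.
move=> h; rewrite (jacobi_trudi h); apply: eq_jt => q.
by rewrite /shifted_cols nth_cj ltn_ord.
Qed.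

Lemma first_part_ptn_of n c : sorted geq c -> size c = n -> (first_part (ptn_of c) <= n)%N.
Proof.
move=> sc szc; rewrite first_part_nth nth_cj; case: ifP => // _.
by rewrite -szc; exact: count_size.
Qed.

Lemma sum_ptns_cols n d c : size c = n -> sumn c = d -> (d <= n)%N ->
  \sum_(mu <- ptns d) (cj n mu == c)%:R *: schur mu =
  if sorted geq c then jt_cols n c else 0.
Proof.
move=> szc sumc dn; case: ifP => sc; last first.
  rewrite big1 // => mu _; case: eqP => [e|]; last by rewrite scale0r.
  by move: sc; rewrite -e cj_sorted.
have fp := first_part_ptn_of sc szc.
rewrite (bigD1_seq (ptn_of c)) ?ptns_uniq ?mem_ptns ?(sumn_ptn_of sc szc) ?sumc //=.
rewrite cj_ptn_of // eqxx scale1r big_seq_cond big1 ?addr0.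
  by rewrite (schur_jt_cols fp) cj_ptn_of.
move=> mu /andP[]; rewrite mem_ptns => /eqP emu ne.
case: eqP => [e|]; last by rewrite scale0r.
by case/eqP: ne; rewrite -e ptn_of_cj // (leq_trans (first_part_le_sumn mu)) ?emu.
Qed.

Lemma jt_cols_unsorted n c : size c = n ->
  (exists2 q, (q.+1 < n)%N & nth 0%N c q.+1 = (nth 0%N c q).+1) -> jt_cols n c = 0.
Proof.
move=> szc [q hq e]; apply: (jt_alternate _ (q := Ordinal (ltnW hq)) (q' := Ordinal hq)).
  by rewrite -(inj_eq val_inj) /= neq_ltn ltnSn.
by rewrite /= e; lia.
Qed.

Lemma sorted_geqPn c : ~~ sorted geq c ->
  exists2 q, (q.+1 < size c)%N & (nth 0 c q < nth 0 c q.+1)%N.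
Proof.
move=> h; case: (boolP [exists q : 'I_(size c), (q.+1 < size c) && (nth 0 c q < nth 0 c q.+1)]%N).
  by case/existsP => q /andP[h1 h2]; exists q.
rewrite negb_exists => /forallP h'; case/negP: h; apply: sorted_geqP => i.
case: (ltnP i.+1 (size c)) => hi; last by rewrite nth_default.
by have := h' (Ordinal (ltnW hi)); rewrite /= hi /= -leqNgt.
Qed.

Lemma size_incr_nth_lt c q n : size c = n -> (q < n)%N -> size (incr_nth c q) = n.
Proof. by move=> szc qn; rewrite size_incr_nth szc qn. Qed.

Lemma sumn_incr_nth c q : sumn (incr_nth c q) = (sumn c).+1.
Proof.
elim: c q => [|x c IH] [|q] //=; last by rewrite IH addnS.
by elim: q => //= q ->.
Qed.

Lemma pieri mu : elementary 1 * schur mu =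
  \sum_(la <- ptns (sumn mu).+1) (adj la mu)%:R *: schur la.
Proof.
(* With [d + 2] columns a new box may open a column and the last column of [mu] is still empty, as
   [pieri_shift] requires. *)
set d := sumn mu; pose n := d.+2; pose c := cj n mu.
have szc : size c = n by rewrite size_cj.
have fp : (first_part mu <= d.+1)%N by apply: leqW; exact: first_part_le_sumn.
have sumc : sumn c = d by rewrite /c sumn_cj ?int_partition_sorted // -first_part_nth leqW.
transitivity (\sum_(q < n) \sum_(la <- ptns d.+1) (cj n la == incr_nth c q)%:R *: schur la); last first.
  rewrite exchange_big /= [LHS]big_seq [RHS]big_seq; apply: eq_bigr => la.
  rewrite mem_ptns => /eqP e; rewrite -scaler_suml /adj e natr_sum.
  by [].
rewrite (schur_jt_cols (leqW fp)) /jt_cols -pieri_shift; last 2 first.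
- rewrite subnn addn0 nth_cj ltnSn; apply/eqP; rewrite -leqn0 leqNgt -count_galois.
    by rewrite -leqNgt -first_part_nth.
  exact: int_partition_sorted.
- exact: elementary0.
apply: eq_bigr => q _; rewrite sum_ptns_cols ?(size_incr_nth_lt szc) ?sumn_incr_nth ?sumc //.
transitivity (jt_cols n (incr_nth c q)).
  apply: eq_jt => i; rewrite nth_incr_nth -val_eqE [\val i == _]eq_sym /= -/n -/c.
  by case: (_ == _) => /=; lia.
(* A box that destroys the order makes some column exactly one longer than its left neighbour; the
   staircase shift then makes two columns of the determinant equal. *)
case: ifP => // /negbT/sorted_geqPn[q' hq' h]; apply: jt_cols_unsorted.
  exact: size_incr_nth_lt.
rewrite (size_incr_nth_lt szc) // in hq'; exists q' => //.
have := sorted_geq_nth (cj_sorted n mu) (leqnSn q'); rewrite -/c; move: h.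
by rewrite !nth_incr_nth; case: (_ == q'); case: (_ == q'.+1) => /=; lia.
Qed.

Lemma restr_elementary_step N k :
  restr N.+1 (elementary k) =
  restr N (elementary k) + var N * (if k is k'.+1 then restr N (elementary k') else 0).
Proof.
case: k => [|k]; first by rewrite elementary0 !rmorph1 mulr0 addr0.
exact: restr_elementaryS.
Qed.

Lemma sum_single_eps (V : nmodType) n (G : {ffun 'I_n -> bool} -> V) :
  \sum_(eps : {ffun 'I_n -> bool} | (\sum_q eps q)%N == 1%N) G eps =
  \sum_q G [ffun i => i == q].
Proof.
pose h (q : 'I_n) : {ffun 'I_n -> bool} := [ffun i => i == q].
rewrite (reindex_omap h (fun eps => [pick q | eps q])).
  apply: eq_bigl => q; apply/andP; split.
    apply/sum_nat_eq1; exists q; split; rewrite ?ffunE ?eqxx // => j jq _.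
    by rewrite ffunE (negbTE jq).
  by case: pickP => [x|/(_ q)]; rewrite ffunE ?eqxx // => /eqP ->.
move=> eps /sum_nat_eq1[q [_ eq hq]]; case: pickP => [x ex|/(_ q)]; last first.
  by move: eq; case: (eps q).
congr Some; apply/ffunP => i; rewrite ffunE.
have xq : x = q by apply/eqP; apply/negPn/negP => /hq -/(_ isT); rewrite ex.
rewrite xq; case: (eqVneq i q) => [->|iq]; first by move: eq; case: (eps q).
by have := hq i iq isT; case: (eps i).
Qed.

Definition decr_nth c q := set_nth 0%N c q (nth 0 c q).-1.

Lemma size_decr_nth c q : (q < size c)%N -> size (decr_nth c q) = size c.
Proof. by move=> h; rewrite size_set_nth; apply/maxn_idPr. Qed.

Lemma nth_decr_nth c q i : nth 0%N (decr_nth c q) i = (nth 0 c i - (i == q))%N.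
Proof. by rewrite nth_set_nth /=; case: eqP => [->|_]; rewrite ?subn1 ?subn0. Qed.

Lemma eq_incr_nth c c' q : size c = size c' -> (q < size c)%N ->
  (c == incr_nth c' q) = (0 < nth 0 c q)%N && (c' == decr_nth c q).
Proof.
move=> szc qc; have szi d : size d = size c -> size (incr_nth d q) = size c.
  by move=> e; rewrite size_incr_nth e qc.
have szd d : size d = size c -> size (decr_nth d q) = size c.
  by move=> e; rewrite size_decr_nth e.
apply/eqP/andP => [->|[c0 /eqP ->]].
  rewrite nth_incr_nth eqxx add1n; split=> //; apply/eqP.
  apply: (@eq_from_nth _ 0%N) => [|i _]; first by rewrite szd ?szi.
  by rewrite nth_decr_nth nth_incr_nth eq_sym addKn.
apply: (@eq_from_nth _ 0%N) => [|i _]; first by rewrite szi ?szd.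
rewrite nth_incr_nth nth_decr_nth eq_sym; case: eqP => [->|_] /=; lia.
Qed.

(** The part linear in [x_N] of the expansion in [jt_extend] lowers exactly one column. The removals
    that survive are those of Pieri's rule read backwards. *)
Lemma dser_schur la d m N : sumn la = d.+1 -> below N m ->
  coef (schur la) (N +` m) = \sum_(mu <- ptns d) (adj la mu)%:R * coef (schur mu) m.
Proof.
move=> ela Nm; pose n := d.+2; pose c := cj n la.
have szc : size c = n by rewrite size_cj.
have fp : (first_part la <= n)%N.
  by apply: leq_trans (first_part_le_sumn la) _; rewrite ela.
have sumc : sumn c = d.+1 by rewrite /c sumn_cj ?int_partition_sorted // -first_part_nth.
have sc : sorted geq c := cj_sorted n la.
pose a (q : 'I_n) := (nth 0 c q + (n.-1 - q))%N.
pose J (eps : {ffun 'I_n -> bool}) : series :=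
  if [forall q, (a q == 0%N) ==> ~~ eps q] then jt elementary (fun q => a q - eps q)%N else 0.
have e1 : restr N.+1 (schur la) =
    \sum_(eps : {ffun 'I_n -> bool}) var N ^+ (\sum_q eps q) * restr N (J eps).
  rewrite (schur_jt_cols fp) /jt_cols restr_jt.
  rewrite (@jt_extend _ _ (fun k => restr N (elementary k)) _ (var N)).
  - apply: eq_bigr => eps _; congr (_ * _); rewrite /J.
    by case: ifP => _; rewrite ?rmorph0 ?restr_jt.
  - by rewrite restr_elementary_step mulr0 addr0.
  - by move=> k; rewrite restr_elementary_step.
have -> : coef (schur la) (N +` m) = coef (restr N.+1 (schur la)) (N +` m).
  by rewrite coef_restr belowD below_mset1 ltnSn (below_widen (leqnSn N) Nm).
rewrite e1 scoef_sum; under eq_bigr => eps _ do rewrite coef_var_head //.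
rewrite (eq_bigr (fun eps : {ffun 'I_n -> bool} =>
  if (\sum_q eps q)%N == 1%N then coef (J eps) m else 0)); last first.
  by move=> eps _; case: eqP; rewrite ?mul1r ?mul0r.
rewrite -big_mkcond /= sum_single_eps.
transitivity (\sum_(mu <- ptns d) \sum_(q < n)
    (cj n la == incr_nth (cj n mu) q)%:R * coef (schur mu) m); last first.
  by apply: eq_bigr => mu _; rewrite -mulr_suml /adj ela natr_sum.
rewrite exchange_big; apply: eq_bigr => q _ /=.
under eq_bigr => mu _ do rewrite eq_incr_nth ?size_cj //.
(* Lowering an empty column gives nothing: the last one is excluded by the guard, and any other
   collides with the empty column after it. *)
case: (posnP (nth 0%N c q)) => cq.
  rewrite big1 => [|mu _]; last by rewrite mul0r.
  rewrite /J; case: ifP => // /forallP/(_ q); rewrite ffunE eqxx implybF.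
  rewrite /a cq add0n => aq; have qn : (q.+1 < n)%N by move: aq; rewrite /n /=; lia.
  have c1 : nth 0%N c q.+1 = 0%N.
    by have := sorted_geq_nth sc (leqnSn q); rewrite cq leqn0 => /eqP.
  have nq : q != Ordinal qn by rewrite -(inj_eq val_inj) /= neq_ltn ltnSn.
  rewrite (jt_alternate _ nq) // !ffunE eqxx [_ == q]eq_sym (negbTE nq) /a.
  by rewrite cq [nth _ _ (Ordinal _)]c1 /n /=; lia.
have szd : size (decr_nth c q) = n by rewrite size_decr_nth szc.
have sumd : sumn (decr_nth c q) = d.
  have /eqP h : c == incr_nth (decr_nth c q) q by rewrite eq_incr_nth ?szd ?szc // cq eqxx.
  by move: sumc; rewrite [c in sumn c]h sumn_incr_nth => -[].
have -> : J [ffun i => i == q] = jt_cols n (decr_nth c q).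
  rewrite /J ifT.
    apply: eq_jt => i; rewrite ffunE nth_decr_nth /a.
    rewrite -val_eqE /=; case: eqP => [->|_]; lia.
  apply/forallP => i; rewrite ffunE; case: (eqVneq i q) => [->|_]; last by rewrite implybT.
  by rewrite implybF /a; lia.
have -> : jt_cols n (decr_nth c q) = \sum_(mu <- ptns d) (cj n mu == decr_nth c q)%:R *: schur mu.
  rewrite (sum_ptns_cols szd sumd (leqW (leqnSn d))).
  case: ifP => // /negbT/sorted_geqPn[q' hq' h].
  apply: jt_cols_unsorted => //; exists q'; first by rewrite -szd.
  have := sorted_geq_nth sc (leqnSn q'); move: h; rewrite !nth_decr_nth.
  by case: (_ == _); case: (_ == _) => /=; lia.
by rewrite scoef_sum.
Qed.

Implicit Types h : series.

Lemma seq_mset1 x : seq_mset [:: x] = [mset x] :> monomial.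
Proof. by apply/msetP => y; rewrite mset_seqE /= msetnE eq_sym addn0; case: eqP. Qed.

Lemma size_mset1 x : size ([mset x] : monomial) = 1%N.
Proof. by rewrite -seq_mset1 (perm_size (perm_eq_seq_mset _)). Qed.

Lemma size_mset_eq1 m : size m = 1%N -> exists x, m = [mset x].
Proof.
move=> sm; have := seq_mset_id m; case: (m : seq nat) sm => [|x [|y s]] //= _ e.
by exists x; rewrite -e seq_mset1.
Qed.

Lemma p1E : p1 = elementary 1.
Proof.
apply: seriesP => m; rewrite coef_elementary /=.
case: (eqVneq (size m) 1%N) => [/size_mset_eq1[x ->]|sm].
  rewrite (@fsum_seq _ _ [:: x]) // => [|i _]; last first.
    rewrite inE => ix; case: eqP => // e; case/negP: ix.
    by rewrite -in_mset1 e mset11.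
  by rewrite big_seq1 eqxx -seq_mset1 (perm_uniq (perm_eq_seq_mset _)).
rewrite andbF fsbig1 // => i _ /=; case: eqP => // e.
by rewrite e size_mset1 in sm.
Qed.

Lemma size_ptn_mon mu : size (ptn_mon mu) = sumn mu.
Proof.
rewrite /ptn_mon size_pmon; apply/esym/sumn_nth => k hk.
by rewrite nth_default.
Qed.

Lemma schur_coef_dser f mu : symmetric_series f ->
  schur_coef (dser f) mu =
  \sum_(la <- ptns (sumn mu).+1) (adj la mu)%:R * schur_coef f la.
Proof.
move=> sf; rewrite (@schur_coef_eq _ (fun mu =>
  \sum_(la <- ptns (sumn mu).+1) (adj la mu)%:R * schur_coef f la)) //.
apply: seriesP => m; rewrite coef_schur_sum /= (coef_schur_coef _ sf).
rewrite size_msetD size_mset1 add1n.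
transitivity (\sum_(la <- ptns (size m).+1) \sum_(mu <- ptns (size m))
    (adj la mu)%:R * schur_coef f la * coef (schur mu) m).
  rewrite [LHS]big_seq [RHS]big_seq; apply: eq_bigr => la; rewrite mem_ptns => /eqP e.
  rewrite (dser_schur e (below_fresh m)) mulr_sumr; apply: eq_bigr => mu' _; ring.
rewrite exchange_big [LHS]big_seq [RHS]big_seq; apply: eq_bigr => mu'.
by rewrite mem_ptns => /eqP ->; rewrite mulr_suml.
Qed.

Lemma mul_scale f (c : rat) g : f * (c *: g) = c *: (f * g).
Proof.
apply: seriesP => m; rewrite scoefZ !scoefM mulr_sumr.
by apply: eq_bigr => p _; rewrite scoefZ mulrCA.
Qed.

Lemma schur_coef_mulp1 h la : symmetric_series h ->
  schur_coef (p1 * h) la =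
  if sumn la is d.+1 then \sum_(mu <- ptns d) (adj la mu)%:R * schur_coef h mu else 0.
Proof.
move=> sh; rewrite (@schur_coef_eq _ (fun la =>
  if sumn la is d.+1 then \sum_(mu <- ptns d) (adj la mu)%:R * schur_coef h mu else 0)) //.
apply: seriesP => m; rewrite coef_schur_sum scoefM p1E.
case e : (size m) => [|d].
  rewrite big_seq big1; last first.
    move=> p; rewrite mem_divs => /eqP eab.
    move: e; rewrite -eab size_msetD => /eqP; rewrite addn_eq0 => /andP[/eqP a0 _].
    by rewrite coef_elementary a0 andbF mul0r.
  rewrite big_seq big1 // => la'; rewrite mem_ptns => /eqP ->.
  by rewrite mul0r.
(* Only the part of [h] of degree [d] meets [m], so its infinite Schur expansion is cut to a finite
   sum before multiplying. *)
pose hd := \sum_(mu <- ptns d) schur_coef h mu *: schur mu.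
have -> : \sum_(p <- divs m) coef (elementary 1) p.1 * coef h p.2 =
    coef (elementary 1 * hd) m.
  rewrite scoefM [LHS]big_seq [RHS]big_seq; apply: eq_bigr => p.
  rewrite mem_divs => /eqP eab; rewrite coef_elementary.
  case: (eqVneq (size (p.1 : monomial)) 1%N) => sa; last by rewrite andbF !mul0r.
  congr (_ * _); rewrite (coef_schur_coef _ sh) scoef_sum.
  have -> : size (p.2 : monomial) = d by move: e; rewrite -eab size_msetD sa => -[].
  by [].
rewrite mulr_sumr scoef_sum.
transitivity (\sum_(mu <- ptns d) \sum_(la <- ptns d.+1)
    (adj la mu)%:R * schur_coef h mu * coef (schur la) m).
  rewrite [LHS]big_seq [RHS]big_seq; apply: eq_bigr => mu; rewrite mem_ptns => /eqP emu.
  rewrite mul_scale pieri emu scoefZ scoef_sum mulr_sumr.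
  by apply: eq_bigr => la' _; rewrite scoefZ; ring.
rewrite exchange_big [LHS]big_seq [RHS]big_seq; apply: eq_bigr => la'.
by rewrite mem_ptns => /eqP ->; rewrite mulr_suml.
Qed.

Lemma schur_coef_bounded h D : symmetric_series h ->
  (forall m, coef h m != 0 -> (size m <= D)%N) ->
  forall la, (D < sumn la)%N -> schur_coef h la = 0.
Proof.
move=> sh hD la hla; apply: (@kostka_inj (sumn la)) => // mu emu.
have := coef_schur_coef (ptn_mon mu) sh; rewrite size_ptn_mon emu => <-.
by apply/eqP; apply: contraLR hla => /hD; rewrite size_ptn_mon emu -leqNgt.
Qed.

(** On Schur coefficients, [dser] and multiplication by [p1] have transposed matrices [adj]. Bounded
    degree of [h] makes both pairings finite sums, which can be exchanged. *)
Lemma p1_adjoint_dser f : symmetric_series f -> p1_adjoint f (dser f).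
Proof.
move=> sf; split; first exact: dser_symmetric.
move=> h sh [D hD]; have h0 := schur_coef_bounded sh hD.
rewrite /hall (@fsum_ptns D); last by move=> la /h0 ->; rewrite mulr0.
rewrite (@fsum_ptns D.+1); last first.
  move=> la; rewrite schur_coef_mulp1 //; case e : (sumn la) => [|d] // dD.
  rewrite big_seq big1 ?mulr0 // => mu; rewrite mem_ptns => /eqP emu.
  by rewrite h0 ?mulr0 // emu.
rewrite [RHS]big_ord_recl [X in _ = X + _]big1_seq ?add0r; last first.
  by move=> la /=; rewrite mem_ptns => /eqP e; rewrite schur_coef_mulp1 // e mulr0.
apply: eq_bigr => d _.
transitivity (\sum_(mu <- ptns d) \sum_(la <- ptns d.+1)
    schur_coef f la * ((adj la mu)%:R * schur_coef h mu)).
  rewrite [LHS]big_seq [RHS]big_seq; apply: eq_bigr => mu; rewrite mem_ptns => /eqP e.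
  by rewrite schur_coef_dser // e mulr_suml; apply: eq_bigr => la _; ring.
rewrite exchange_big [LHS]big_seq [RHS]big_seq; apply: eq_bigr => la.
rewrite mem_ptns => /eqP e; rewrite schur_coef_mulp1 // e.
by rewrite mulr_sumr.
Qed.

Lemma schur_coef_schur mu : schur_coef (schur mu) = (fun la => (la == mu)%:R).
Proof.
apply: schur_coef_eq; apply: seriesP => m; rewrite coef_schur_sum.
case: (eqVneq (sumn mu) (size m)) => e; last first.
  rewrite schur_homogeneous // big_seq big1 // => la; rewrite mem_ptns => /eqP ela.
  case: eqP => [ll|]; last by rewrite mul0r.
  by rewrite -ela ll eqxx in e.
rewrite (bigD1_seq mu) ?ptns_uniq ?mem_ptns ?e ?eqxx //= mul1r.
by rewrite [X in _ + X]big1 ?addr0 // => la /negbTE ->; rewrite mul0r.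
Qed.

Lemma hall_schur g mu : hall g (schur mu) = schur_coef g mu.
Proof.
rewrite /hall (@fsum_seq _ _ [:: mu]) //.
  by rewrite big_seq1 schur_coef_schur eqxx mulr1.
by move=> la _; rewrite inE schur_coef_schur => /negbTE ->; rewrite mulr0.
Qed.

(** [p1perp] chooses some adjoint; pairing with the Schur functions, which have bounded degree,
    recovers all its Schur coefficients. *)
Lemma p1perpE f : symmetric_series f -> p1perp f = dser f.
Proof.
move=> sf; have ad := p1_adjoint_dser sf.
have [sg hg] : p1_adjoint f (p1perp f) by exact: (xgetPex 0 (ex_intro _ _ ad)).
have [sd hd] := ad.
suff e : schur_coef (p1perp f) = schur_coef (dser f).
  by rewrite (schur_coefP sg) (schur_coefP sd) e.
apply/funext => mu; have smu := schur_symmetric mu.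
have bmu : bounded_degree (schur mu).
  exists (sumn mu) => m; apply: contraNT; rewrite -ltnNge => h.
  by rewrite schur_homogeneous // neq_ltn h.
by rewrite -!hall_schur hg // hd.
Qed.

Lemma iter_p1perp f j : symmetric_series f ->
  symmetric_series (iter j dser f) /\ iter j p1perp f = iter j dser f.
Proof.
move=> sf; elim: j => //= j [IH1 ->]; split; first exact: dser_symmetric.
exact: p1perpE.
Qed.

Lemma iter_dserD f g j : iter j dser (f + g) = iter j dser f + iter j dser g.
Proof. by elim: j => //= j ->; apply: seriesP. Qed.

Lemma iter_dserN f j : iter j dser (- f) = - iter j dser f.
Proof. by elim: j => //= j ->; apply: seriesP. Qed.

Lemma act_elementaryz s a : bijective s -> act s (elementaryz a) = elementaryz a.
Proof. by move=> bs; case: a => a /=; [exact: act_elementary | rewrite raddf0]. Qed.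

Lemma f_series_symmetric r : symmetric_series (f_series r).
Proof.
apply/symmetricP => s bs; apply: seriesP => m /=.
apply: eq_fsbigr => n _.
have := congr1 (coef^~ m) (actM (elementaryz n) (elementaryz (n + r)) bs).
by rewrite !(act_elementaryz _ bs).
Qed.

Lemma restr_f_series N M r : (N <= M)%N ->
  restr N (f_series r) =
  \sum_(n < M.+1) restr N (elementary n) * restr N (elementaryz (n%:Z + r)).
Proof.
move=> NM; under eq_bigr => n _ do rewrite -rmorphM.
rewrite -raddf_sum; apply: seriesP => m; rewrite !coef_restr; case: ifP => // Nm.
rewrite [LHS](@fsum_seq _ _ (map Posz (iota 0 M.+1))) //.
- rewrite big_map scoef_sum -(big_mkord xpredT (fun n => coef (elementary n * elementaryz (n%:Z + r)) m)).
  by rewrite /index_iota subn0.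
- by rewrite map_inj_uniq ?iota_uniq // => x y [].
move=> n _ hn; rewrite -[LHS]/(coef (elementaryz n * elementaryz (n + r)) m).
case: n hn => n hn; last by rewrite -[elementaryz (Negz n)]/(0 : series) mul0r.
have Mn : (M < n)%N.
  by rewrite ltnNge; apply: contra hn => hn; apply: map_f; rewrite mem_iota.
rewrite -[elementaryz n]/(elementary n).
have := coef_restr N (elementary n * elementaryz (n%:Z + r)) m; rewrite Nm => <-.
by rewrite rmorphM [X in X * _]restr_elementary_gt ?mul0r // (leq_trans _ Mn).
Qed.

Lemma restr_elementaryzS N a :
  restr N.+1 (elementaryz a) = restr N (elementaryz a) + var N * restr N (elementaryz (a - 1)).
Proof.
case: a => [[|k]|k].
- rewrite -[elementaryz 0]/(elementary 0) -[elementaryz (_ - 1)]/(0 : series).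
  by rewrite elementary0 !rmorph1 rmorph0 mulr0 addr0.
- have -> : Posz k.+1 - 1 = k by lia.
  exact: restr_elementaryS.
- have -> : Negz k - 1 = Negz k.+1 by lia.
  by rewrite -![elementaryz (Negz _)]/(0 : series) !rmorph0 mulr0 addr0.
Qed.

(** The derivative lowers [e_n] to [e_(n-1)], and the product rule turns each product of [f_r] into
    one of [f_(r-1)] and one of [f_(r+1)]. It is carried out as the coefficient of [x_N] in [N + 1]
    variables. *)
Lemma dser_f_series r : dser (f_series r) = f_series (r - 1) + f_series (r + 1).
Proof.
apply: seriesP => m; have Nm := below_fresh m.
rewrite -[LHS]/(coef (f_series r) (fresh m +` m)); move: (fresh m) Nm => N Nm.
have -> : coef (f_series r) (N +` m) = coef (restr N.+1 (f_series r)) (N +` m).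
  by rewrite coef_restr belowD below_mset1 ltnSn (below_widen (leqnSn N) Nm).
pose ez := elementaryz.
pose B (n : 'I_N.+2) := ez n%:Z * ez (n%:Z + (r - 1)) + ez (n%:Z - 1) * ez (n%:Z + r).
have -> : coef (restr N.+1 (f_series r)) (N +` m) = coef (restr N (\sum_n B n)) m.
  rewrite (@restr_f_series _ N.+1) // scoef_sum coef_restr Nm scoef_sum.
  apply: eq_bigr => n _; rewrite -[elementary n]/(ez n%:Z) !restr_elementaryzS.
  rewrite (_ : n%:Z + r - 1 = n%:Z + (r - 1)); last by rewrite addrA.
  transitivity (coef (var N ^+ 0 * restr N (ez n%:Z * ez (n%:Z + r)) +
     var N ^+ 1 * restr N (B n) +
     var N ^+ 2 * restr N (ez (n%:Z - 1) * ez (n%:Z + (r - 1)))) (N +` m)).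
    congr (coef _ _); rewrite /B rmorphD !rmorphM /= /ez; ring.
  rewrite scoefD [X in X + _]scoefD (coef_var_head 0 _ Nm) (coef_var_head 1 _ Nm).
  by rewrite (coef_var_head 2 _ Nm) -![_%:R]/(0 : rat) mul1r !mul0r add0r addr0.
have -> : restr N (\sum_n B n) = restr N (f_series (r - 1) + f_series (r + 1)).
  rewrite raddf_sum /=; under eq_bigr => n _ do rewrite rmorphD !rmorphM /=.
  rewrite big_split /= rmorphD /= (@restr_f_series N N.+1 (r - 1)) //; congr (_ + _).
  rewrite big_ord_recl [X in X * _]raddf0 mul0r add0r (@restr_f_series N N) //.
  apply: eq_bigr => n _; rewrite lift0.
  have -> : n.+1%:Z - 1 = n%:Z by lia.
  by have -> : n.+1%:Z + r = n%:Z + (r + 1) by lia.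
by rewrite coef_restr Nm.
Qed.

Lemma iter_dser_seqT (F : int -> series) j a :
  (forall d, dser (F d) = seqT F d) -> iter j dser (F a) = iter j (@seqT series) F a.
Proof.
elim: j F a => // j IH F a hF; rewrite !iterSr hF IH //.
move=> d; rewrite -[LHS]/(iter 1 dser (F (d - 1) + F (d + 1))) iter_dserD.
by rewrite -[X in X + _]/(dser _) -[X in _ + X]/(dser _) !hF.
Qed.

End Derivation.

(** * Assembly *)

Lemma odd_columnsE n (la : int_partition) : (first_part la <= n)%N ->
  odd_columns la = (\sum_(p < n) odd (count (ltn p) la))%N.
Proof.
pose F p : nat := odd (count (ltn p) la); move=> h.
transitivity (\sum_(p < first_part la) F p)%N.
  rewrite /odd_columns /conj_part count_map -sum1_count big_mkcond /=.
  rewrite (iotaDl 1 0) big_map -(big_mkord xpredT F) /index_iota subn0.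
  by apply: eq_bigr => p _; rewrite /F /= add1n; case: odd.
rewrite (big_ord_widen n F h) big_mkcond; apply: eq_bigr => p _.
case: ltnP => // hp; rewrite -[RHS]/(F p) /F.
have -> : count (ltn p) la = 0%N; last by [].
apply/eqP; rewrite -leqn0 leqNgt -count_galois ?int_partition_sorted //.
by rewrite -leqNgt -first_part_nth.
Qed.

Section FiniteVariables.
Variable N : nat.

Definition elem_poly : {poly series} := \poly_(i < N.+1) restr N (elementary i).
Local Notation E := elem_poly.

Lemma coef_elem_poly i : E`_i = restr N (elementary i).
Proof. by rewrite coef_poly; case: ltnP => // h; rewrite restr_elementary_gt. Qed.

Lemma size_elem_poly : (size E <= N.+1)%N.
Proof. exact: size_poly. Qed.

Lemma horner_elem_poly x : E.[x] = \sum_(i < N.+1) restr N (elementary i) * x ^+ i.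
Proof.
rewrite (horner_coef_wide _ size_elem_poly).
by apply: eq_bigr => i _; rewrite coef_elem_poly.
Qed.

Lemma restr_ssum_nat (F : nat -> series) : (forall i, (N < i)%N -> restr N (F i) = 0) ->
  restr N (ssum [set: nat] F) = \sum_(i < N.+1) restr N (F i).
Proof.
move=> F0; apply: seriesP => m; rewrite coef_restr scoef_sum.
case: (boolP (below N m)) => Nm; last first.
  by rewrite big1 // => i _; rewrite coef_restr (negbTE Nm).
rewrite [LHS](@fsum_seq _ _ (iota 0 N.+1)) ?iota_uniq // => [|i _].
  rewrite -(big_mkord xpredT (fun i => coef (restr N (F i)) m)) /index_iota subn0.
  by apply: eq_bigr => i _; rewrite coef_restr Nm.
rewrite mem_iota add0n ltnS -ltnNge => /F0/(congr1 (coef^~ m)).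
by rewrite coef_restr Nm.
Qed.

Lemma restr_e_series : restr N e_series = E.[1].
Proof.
rewrite horner_elem_poly restr_ssum_nat => [|i]; last exact: restr_elementary_gt.
by apply: eq_bigr => i _; rewrite expr1n mulr1.
Qed.

Lemma restr_ebar_series : restr N ebar_series = E.[-1].
Proof.
rewrite horner_elem_poly restr_ssum_nat => [|i h]; last by rewrite rmorphM /= restr_elementary_gt ?mulr0.
by apply: eq_bigr => i _; rewrite rmorphM rmorphXn rmorphN1 mulrC.
Qed.

Lemma restr_f_series_autocorr (d : int) : restr N (f_series d) = autocorr E d.
Proof.
rewrite (autocorr_wide d size_elem_poly).
case: d => d.
  rewrite (@restr_f_series N N) //; apply: eq_bigr => i _.
  by rewrite !coef_elem_poly.
(* For a negative shift the first [d + 1] products contain an [e] of negative index; the sum is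
   prolonged by as many terms so that dropping them leaves the range of the autocorrelation. *)
rewrite (@restr_f_series N (d.+1 + N)) ?leq_addl // -addnS big_split_ord /= big1 ?add0r.
  apply: eq_bigr => i _; rewrite !coef_elem_poly mulrC.
  have -> : (d.+1 + i)%N%:Z + Negz d = i%:Z by lia.
  by rewrite [(d.+1 + i)%N]addnC.
move=> i _; have -> : i%:Z + Negz d = Negz (d - i) by have := ltn_ord i; lia.
by rewrite -[elementaryz _]/(0 : series) rmorph0 mulr0.
Qed.

End FiniteVariables.

Section Columns.
Variables (w r : nat).
Local Notation n := (w + w + r)%N.
Hypothesis n_gt0 : (0 < n)%N.

Definition cols_of M (a : {ffun 'I_n -> 'I_M}) : seq nat :=
  [seq (a q - (n.-1 - q))%N | q <- enum 'I_n].

Lemma size_cols_of M (a : {ffun 'I_n -> 'I_M}) : size (cols_of a) = n.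
Proof. by rewrite size_map size_enum_ord. Qed.

Lemma nth_cols_of M (a : {ffun 'I_n -> 'I_M}) (q : 'I_n) :
  nth 0%N (cols_of a) q = (a q - (n.-1 - q))%N.
Proof. by rewrite (nth_map q) ?size_enum_ord // nth_ord_enum. Qed.

Lemma decr_ge M (a : {ffun 'I_n -> 'I_M}) (q : 'I_n) : decr a -> (n.-1 - q <= a q)%N.
Proof.
move=> da; have hn : (n.-1 < n)%N by move: n_gt0; lia.
have qn : (q <= Ordinal hn)%N by rewrite /=; have := ltn_ord q; lia.
by have := decr_gap da qn; rewrite /=; lia.
Qed.

Lemma cols_of_sorted M (a : {ffun 'I_n -> 'I_M}) : decr a -> sorted geq (cols_of a).
Proof.
move=> da; apply: sorted_geqP => i; case: (ltnP i.+1 n) => hi; last first.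
  by rewrite nth_default ?size_cols_of.
have := nth_cols_of a (Ordinal hi); have := nth_cols_of a (Ordinal (ltnW hi)).
have := @decr_gap _ _ a (Ordinal (ltnW hi)) (Ordinal hi) da (leqnSn i).
rewrite /= => h -> ->; lia.
Qed.

Definition ptn_of_gaps M (a : {ffun 'I_n -> 'I_M}) : int_partition := ptn_of (cols_of a).

Lemma first_part_ptn_of_gaps M (a : {ffun 'I_n -> 'I_M}) : decr a ->
  (first_part (ptn_of_gaps a) <= n)%N.
Proof. by move=> da; apply: first_part_ptn_of; rewrite ?size_cols_of ?cols_of_sorted. Qed.

Lemma shifted_cols_ptn_of_gaps M (a : {ffun 'I_n -> 'I_M}) (q : 'I_n) : decr a ->
  shifted_cols (ptn_of_gaps a) q = a q.
Proof.
move=> da; rewrite /shifted_cols.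
have := nth_cj n (ptn_of_gaps a) q; rewrite ltn_ord => <-.
rewrite cj_ptn_of ?size_cols_of ?cols_of_sorted // nth_cols_of subnK //.
exact: decr_ge.
Qed.

(** [a p] is a column length plus [n.-1 - p]; adding [n.-1 - p] once more restores the parity of the
    column. *)
Lemma odd_columns_ptn_of_gaps M (a : {ffun 'I_n -> 'I_M}) : decr a ->
  odd_columns (ptn_of_gaps a) = odd_gaps a.
Proof.
move=> da; rewrite (odd_columnsE (first_part_ptn_of_gaps da)).
apply: eq_bigr => p _; rewrite -(shifted_cols_ptn_of_gaps p da) /shifted_cols.
move: (count _ _) (n.-1 - p)%N => x y; by rewrite -addnA addnn oddD odd_double addbF.
Qed.

Lemma ec_elem_poly N a b :
  ec (fun k => restr N (elementary k)) a b = ('X^b * elem_poly N)`_a.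
Proof. by rewrite coefXnM coef_elem_poly. Qed.

Lemma restr_schur_det N (a : 'I_n -> nat) :
  restr N (jt elementary a) = \det (\matrix_(p, q) ('X^(n.-1 - p) * elem_poly N)`_(a q)).
Proof.
rewrite restr_jt; congr (\det _); apply/matrixP => p q; rewrite !mxE.
exact: ec_elem_poly.
Qed.

(** Such an entry makes every index in its column exceed [N], where the restricted elementary
    functions vanish. It justifies the finite range ['I_M] of the decreasing sequences. *)
Lemma restr_schur_wide N (la : int_partition) (q : 'I_n) : (first_part la <= n)%N ->
  (N + n <= shifted_cols la q)%N -> restr N (schur la) = 0.
Proof.
move=> fp h; rewrite (jacobi_trudi fp) restr_schur_det (@det_col0 _ _ _ q) // => p.
rewrite mxE coefXnM coef_elem_poly; case: ifP => // _.
by rewrite restr_elementary_gt //; move: h n_gt0; lia.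
Qed.

(** Decreasing sequences correspond to partitions through their column lengths; the partitions whose
    shifted columns leave the range [M] restrict to 0 by [restr_schur_wide]. *)
Lemma restr_schur_sum N M c : (N + n <= M)%N ->
  restr N (schur_sum n c) =
  \sum_(a : {ffun 'I_n -> 'I_M} | decr a)
    \det (\matrix_(p, q) ('X^(n.-1 - p) * elem_poly N)`_(a q)) * (odd_gaps a == c)%:R.
Proof.
move=> NM; apply: seriesP => m; rewrite coef_restr scoef_sum.
rewrite (eq_bigr (fun a : {ffun 'I_n -> 'I_M} =>
  if odd_gaps a == c then coef (restr N (jt elementary (fun q => a q))) m else 0)); last first.
  move=> a _; rewrite restr_schur_det.
  by case: eqP => _; rewrite ?mulr1 ?mulr0.
case: (boolP (below N m)) => Nm; last first.
  by rewrite big1 // => a _; rewrite coef_restr (negbTE Nm) if_same.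
rewrite -big_mkcondr.
rewrite [LHS](@fsum_seq _ _
  [seq ptn_of_gaps a | a <- enum [pred a : {ffun 'I_n -> 'I_M} | decr a & odd_gaps a == c]]).
- rewrite big_map big_enum_cond; apply: eq_big => [a|a].
    by rewrite inE andbT.
  rewrite inE => /andP[/andP[da _] _].
  rewrite coef_restr Nm (jacobi_trudi (first_part_ptn_of_gaps da)).
  by congr (coef _ m); apply: eq_jt => q; rewrite shifted_cols_ptn_of_gaps.
- rewrite map_inj_in_uniq ?enum_uniq // => a b; rewrite !mem_enum !inE.
  move=> /andP[da _] /andP[db _] e; apply/ffunP => q; apply: val_inj.
  by rewrite /= -(shifted_cols_ptn_of_gaps q da) e shifted_cols_ptn_of_gaps.
- move=> la /mapP[a]; rewrite mem_enum inE => /andP[da /eqP oc] ->.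
  by split; rewrite ?odd_columns_ptn_of_gaps ?first_part_ptn_of_gaps.
move=> la [fp oc] hla.
have := coef_restr N (schur la) m; rewrite Nm => <-.
case: (boolP [exists q : 'I_n, (M <= shifted_cols la q)%N]) => [/existsP[q hq]|].
  by rewrite (@restr_schur_wide _ _ q) // (leq_trans NM).
rewrite negb_exists => /forallP hM; case/negP: hla.
have ltM (q : 'I_n) : (shifted_cols la q < M)%N by rewrite ltnNge.
pose a : {ffun 'I_n -> 'I_M} := [ffun q => Ordinal (ltM q)].
have aE (q : 'I_n) : a q = shifted_cols la q :> nat by rewrite ffunE.
have da : decr a.
  apply/decrP => p q pq; rewrite !aE /shifted_cols.
  by have := count_ltn_anti la (ltnW pq); have := ltn_ord q; lia.
have e : ptn_of_gaps a = la.
  rewrite /ptn_of_gaps (_ : cols_of a = cj n la) ?ptn_of_cj //.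
  apply: (@eq_from_nth _ 0%N); rewrite size_cols_of ?size_cj // => q qn.
  by rewrite (nth_cols_of a (Ordinal qn)) aE /shifted_cols addnK nth_cj qn.
apply/mapP; exists a; last by rewrite e.
by rewrite mem_enum inE da -odd_columns_ptn_of_gaps // e oc eqxx.
Qed.

Variables (eta : 'I_r -> int) (sig al be cc nu : int).
Hypothesis sc : sign_case eta sig al be cc nu.

(** [G c] stands for [e_series] or [ebar_series], the values of [E] at 1 and -1; restrictions to all
    finite sets of variables separate series. *)
Theorem schur_sum_det (G : 'I_r -> series) k :
  (forall N c, restr N (G c) = (elem_poly N).[(eta c)%:~R]) -> (k <= w)%N ->
  schur_sum n k + (sgprod eta)%:~R * schur_sum n (n - k) =
  (\prod_c G c) * (1 + ((r == 0%N) && (k == w))%:R) * psi_det r sig w f_series (w - k).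
Proof.
move=> hG kw; apply: restr_inj => N; pose M := (n + N.+1 + 4)%N.
have M_big : (n + size (elem_poly N) + 4 <= M)%N.
  by rewrite /M !leq_add2r leq_add2l size_elem_poly.
have NM : (N + n <= M)%N by rewrite /M; lia.
rewrite !rmorphM rmorphD rmorphM rmorph_int rmorphD /= !rmorph_nat rmorph1.
have -> : restr N (\prod_c G c) = \prod_c (elem_poly N).[(eta c)%:~R].
  by rewrite rmorph_prod; apply: eq_bigr => c _; exact: hG.
have -> : restr N (psi_det r sig w f_series (w - k)) = psi_det r sig w (autocorr (elem_poly N)) (w - k).
  rewrite /psi_det -det_map_mx; congr (\det _); apply/matrixP => i j; rewrite !mxE /psi.
  rewrite rmorphD rmorphM rmorph_int /=.
  by rewrite !(iter_seqT_morph j (fun d => esym (restr_f_series_autocorr N d))).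
rewrite -(gap_sum_det sc n_gt0 (@torsion_free_series) M_big kw) /gap_sum.
rewrite !(@restr_schur_sum N M) // mulr_sumr -big_split /=; apply: eq_bigr => a da.
rewrite mulrDr mulrCA; congr (_ + _ * (_ * _%:R)); congr (nat_of_bool _).
have : (odd_gaps a <= n)%N.
  rewrite /odd_gaps -[X in (_ <= X)%N](card_ord n) -sum1_card.
  by apply: leq_sum => p _; exact: leq_b1.
by lia.
Qed.

End Columns.

Lemma iter_p1perp_f j (a : int) :
  iter j p1perp (f_series a) = iter j (@seqT series) f_series a.
Proof.
rewrite (iter_p1perp j (f_series_symmetric a)).2.
exact/iter_dser_seqT/dser_f_series.
Qed.

Lemma iter_p1perp_fD j (a b : int) :
  iter j p1perp (f_series a + f_series b) =
  iter j (@seqT series) f_series a + iter j (@seqT series) f_series b.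
Proof.
have s : symmetric_series (f_series a + f_series b).
  apply/symmetricP => s bs; rewrite raddfD /=.
  by rewrite !(symmetricP _).1 //; exact: f_series_symmetric.
rewrite (iter_p1perp j s).2 iter_dserD.
by congr (_ + _); exact/iter_dser_seqT/dser_f_series.
Qed.

Lemma iter_p1perp_fB j (a b : int) :
  iter j p1perp (f_series a - f_series b) =
  iter j (@seqT series) f_series a - iter j (@seqT series) f_series b.
Proof.
have s : symmetric_series (f_series a - f_series b).
  apply/symmetricP => s bs; rewrite raddfB /=.
  by rewrite !(symmetricP _).1 //; exact: f_series_symmetric.
rewrite (iter_p1perp j s).2 iter_dserD iter_dserN.
by congr (_ - _); exact/iter_dser_seqT/dser_f_series.
Qed.

Lemma schur_sum00 : schur_sum 0 0 = 1.
Proof.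
pose la0 := ptn_of [::].
have e : schur la0 = 1 by rewrite (@jacobi_trudi 0) // /jt det_mx00.
apply: seriesP => m; rewrite -e [LHS](@fsum_seq _ _ [:: la0]) ?big_seq1 //.
  by move=> la; rewrite inE => /eqP ->.
move=> la [la0P _]; rewrite inE => /eqP; case.
by rewrite -(ptn_of_cj la0P).
Qed.

(* Matrix indices start at 0: the row i and the column j of the informal
   determinants are i.+1 and j.+1 (and i.+2 and j.+2 in the last one). *)
Theorem theorem1p6 (w k : nat) (hkw : (k <= w)%N) :
  [/\ schur_sum (2 * w + 1) k + schur_sum (2 * w + 1) (2 * w + 1 - k)
      = e_series * \det (\matrix_(i < w, j < w)
          iter j p1perp (f_series (i + (w - k < i.+1))%N
                         - f_series (i.+1 + (w - k < i.+1))%N)),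
      schur_sum (2 * w + 1) k - schur_sum (2 * w + 1) (2 * w + 1 - k)
      = ebar_series * \det (\matrix_(i < w, j < w)
          iter j p1perp (f_series (i + (w - k < i.+1))%N
                         + f_series (i.+1 + (w - k < i.+1))%N)),
      schur_sum (2 * w) k + schur_sum (2 * w) (2 * w - k)
      = 2 ^+ (k == w) * \det (\matrix_(i < w, j < w)
          iter j p1perp (f_series (i + (w - k < i.+1))%N))
    & (k < w)%N ->
      schur_sum (2 * w) k - schur_sum (2 * w) (2 * w - k)
      = e_series * ebar_series * \det (\matrix_(i < w.-1, j < w.-1)
          iter j p1perp (f_series (i + (w - k < i.+2))%N
                         - f_series (i.+2 + (w - k < i.+2))%N))].
Proof.
have n1 : (2 * w + 1 = w + w + 1)%N by lia.
have n0 : (2 * w = w + w + 0)%N by lia.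
have bumpE b i : bump b i = (i + (b < i.+1))%N by rewrite /bump addnC ltnS.
have sg1 s : sgprod (fun _ : 'I_1 => s) = s by rewrite /sgprod big_ord1.
have w1 : (0 < w + w + 1)%N by rewrite addn1.
split.
- have := schur_sum_det w1 (sign_case1 (expr1n _ 2)) (fun N _ => restr_e_series N) hkw.
  rewrite sg1 mul1r n1 => ->; rewrite big_ord1 addr0 mulr1; congr (_ * \det _).
  apply/matrixP => i j; rewrite !mxE iter_p1perp_fB /psi mulNr mul1r bumpE.
  by rewrite addn1 addSn.
- have h : (-1 : int) ^+ 2 = 1 by rewrite sqrrN.
  have := schur_sum_det w1 (sign_case1 h) (fun N _ => restr_ebar_series N) hkw.
  rewrite sg1 mulNr mul1r n1 => ->; rewrite big_ord1 addr0 mulr1; congr (_ * \det _).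
  apply/matrixP => i j; rewrite !mxE iter_p1perp_fD /psi opprK mul1r bumpE.
  by rewrite addn1 addSn.
(* For [w = 0] the general result, which needs a column, does not apply; both Schur sums are 1 and
   the factor [2 ^+ (k == w)] is 2. *)
- case: (posnP w) => [w0|w_gt0].
    move: hkw; rewrite w0 leqn0 => /eqP ->.
    by rewrite muln0 subnn schur_sum00 det_mx00 mulr1.
  have w2 : (0 < w + w + 0)%N by lia.
  have hG N (c : 'I_0) : restr N 1 = (elem_poly N).[1%:~R] by case: c.
  have := schur_sum_det w2 sign_case0 (G := fun=> 1) hG hkw.
  rewrite {1}/sgprod !big_ord0 !mul1r -n0 => ->; rewrite /psi_det; congr (_ * _); first by case: (k == w); rewrite ?addr0.
  congr (\det _).
  apply/matrixP => i j; rewrite !mxE iter_p1perp_f /psi mulr0z mul0r addr0.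
  by rewrite bumpE.
(* Two of the [2 * w] columns are taken by the border with both signs, which leaves [w.-1] pairs and
   requires [k < w]. *)
move=> kw; have kw' : (k <= w.-1)%N by lia.
have n2 : (2 * w = w.-1 + w.-1 + 2)%N by lia.
have w2 : (0 < w.-1 + w.-1 + 2)%N by rewrite addn2.
have hG N (c : 'I_2) : restr N (if c == ord0 then e_series else ebar_series) = (elem_poly N).[(pm c)%:~R].
  rewrite /pm; case: ifP => _; [exact: restr_e_series | exact: restr_ebar_series].
have sg2 : sgprod pm = -1 by rewrite /sgprod !big_ord_recl big_ord0 /pm /= mulr1 mul1r.
have := schur_sum_det w2 sign_case2 hG kw'.
rewrite sg2 mulNr mul1r -n2 => ->; rewrite !big_ord_recl big_ord0 /= mulr1 addr0 mulr1.
congr (_ * \det _); apply/matrixP => i j; rewrite !mxE iter_p1perp_fB /psi mulNr mul1r.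
have -> : bump (w.-1 - k) i = (i + (w - k < i.+2))%N by rewrite bumpE; lia.
by rewrite -addnA [(_ + 2)%N]addnC addnA addn2.
Qed.
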